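(* Let $M$ be the Markov-modulated Ornstein-Uhlenbeck process $$M(t)=m_0+\int_0^t(\alpha_{X(s)}-\gamma_{X(s)}M(s))\,\mathrm ds+\int_0^t\sigma_{X(s)}\,\mathrm dB(s),\qquad t\ge0,$$ with $m_0\in\mathbb R$. For $k\in\{0,1,2,\dots\}$ put $\boldsymbol H_k(t):=\mathbb E[M(t)^k\boldsymbol Z(t)]$. Then for every $k\ge 0$ and $t\ge0$ $$\frac{\mathrm d}{\mathrm dt}\boldsymbol H_k(t)=\left(Q^{\rm T}-k\,\mathrm{diag}\{\boldsymbol\gamma\}\right)\boldsymbol H_k(t)+k\,\mathrm{diag}\{\boldsymbol\alpha\}\boldsymbol H_{k-1}(t)+\tfrac12k(k-1)\,\mathrm{diag}\{\boldsymbol\sigma^2\}\boldsymbol H_{k-2}(t)$$ (terms with coefficient $0$ being absent). Consequently, for each $n$, with $\bar{\boldsymbol H}_n(t)$ the vector obtained by stacking $\boldsymbol H_0(t),\dots,\boldsymbol H_n(t)$ and $A_n\in\mathbb R^{(n+1)d\times(n+1)d}$ the lower block triangular coefficient matrix of these equations for $k=0,\dots,n$, one has $\bar{\boldsymbol H}_n(t)=e^{A_nt}\bar{\boldsymbol H}_n(0)$; and $\mathbb E[M(t)^k]=\mathbf 1^{\rm T}\boldsymbol H_k(t)$.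
   Context: $X$ is a continuous-time Markov chain on $\{1,\dots,d\}$ with generator $Q$ (arbitrary initial law); $B$ is a standard Brownian motion independent of $X$; $\alpha_i\in\mathbb R$, $\gamma_i>0$, $\sigma_i\in\mathbb R$ are collected in vectors $\boldsymbol\alpha,\boldsymbol\gamma,\boldsymbol\sigma$, and $\boldsymbol\sigma^2:=(\sigma_1^2,\dots,\sigma_d^2)^{\rm T}$. $\boldsymbol Z(t)\in\{0,1\}^d$ is the indicator vector of $X(t)$ ($Z_i(t)=1$ if $X(t)=i$, else $0$). $\mathbf 1$ is the all-ones vector. *)

(* Defs.v *)
From HB Require Import structures.
From mathcomp Require Import all_boot all_order all_algebra.
From mathcomp Require Import all_classical all_reals all_analysis.

Set Implicit Arguments.
Unset Strict Implicit.
Unset Printing Implicit Defensive.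

Import Order.TTheory GRing.Theory Num.Theory.
Import numFieldNormedType.Exports.

Local Open Scope classical_set_scope.
Local Open Scope ring_scope.

Definition expmx (R : realType) (n : nat) (A : 'M[R]_n) : 'M[R]_n :=
  \matrix_(i, j) limn (series (fun k => (k`!%:R)^-1 * (A ^+ k) i j)).

(* The derivative at [t >= 0], taken entrywise, of a vector function that is
   only meaningful on [0, +oo[: two-sided for [t > 0], from the right at 0. *)
Definition has_derivative_nonneg (R : realType) (m : nat)
    (f : R -> 'cV[R]_m) (t : R) (l : 'cV[R]_m) : Prop :=
  forall i : 'I_m,
    h^-1 * (f (t + h) i 0 - f t i 0)
      @[h --> within [set h | 0 <= t + h] 0^'] --> l i 0.

(* Processes are families indexed by [R] of which only the times [t >= 0]
   matter. *)
Section Processes.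
Context (disp : measure_display) (T : measurableType disp) (R : realType)
  (P : probability T R) (d : nat).
Implicit Types (X : R -> T -> 'I_d) (B M : R -> {RV P >-> R}).

Definition chain_events X (J : set R) : set (set T) :=
  [set E | exists2 s, J s & exists i : 'I_d, E = X s @^-1` [set i]].

Definition real_events B (J : set R) : set (set T) :=
  [set E | exists2 s, J s &
    exists2 U : set R, measurable U & E = B s @^-1` U].

Definition independent_sigma (G H : set (set T)) : Prop :=
  forall E F, <<s G >> E -> <<s H >> F -> P (E `&` F) = (P E * P F)%E.

Definition is_generator (Q : 'M[R]_d) : Prop :=
  (forall i j, i != j -> 0 <= Q i j) /\ (forall i, \sum_j Q i j = 0).

(* The last clause is the Markov property
   P(X_t = j | X_u, u <= s) = (e^((t-s)Q))_(X_s, j), integrated over the events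
   [E `&` {X_s = i}] with [E] in the past of [s]. *)
Definition is_markov_chain (Q : 'M[R]_d) X : Prop :=
  [/\ forall (t : R) i, 0 <= t -> measurable (X t @^-1` [set i]),
      {ae P, forall w, forall t : R, 0 <= t ->
        \forall s \near t^'+, X s w = X t w}
    & forall (s t : R) i j (E : set T), 0 <= s -> s <= t ->
        <<s chain_events X `[0, s] >> E ->
        (P (E `&` X s @^-1` [set i] `&` X t @^-1` [set j]) =
         P (E `&` X s @^-1` [set i]) * (expmx ((t - s) *: Q) i j)%:E)%E].

(* The second parameter of [normal_prob] is the standard deviation. *)
Definition is_brownian_motion B : Prop :=
  [/\ {ae P, forall w, B 0 w = 0},
      {ae P, forall w, {within `[0, +oo[, continuous (fun t : R => B t w)}},
      forall (s t : R) (U : set R), 0 <= s -> s < t -> measurable U ->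
        P ((fun w => B t w - B s w) @^-1` U)
          = normal_prob 0 (Num.sqrt (t - s)) U
    & forall s t : R, 0 <= s -> s < t ->
        independent_sigma
          [set E | exists2 U : set R, measurable U &
                     E = (fun w => B t w - B s w) @^-1` U]
          (real_events B `[0, s])].

Definition independent_chain_real X B : Prop :=
  independent_sigma (chain_events X `[0, +oo[) (real_events B `[0, +oo[).

(* The natural filtration of the pair [(X, B)]. *)
Definition joint_filtration X B (t : R) : set (set T) :=
  <<s chain_events X `[0, t] `|` real_events B `[0, t] >>.

(* The integrand \sum_(i < sp_size) sp_coef i 1_(sp_time i < s <= sp_time i.+1).
   *)
Record simple_process := SimpleProcess {
  sp_size : nat;
  sp_time : nat -> R;
  sp_coef : nat -> T -> R }.

Definition simple_adapted (F : R -> set (set T)) (S : simple_process) : Prop :=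
  [/\ 0 <= sp_time S 0%N,
      forall i, sp_time S i <= sp_time S i.+1,
      forall i, exists C : R, forall w, `|sp_coef S i w| <= C
    & forall i (U : set R), measurable U ->
        F (sp_time S i) (sp_coef S i @^-1` U)].

Definition simple_value (S : simple_process) (s : R) (w : T) : R :=
  \sum_(i < sp_size S)
    sp_coef S i w * ((sp_time S i < s) && (s <= sp_time S i.+1))%:R.

Definition simple_integral (S : simple_process) B (t : R) (w : T) : R :=
  \sum_(i < sp_size S)
    sp_coef S i w * (B (Num.min (sp_time S i.+1) t) w
                     - B (Num.min (sp_time S i) t) w).

(* [Y] is (a version of) the Ito integral over [0, t] of [H] against [B]: the
   L^2(P) limit of the integrals of simple [F]-adapted processes converging to
   [H] in L^2(P x ds). *)
Definition is_ito_integral (F : R -> set (set T)) B (H : R -> T -> R) (t : R)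
    (Y : T -> R) : Prop :=
  exists S : nat -> simple_process,
    [/\ forall n, simple_adapted F (S n),
        (\int[P]_w \int[lebesgue_measure]_(s in `[0%R, t])
           ((simple_value (S n) s w - H s w) ^+ 2)%R%:E)%E @[n --> \oo] --> 0%E
      & ('E_P[fun w => ((simple_integral (S n) B t w - Y w) ^+ 2)%R])%E
          @[n --> \oo] --> 0%E].

Definition is_mmou (alpha gamma sigma : 'cV[R]_d) (m0 : R) X B M : Prop :=
  {ae P, forall w, {within `[0, +oo[, continuous (fun t : R => M t w)}} /\
  exists I : R -> {RV P >-> R},
    (forall t : R, 0 <= t ->
       is_ito_integral (joint_filtration X B) B
         (fun s w => sigma (X s w) 0) t (I t)) /\
    (forall t : R, 0 <= t ->
       {ae P, forall w,
         M t w = m0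
           + \int[lebesgue_measure]_(s in `[0, t])
               (alpha (X s w) 0 - gamma (X s w) 0 * M s w)
           + I t w}).

Definition indic_state X (t : R) (w : T) : 'cV[R]_d :=
  \col_i (X t w == i)%:R.

Definition H_moment X M (k : nat) (t : R) : 'cV[R]_d :=
  \col_i fine ('E_P[fun w => (M t w ^+ k * indic_state X t w i 0)%R])%E.

End Processes.

Section MomentMatrix.
Context (R : realType) (d : nat) (Q : 'M[R]_d) (alpha gamma sigma : 'cV[R]_d).

Definition moment_block (k j : nat) : 'M[R]_d :=
  if j == k then Q^T - k%:R *: diag_mx gamma^T
  else if j.+1 == k then k%:R *: diag_mx alpha^T
  else if j.+2 == k then
    (2^-1 * k%:R * (k%:R - 1)) *: diag_mx (map_mx (fun x => x ^+ 2) sigma)^T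
  else 0.

Definition moment_mx (n : nat) : 'M[R]_(\sum_(k < n.+1) d) :=
  \mxblock_(k < n.+1, j < n.+1) moment_block k j.

End MomentMatrix.

Definition H_stack (disp : measure_display) (T : measurableType disp)
    (R : realType) (P : probability T R) (d : nat) (X : R -> T -> 'I_d)
    (M : R -> {RV P >-> R}) (n : nat) (t : R) : 'cV[R]_(\sum_(k < n.+1) d) :=
  \mxcol_(k < n.+1) H_moment X M k t.

(* Main.v *)
(* Instead of Ito's formula, the proof discretizes time. On the grid of mesh h, the
   Euler scheme Y_{j+1} = Y_j + h (alpha - gamma Y_j) + sigma (B_{(j+1)h} - B_{jh}),
   with coefficients taken at X_{jh}, is adapted; by the independence of X and B and
   the Markov property, the stacked vectors u_j of the moments E[Y_j^k Z(jh)], k <= n,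
   satisfy a linear recursion u_{j+1} = (1 + h A_n + O(h^{3/2})) u_j, because
   the increments of B have mean 0, variance h and q-th moments O(h^{q/2}). Hence the
   moments of the scheme at time t converge to e^{A_n t} u_0.

   On the other hand, X leaves its grid value during a proportion O(h) of the time on
   average, so the Ito isometry puts the stochastic integral of sigma(X) within
   O(h^{1/2}) in L^2 of that of its grid version, and a pathwise Gronwall inequality
   shows that the scheme tends to M(t) almost surely along the meshes t / 4^l. The
   2k-th moments of the scheme are bounded, so Fatou's lemma and uniform integrability
   carry the k-th moments to the limit. The differential equation is then that of the
   flow e^{A_n t}. *)

Require Import Defs.
From HB Require Import structures.
From mathcomp Require Import all_boot all_order all_algebra.
From mathcomp Require Import all_classical all_reals all_analysis.
From mathcomp Require Import measurable_realfun.
From mathcomp Require Import ring lra.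

Set Implicit Arguments.
Unset Strict Implicit.
Unset Printing Implicit Defensive.

Import Order.TTheory GRing.Theory Num.Theory.
Import numFieldNormedType.Exports.

Local Open Scope classical_set_scope.
Local Open Scope ring_scope.

(** * Matrix exponentials and linear recursions *)

(** No moment of [M] is known to exist beforehand, and this shapes the argument: bounds that involve
    [M] (its supremum and its modulus of continuity on [[0, t]]) are used path by path, and
    expectations are taken only of quantities that do not contain [M], namely the time [X] spends
    away from its grid values and the error of the stochastic integral. Hence the comparison of the
    scheme with [M] is almost sure, and the integrability of the powers of [M] comes out only at the
    end, from moment bounds for the scheme that are themselves read off from the convergence to the
    flow. The recursion closes because the drift is affine and the noise does not depend on [M]:
    given the state, the mean of the [k]-th power after one step is a polynomial of degree at most
    [k] in the present value. The stochastic integral is accessible only as an L^2 limit of simple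
    integrals with arbitrary partition times. The isometry is therefore proved for finite families
    of intervals that may overlap, which covers the difference between a simple integral and a grid
    sum without any common refinement. *)

Ltac nonneg := repeat (first [ assumption | done | match goal with
  | |- is_true (0 <= _ ^+ 2) => exact: sqr_ge0
  | |- is_true (0 <= `|_|) => exact: normr_ge0
  | |- is_true (0 <= expR _) => exact: expR_ge0
  | |- is_true (0 <= Num.sqrt _) => exact: sqrtr_ge0
  | |- is_true (0 <= _ ^+ _) => apply: exprn_ge0
  | |- is_true (0 <= _ ^-1) => rewrite invr_ge0
  | |- is_true (0 <= _ + _) => apply: addr_ge0
  | |- is_true (0 <= _ * _) => apply: mulr_ge0
  | |- is_true (0 <= \sum_(_ <- _ | _) _) => apply: sumr_ge0 => ? _
  end]).

Lemma cvgn_sum (R : realType) (I : Type) (r : seq I) (f : I -> nat -> R)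
    (l : I -> R) : (forall i, f i @ \oo --> l i) ->
  (fun n => \sum_(i <- r) f i n) @ \oo --> \sum_(i <- r) l i.
Proof.
move=> fl; elim: r => [|i r IH].
  by rewrite big_nil; under eq_fun do rewrite big_nil; exact: cvg_cst.
rewrite big_cons; under eq_fun do rewrite big_cons.
exact: cvgD.
Qed.

Section MatrixExponential.
Context (R : realType) (m : nat) (A : 'M[R]_m).

Definition mxnorm1 := \sum_i \sum_j `|A i j|.
Local Notation c := mxnorm1.

Lemma mxnorm1_ge0 : 0 <= c.
Proof. by apply: sumr_ge0 => i _; apply: sumr_ge0. Qed.

Lemma le_row_mxnorm1 i : \sum_j `|A i j| <= c.
Proof.
rewrite /mxnorm1 [leRHS](bigD1 i)//= lerDl.
by apply: sumr_ge0 => k _; apply: sumr_ge0.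
Qed.

Lemma normr_expmx_coef k i j : `|(A ^+ k) i j| <= c ^+ k.
Proof.
elim: k i j => [|k IH] i j.
  by rewrite !expr0 mxE; case: (i == j); rewrite ?normr1 ?normr0.
rewrite exprS mxE (le_trans (ler_norm_sum _ _ _))//.
rewrite exprS; apply: (@le_trans _ _ (\sum_l `|A i l| * c ^+ k)).
  by apply: ler_sum => l _; rewrite normrM ler_wpM2l.
by rewrite -mulr_suml ler_wpM2r ?le_row_mxnorm1// exprn_ge0// mxnorm1_ge0.
Qed.

Lemma expr_scalemx (t : R) k : (t *: A) ^+ k = t ^+ k *: A ^+ k.
Proof.
elim: k => [|k IH]; first by rewrite !expr0 scale1r.
by rewrite !exprS IH -[LHS]/(_ *m _) -scalemxAl -scalemxAr scalerA.
Qed.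

Definition expmx_term (t : R) i j k : R := (k`!%:R)^-1 * (t ^+ k * (A ^+ k) i j).

Lemma normr_expmx_term t i j k : `|expmx_term t i j k| <= exp_coeff (c * `|t|) k.
Proof.
rewrite /expmx_term /exp_coeff/= mulrC normrM [X in _ * X]ger0_norm ?invr_ge0//.
rewrite ler_wpM2r ?invr_ge0// normrM normrX exprMn mulrC ler_wpM2r ?exprn_ge0//.
exact: normr_expmx_coef.
Qed.

Lemma expmx_term_cvg t i j :
  series (expmx_term t i j) @ \oo --> expmx (t *: A) i j.
Proof.
have -> : expmx (t *: A) i j = limn (series (expmx_term t i j)).
  rewrite /expmx mxE; congr (limn (series _)); apply/funext => k.
  by rewrite expr_scalemx mxE.
apply: normed_cvg.
apply: (@series_le_cvg _ _ (exp_coeff (c * `|t|))) => //.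
- by move=> n; apply: normr_ge0.
- by move=> n; rewrite exp_coeff_ge0// mulr_ge0 ?mxnorm1_ge0.
- by move=> n; apply: normr_expmx_term.
- exact: is_cvg_series_exp_coeff.
Qed.

(** The remainders satisfy r_(k+1) = (t + h) r_k + k h^2 t^(k-1). Their sign allows the Taylor
    remainder of a matrix exponential to be compared term by term with that of a scalar one. *)
Lemma expr_step_ge0 (t h : R) k : 0 <= t -> 0 <= h ->
  0 <= (t + h) ^+ k - t ^+ k - k%:R * h * t ^+ k.-1.
Proof.
move=> t0 h0; elim: k => [|k IH].
  by rewrite /= !expr0 subrr !mul0r subrr.
have -> : (t + h) ^+ k.+1 - t ^+ k.+1 - k.+1%:R * h * t ^+ k.+1.-1 =
   (t + h) * ((t + h) ^+ k - t ^+ k - k%:R * h * t ^+ k.-1)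
     + k%:R * h ^+ 2 * t ^+ k.-1.
  rewrite !exprS /=; case: k IH => [|k] IH; first by rewrite /= !expr0; ring.
  by rewrite /= !exprS -[k.+2%:R]natr1; ring.
by rewrite addr_ge0 // mulr_ge0 // ?addr_ge0 // ?mulr_ge0 // exprn_ge0.
Qed.

(** Termwise differentiation of an exponential series: k / k! = 1 / (k-1)!, and the term k = 0,
    where [k.-1] is 0, is cancelled by its factor k. *)
Lemma series_diff_shift (a : nat -> R) (t : R) n :
  series (fun k => (k`!%:R)^-1 * (k%:R * t ^+ k.-1 * a k)) n.+1
  = series (fun k => (k`!%:R)^-1 * (t ^+ k * a k.+1)) n.
Proof.
rewrite /series /= big_nat_recl//= mul0r mul0r mulr0 add0r.
apply: eq_bigr => k _; rewrite factS natrM invfM.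
have : k.+1%:R != 0 :> R by rewrite pnatr_eq0.
by move: (k.+1%:R) (k`!%:R^-1) => x y x0; field.
Qed.

(** For x >= 1 the right-hand side is already at least e^x; for x < 1, multiply (1 - x) e^x <= 1 by
    1 + x. *)
Lemma expR_step (x : R) : 0 <= x -> expR x - 1 - x <= x ^+ 2 * expR x.
Proof.
move=> x0; have [x1|x1] := leP 1 x.
  have : expR x <= x ^+ 2 * expR x.
    by rewrite ler_peMl ?expR_ge0// exprn_ege1.
  by lra.
have h : (1 - x) * expR x <= 1.
  have := expR_ge1Dx (- x); rewrite expRN => h.
  by rewrite -ler_pdivlMr ?expR_gt0// div1r.
have : (1 + x) * ((1 - x) * expR x) <= (1 + x) * 1 by rewrite ler_wpM2l//; lra.
nra.
Qed.

(** Each term of the remainder is a nonnegative scalar times an entry of [A ^+ k], and such an entry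
    is at most [c ^+ k] in absolute value. The remainder is therefore dominated by that of the
    scalar function e^(ct), to which [expR_step] applies. *)
Lemma expmx_step (t h : R) i j : 0 <= t -> 0 <= h ->
  `|expmx ((t + h) *: A) i j - expmx (t *: A) i j
     - h * (A *m expmx (t *: A)) i j| <= (c * h) ^+ 2 * expR (c * (t + h)).
Proof.
move=> t0 h0; have c0 := mxnorm1_ge0.
pose D k := (k`!%:R)^-1 * (k%:R * t ^+ k.-1 * (A ^+ k) i j).
pose Dc k := (k`!%:R)^-1 * (k%:R * t ^+ k.-1 * c ^+ k).
have cD : series D @ \oo --> (A *m expmx (t *: A)) i j.
  rewrite -(cvg_shiftn 1)/=.
  have -> : (fun n => series D (n + 1)%N) =
     (fun n => \sum_l A i l * series (expmx_term t l j) n).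
    apply/funext => n; rewrite addn1 series_diff_shift /series/=.
    under [RHS]eq_bigr do rewrite mulr_sumr.
    rewrite exchange_big/=; apply: eq_bigr => k _.
    rewrite exprS mxE 2!mulr_sumr; apply: eq_bigr => l _.
    by rewrite /expmx_term; ring.
  rewrite mxE; apply: cvgn_sum => l; apply: cvgMl_tmp.
  exact: expmx_term_cvg.
have cDc : series Dc @ \oo --> c * expR (c * t).
  rewrite -(cvg_shiftn 1)/=.
  have -> : (fun n => series Dc (n + 1)%N) =
     (fun n => c * series (exp_coeff (c * t)) n).
    apply/funext => n; rewrite addn1 series_diff_shift /series/= mulr_sumr.
    apply: eq_bigr => k _.
    by rewrite exprS /exp_coeff/= exprMn; ring.
  apply: cvgMl_tmp; exact: is_cvg_series_exp_coeff.
have l1 : (fun n => series (expmx_term (t + h) i j) n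
     - series (expmx_term t i j) n - h * series D n) @ \oo -->
   expmx ((t + h) *: A) i j - expmx (t *: A) i j - h * (A *m expmx (t *: A)) i j.
  by apply: cvgB; [apply: cvgB; apply: expmx_term_cvg|apply: cvgMl_tmp].
have l2 : (fun n => series (exp_coeff (c * (t + h))) n
     - series (exp_coeff (c * t)) n - h * series Dc n) @ \oo -->
   expR (c * (t + h)) - expR (c * t) - h * (c * expR (c * t)).
  by apply: cvgB; [apply: cvgB; exact: is_cvg_series_exp_coeff|apply: cvgMl_tmp].
apply: (@le_trans _ _ (expR (c * (t + h)) - expR (c * t) - h * (c * expR (c * t)))).
  apply: (@ler_cvg_to _ _ _ _ _ _ _ _ (cvg_norm l1) l2).
  near=> n; rewrite /series/= !mulr_sumr -!sumrB (le_trans (ler_norm_sum _ _ _))//.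
  apply: ler_sum => k _.
  rewrite /expmx_term /D /Dc /exp_coeff/=.
  have -> : (k`!%:R)^-1 * ((t + h) ^+ k * (A ^+ k) i j)
      - (k`!%:R)^-1 * (t ^+ k * (A ^+ k) i j)
      - h * ((k`!%:R)^-1 * (k%:R * t ^+ k.-1 * (A ^+ k) i j))
    = (k`!%:R)^-1 * (((t + h) ^+ k - t ^+ k - k%:R * h * t ^+ k.-1)
      * (A ^+ k) i j) by ring.
  have -> : (c * (t + h)) ^+ k / k`!%:R - (c * t) ^+ k / k`!%:R
     - h * ((k`!%:R)^-1 * (k%:R * t ^+ k.-1 * c ^+ k))
    = (k`!%:R)^-1 * (((t + h) ^+ k - t ^+ k - k%:R * h * t ^+ k.-1) * c ^+ k).
    by rewrite !exprMn; ring.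
  rewrite normrM ger0_norm ?invr_ge0// ler_wpM2l ?invr_ge0//.
  rewrite normrM ger0_norm ?expr_step_ge0// ler_wpM2l ?expr_step_ge0//.
  exact: normr_expmx_coef.
rewrite mulrDr expRD.
have := @expR_step (c * h) (mulr_ge0 c0 h0).
have := expR_ge0 (c * t).
set a := expR (c * t); set b := expR (c * h) => a0 hb.
have : a * (b - 1 - c * h) <= a * ((c * h) ^+ 2 * b) by rewrite ler_wpM2l.
nra.
Unshelve. all: end_near. Qed.

Lemma expmx0 : expmx (0 *: A) = 1%:M.
Proof.
apply/matrixP => i j; rewrite mxE.
apply/cvg_lim => //; rewrite -(cvg_shiftn 1)/=.
rewrite (_ : (fun _ => _) = fun=> (1%:M : 'M[R]_m) i j); first exact: cvg_cst.
apply/funext => n; rewrite addn1 /series /= big_nat_recl// big1 ?addr0.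
  by rewrite fact0 invr1 mul1r expr0.
by move=> k _; rewrite expr_scalemx expr0n/= scale0r mxE mulr0.
Qed.

End MatrixExponential.

Lemma eq_ler (R : numDomainType) (x y : R) : x = y -> x <= y.
Proof. by move->. Qed.

Section VectorNorm.
Context (R : realType) (m : nat).
Implicit Types (v w : 'cV[R]_m) (A : 'M[R]_m).

Definition vnorm1 v := \sum_i `|v i 0|.

Lemma vnorm1_ge0 v : 0 <= vnorm1 v.
Proof. exact: sumr_ge0. Qed.

Lemma ler_vnorm1D v w : vnorm1 (v + w) <= vnorm1 v + vnorm1 w.
Proof.
by rewrite /vnorm1 -big_split/= ler_sum// => i _; rewrite mxE ler_normD.
Qed.

Lemma vnorm1Z (a : R) v : vnorm1 (a *: v) = `|a| * vnorm1 v.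
Proof.
by rewrite /vnorm1 mulr_sumr; apply: eq_bigr => i _; rewrite mxE normrM.
Qed.

Lemma ler_coord_vnorm1 v i : `|v i 0| <= vnorm1 v.
Proof. by rewrite /vnorm1 (bigD1 i)//= lerDl sumr_ge0. Qed.

Lemma vnorm1_mulmx A v : vnorm1 (A *m v) <= mxnorm1 A * vnorm1 v.
Proof.
rewrite /mxnorm1 mulr_suml; apply: ler_sum => i _; rewrite mxE.
rewrite (le_trans (ler_norm_sum _ _ _))// mulr_suml; apply: ler_sum => j _.
by rewrite normrM ler_wpM2l// ler_coord_vnorm1.
Qed.

End VectorNorm.

Lemma discrete_gronwall (R : realType) (x : nat -> R) (b q : R) n :
  0 <= b -> 0 <= q -> 0 <= x 0%N ->
  (forall j, (j < n)%N -> x j.+1 <= (1 + b) * x j + q) ->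
  forall j, (j <= n)%N -> x j <= expR (b * j%:R) * (x 0%N + j%:R * q).
Proof.
move=> b0 q0 x0 H; elim=> [|j IH] jn; first by rewrite mulr0 expR0 mul1r mul0r addr0.
rewrite (le_trans (H j jn))//.
have {}IH := IH (ltnW jn).
have e1 : 1 <= expR (b * j.+1%:R) by rewrite -expR0 ler_expR mulr_ge0.
have eb : 1 + b <= expR b := expR_ge1Dx b.
have -> : expR (b * j.+1%:R) * (x 0%N + j.+1%:R * q) =
   expR b * (expR (b * j%:R) * (x 0%N + j%:R * q)) + expR (b * j.+1%:R) * q.
  have -> : j.+1%:R = j%:R + 1 :> R by rewrite natr1.
  by rewrite [b * (_ + 1)]mulrDr mulr1 expRD; ring.
apply: lerD; last by rewrite ler_peMl.
apply: (@le_trans _ _ ((1 + b) * (expR (b * j%:R) * (x 0%N + j%:R * q)))).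
  by rewrite ler_wpM2l// addr_ge0.
by rewrite ler_wpM2r// mulr_ge0 ?expR_ge0// addr_ge0// mulr_ge0.
Qed.

Section ExponentialFlow.
Context (R : realType) (m : nat) (A : 'M[R]_m) (v : 'cV[R]_m).
Local Notation c := (mxnorm1 A).
Local Notation y t := (expmx (t *: A) *m v).

(** This local error of the exact flow serves twice: for the derivative of the flow, and for the
    comparison with a perturbed Euler recursion. *)
Lemma expmx_flow_step (T : R) : exists2 K : R, 0 <= K &
  forall t h : R, 0 <= t -> 0 <= h -> t + h <= T ->
    vnorm1 (y (t + h) - y t - h *: (A *m y t)) <= K * h ^+ 2.
Proof.
exists (m%:R * (c ^+ 2 * expR (c * T) * vnorm1 v)).
  by rewrite !mulr_ge0 ?exprn_ge0 ?mxnorm1_ge0 ?expR_ge0 ?vnorm1_ge0.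
move=> t h t0 h0 thT.
have -> : y (t + h) - y t - h *: (A *m y t) =
    (expmx ((t + h) *: A) - expmx (t *: A) - h *: (A *m expmx (t *: A))) *m v.
  by rewrite !mulmxBl -scalemxAl mulmxA.
set D := _ - _ - _.
have DE i j : `|D i j| <= c ^+ 2 * expR (c * T) * h ^+ 2.
  have := expmx_step A i j t0 h0; rewrite /D !mxE => /le_trans; apply.
  rewrite exprMn mulrAC ler_wpM2r ?sqr_ge0// ler_wpM2l ?sqr_ge0//.
  by rewrite ler_expR ler_wpM2l ?mxnorm1_ge0.
rewrite /vnorm1 (le_trans (y := \sum_(i < m) (c ^+ 2 * expR (c * T) * h ^+ 2 * vnorm1 v)))//.
  apply: ler_sum => i _; rewrite mxE (le_trans (ler_norm_sum _ _ _))//.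
  rewrite /vnorm1 mulr_sumr; apply: ler_sum => j _.
  by rewrite normrM ler_wpM2r.
rewrite sumr_const card_ord -[_ *+ m]mulr_natl; rewrite -/(vnorm1 v); apply: eq_ler.
  ring.
Qed.

Lemma expmx_flow0 : y 0 = v.
Proof. by rewrite expmx0 mul1mx. Qed.

Lemma expmx_flow_bounded (T : R) : exists2 U : R, 0 <= U &
  forall t : R, 0 <= t -> t <= T -> vnorm1 (y t) <= U.
Proof.
have [K K0 KP] := expmx_flow_step T.
exists (K * T ^+ 2 + (1 + `|T| * c) * vnorm1 v).
  by have := mxnorm1_ge0 A; have := vnorm1_ge0 v => *; nonneg.
move=> t t0 tT.
have := KP 0 t (lexx _) t0; rewrite add0r expmx_flow0 => /(_ tT).
set r := y t - v - _ => rK.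
have -> : y t = r + (v + t *: (A *m v)) by rewrite /r -[_ - v - _]addrA -opprD subrK.
rewrite (le_trans (ler_vnorm1D _ _))// lerD//.
  by rewrite (le_trans rK)// ler_wpM2l// lerXn2r ?nnegrE// (le_trans t0).
rewrite (le_trans (ler_vnorm1D _ _))// mulrDl mul1r lerD2l vnorm1Z -mulrA.
apply: ler_pM => //; [exact: vnorm1_ge0| |exact: vnorm1_mulmx].
by rewrite !ger0_norm// (le_trans t0).
Qed.

(** The step estimate only goes forward in time. A backward increment at [t] is a forward one issued
    from [t + h], at the price of replacing the slope at [t + h] by the slope at [t]. *)
Lemma expmx_flow_has_derivative (f : R -> 'cV[R]_m) :
  (forall t, 0 <= t -> f t = y t) ->
  forall t, 0 <= t -> has_derivative_nonneg f t (A *m f t).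
Proof.
move=> fE t t0 i.
have [K K0 KP] := expmx_flow_step (t + 1).
have [U U0 UP] := expmx_flow_bounded (t + 1).
have c0 := mxnorm1_ge0 A.
have stepE s h : 0 <= s -> 0 <= h -> s + h <= t + 1 ->
    `|f (s + h) i 0 - f s i 0 - h * (A *m f s) i 0| <= K * h ^+ 2.
  move=> s0 h0 sh; rewrite !fE ?addr_ge0//.
  rewrite (le_trans _ (KP s h s0 h0 sh))// (le_trans _ (ler_coord_vnorm1 _ i))//.
  by rewrite !mxE.
have lipE s h : 0 <= s -> 0 <= h -> h <= 1 -> s + h <= t + 1 ->
    `|(A *m f (s + h)) i 0 - (A *m f s) i 0| <= c * (K + c * U) * h.
  move=> s0 h0 h1 sh; rewrite !fE ?addr_ge0//.
  have -> : (A *m y (s + h)) i 0 - (A *m y s) i 0 = (A *m (y (s + h) - y s)) i 0.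
    by rewrite mulmxBr; apply/esym; rewrite mxE; congr (_ + _); rewrite mxE.
  rewrite (le_trans (ler_coord_vnorm1 _ i))// (le_trans (vnorm1_mulmx _ _))//.
  rewrite -mulrA ler_wpM2l//.
  have -> : y (s + h) - y s = (y (s + h) - y s - h *: (A *m y s)) + h *: (A *m y s).
    by rewrite subrK.
  rewrite (le_trans (ler_vnorm1D _ _))// mulrDl lerD//.
    rewrite (le_trans (KP s h s0 h0 sh))// ler_wpM2l// expr2.
    by rewrite ler_piMl.
  rewrite vnorm1Z ger0_norm// mulrC ler_wpM2r//.
  rewrite (le_trans (vnorm1_mulmx _ _))// ler_wpM2l//.
  by apply: UP => //; rewrite (le_trans _ sh)// lerDl.
(* [K] is the constant of the step estimate; [c * (K + c * U)] is a Lipschitz constant of the slope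
   for steps of length at most 1, used when [h] is negative. *)
set L := K + c * (K + c * U).
have L0 : 0 <= L by rewrite !addr_ge0 ?mulr_ge0 ?addr_ge0 ?mulr_ge0.
apply/cvgrPdist_le => e e0.
have ePos : 0 < Num.min 1 (e / (L + 1)).
  by rewrite lt_min ltr01 divr_gt0// ltr_wpDl.
rewrite near_withinE.
near=> h => th.
have hn0 : h != 0 by near: h; exact: nbhs_dnbhs_neq.
have hd : `|h| < Num.min 1 (e / (L + 1)).
  near: h; apply: dnbhs0_lt => //.
have h1 : `|h| <= 1 by rewrite ltW// (lt_le_trans hd)// ge_min lexx.
have hL : L * `|h| <= e.
  rewrite (@le_trans _ _ ((L + 1) * `|h|))// ?ler_wpM2r ?lerDl//.
  rewrite mulrC -ler_pdivlMr ?ltr_wpDl// ltW// (lt_le_trans hd)// ge_min lexx orbT.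
  by [].
apply: le_trans hL; rewrite distrC.
have hK : `|f (t + h) i 0 - f t i 0 - h * (A *m f t) i 0| <= L * `|h| ^+ 2.
  have [hp|hn] := leP 0 h.
    rewrite (le_trans (stepE t h t0 hp _))//; first by rewrite lerD2l (le_trans (ler_norm _)).
    rewrite ger0_norm// ler_wpM2r ?sqr_ge0// lerDl.
    by rewrite mulr_ge0// addr_ge0// mulr_ge0.
  have nh0 : 0 <= - h by rewrite oppr_ge0 ltW.
  have tE : t + h + - h = t by rewrite addrK.
  have nhE : `|h| = - h by rewrite ltr0_norm.
  have := stepE (t + h) (- h) th nh0; rewrite tE => /(_ ltac:(by rewrite lerDl))s1.
  have := lipE (t + h) (- h) th nh0; rewrite tE -nhE => /(_ h1 ltac:(by rewrite lerDl))s2.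
  have -> : f (t + h) i 0 - f t i 0 - h * (A *m f t) i 0 =
     - (f t i 0 - f (t + h) i 0 - - h * (A *m f (t + h)) i 0)
     + (- h) * ((A *m f t) i 0 - (A *m f (t + h)) i 0) by ring.
  rewrite (le_trans (ler_normD _ _))// normrN /L mulrDl lerD//.
    by rewrite (le_trans s1)// nhE.
  rewrite normrM normrN expr2 [leRHS]mulrCA ler_wpM2l//.
have -> : h^-1 * (f (t + h) i 0 - f t i 0) - (A *m f t) i 0 =
   h^-1 * (f (t + h) i 0 - f t i 0 - h * (A *m f t) i 0).
  by rewrite [in RHS]mulrBr mulKf.
rewrite normrM normfV mulrC ler_pdivrMr ?normr_gt0// -mulrA -expr2//.
Unshelve. all: end_near. Qed.

(* [w] stays below [e^(at) |v|], so each step of [w - y] adds an error of order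
   [h^(3/2)]; there are [t / h] steps. *)
Lemma euler_scheme_cvg (C t : R) : 0 <= C -> exists2 K : R, 0 <= K &
  forall n h (w : nat -> 'cV[R]_m), 0 <= h -> h <= 1 -> n%:R * h = t -> w 0%N = v ->
    (forall j, (j < n)%N -> vnorm1 (w j.+1 - w j - h *: (A *m w j))
       <= C * (h * Num.sqrt h) * vnorm1 (w j)) ->
    vnorm1 (w n - y t) <= K * Num.sqrt h.
Proof.
move=> C0.
have [K K0 KP] := expmx_flow_step t.
have c0 := mxnorm1_ge0 A.
pose U := expR ((c + C) * t) * vnorm1 v.
exists (expR (c * t) * (`|t| * (C * U + K))).
  by rewrite !mulr_ge0 ?expR_ge0// addr_ge0// !mulr_ge0 ?expR_ge0 ?vnorm1_ge0.
move=> n h w h0 h1 nht w0 wS.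
have s0 : 0 <= Num.sqrt h := sqrtr_ge0 h.
have s1 : Num.sqrt h <= 1 by rewrite -[leRHS]sqrtr1 ler_wsqrtr.
have hs : h * Num.sqrt h <= h by rewrite ler_piMr.
have stepw j : w j.+1 = (w j.+1 - w j - h *: (A *m w j)) + (w j + h *: (A *m w j)).
  by rewrite -[_ - w j - _]addrA -opprD subrK.
have Aw (x : 'cV[R]_m) : vnorm1 (x + h *: (A *m x)) <= (1 + c * h) * vnorm1 x.
  rewrite (le_trans (ler_vnorm1D _ _))// mulrDl mul1r lerD2l vnorm1Z ger0_norm//.
  by rewrite [c * h]mulrC -mulrA ler_wpM2l// vnorm1_mulmx.
have jnt j : (j <= n)%N -> j%:R * h <= t by move=> jn; rewrite -nht ler_wpM2r// ler_nat.
have wU j : (j <= n)%N -> vnorm1 (w j) <= U.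
  move=> jn.
  have := @discrete_gronwall R (fun j => vnorm1 (w j)) ((c + C) * h) 0 n.
  rewrite mulr_ge0 ?addr_ge0// => /(_ isT (lexx _) (vnorm1_ge0 _)) G.
  have {}G := G _ j jn; rewrite (le_trans (G _))//.
    move=> k kn; rewrite stepw (le_trans (ler_vnorm1D _ _))// addr0.
    have := wS k kn; have := Aw (w k).
    have : C * (h * Num.sqrt h) * vnorm1 (w k) <= C * h * vnorm1 (w k).
      by rewrite ler_wpM2r ?vnorm1_ge0// ler_wpM2l.
    by nra.
  rewrite mulr0 addr0 w0 /U ler_wpM2r ?vnorm1_ge0// ler_expR.
  by rewrite -mulrA [h * _]mulrC ler_wpM2l ?addr_ge0// jnt.
pose e j := vnorm1 (w j - y (j%:R * h)).
have := @discrete_gronwall R e (c * h) ((C * U + K) * (h * Num.sqrt h)) n.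
have -> : e 0%N = 0.
  by rewrite /e mul0r expmx_flow0 w0 subrr /vnorm1 big1// => i _; rewrite mxE normr0.
rewrite mulr_ge0// => /(_ isT); rewrite mulr_ge0 ?mulr_ge0 ?addr_ge0 ?mulr_ge0 ?expR_ge0 ?vnorm1_ge0//.
move=> /(_ isT (lexx _)) G.
have {}G := G _ n (leqnn n).
rewrite -nht -/(e n) (le_trans (G _))//.
  move=> j jn.
  have := KP (j%:R * h) h; rewrite mulr_ge0// => /(_ isT h0).
  have -> : j%:R * h + h = j.+1%:R * h by rewrite -[j.+1%:R]natr1 mulrDl mul1r.
  move=> /(_ (jnt _ jn)) yS.
  (* The new error is the local error of [w], plus one Euler step applied to the old error, minus
     the local error of the flow. The last one is O(h^2), hence O(h sqrt h) since h <= 1. *)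
  have -> : e j.+1 = vnorm1 ((w j.+1 - w j - h *: (A *m w j))
     + ((w j - y (j%:R * h) + h *: (A *m (w j - y (j%:R * h))))
     + (-1) *: (y (j.+1%:R * h) - y (j%:R * h) - h *: (A *m y (j%:R * h))))).
    rewrite /e; congr vnorm1; rewrite mulmxBr scalerBr scaleN1r.
    move: (h *: (A *m w j)) (h *: (A *m _)) => a b.
    by apply/matrixP => i k; rewrite !mxE; ring.
  rewrite (le_trans (ler_vnorm1D _ _))//.
  rewrite [leRHS]addrC [X in _ <= X + _]mulrDl -[leRHS]addrA; apply: lerD.
    rewrite (le_trans (wS j jn))// -mulrA [leRHS]mulrAC -mulrA ler_wpM2l//.
    by rewrite ler_wpM2l ?mulr_ge0// wU// ltnW.
  rewrite (le_trans (ler_vnorm1D _ _))// [leLHS]addrC lerD ?Aw//.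
  rewrite vnorm1Z normrN1 mul1r (le_trans yS)// ler_wpM2l// expr2 ler_wpM2l//.
  by rewrite -[leLHS]sqr_sqrtr// expr2 ler_piMl.
have t0 : 0 <= t by rewrite -nht mulr_ge0.
rewrite nht (ger0_norm t0) -nht add0r; apply: eq_ler.
have -> : c * h * n%:R = c * (n%:R * h) by ring.
by ring.
Qed.

End ExponentialFlow.

(** * Gaussian moments *)

Section NormalDensity.
Context (R : realType) (s : R).
Hypothesis s0 : 0 < s.
Local Notation mu := (@lebesgue_measure R).
Local Notation pdf := (normal_pdf 0 s).
Local Notation nu := (normal_prob 0 s).

Let sn0 : s != 0. Proof. by rewrite gt_eqF. Qed.

(** The change of variables yields an abstract Radon-Nikodym derivative; it agrees almost everywhere
    with [pdf] because both have the same integral over every measurable set. *)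
Lemma normal_density_ge0 (f : R -> \bar R) :
  measurable_fun setT f -> (forall x, (0 <= f x)%E) ->
  (\int[nu]_x f x = \int[mu]_x (f x * (pdf x)%:E))%E.
Proof.
move=> mf f0; have dom := normal_prob_dominates (0:R) s.
rewrite -(Radon_Nikodym_SigmaFinite.change_of_variables dom f0 measurableT mf).
have mg : measurable_fun [set: measurableTypeR R]
   (Radon_Nikodym_SigmaFinite.f nu mu).
  exact: (measurable_int _ (Radon_Nikodym_SigmaFinite.f_integrable dom)).
have mp : measurable_fun [set: R] (EFin \o pdf).
  by apply/measurable_EFinP; exact: measurable_normal_pdf.
apply: ae_eq_integral => //.
- exact: emeasurable_funM.
- exact: emeasurable_funM.
apply: ae_eqe_mul2l.
apply: integral_ae_eq => //=.
- exact: (Radon_Nikodym_SigmaFinite.f_integrable dom).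
- by move=> E _ mE; rewrite -(Radon_Nikodym_SigmaFinite.f_integral dom mE).
Qed.

Lemma expr_le_fact_expR (u : R) p : 0 <= u -> u ^+ p <= p`!%:R * expR u.
Proof.
move=> u0; case: p => [|p].
  by rewrite expr0 fact0 mul1r -expR0 ler_expR.
have := expR_ge1Dxn p u0; have : (0 : R) < p.+1`!%:R by rewrite ltr0n fact_gt0.
move=> fp le1; rewrite mulrC -ler_pdivrMr//; apply: le_trans le1.
by rewrite lerDr.
Qed.

(** The factor p! e comes from completing the square; the factor sqrt 2 compensates the ratio of the
    peaks of the normal densities of standard deviations [s] and [Num.sqrt 2 * s]. *)
Definition gauss_const p : R := p`!%:R * expR 1 * Num.sqrt 2.

Lemma gauss_const_ge0 p : 0 <= gauss_const p.
Proof. by rewrite /gauss_const; nonneg. Qed.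

Lemma normal_peak_sqrt2 (r : R) :
  normal_peak (Num.sqrt 2 * r) = (Num.sqrt 2)^-1 * normal_peak r.
Proof.
have E (a : R) : (Num.sqrt (2 * a))^-1 = (Num.sqrt 2)^-1 * (Num.sqrt a)^-1.
  by rewrite sqrtrM// invfM.
rewrite /normal_peak -E; congr (Num.sqrt _)^-1.
by rewrite exprMn sqr_sqrtr// -mulrA mulrnAr.
Qed.

(* Completing the square: [u^p e^(-u^2/2) <= p! e^(u - u^2/2) <= p! e e^(-u^2/4)]
   with [u = |x| / s]. *)
Lemma normal_pdf_moment_le p x :
  `|x| ^+ p * pdf x <= gauss_const p * s ^+ p * normal_pdf 0 (Num.sqrt 2 * s) x.
Proof.
have r0 : (0 : R) < Num.sqrt 2 by rewrite sqrtr_gt0.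
have r2 : (Num.sqrt 2 : R) ^+ 2 = 2 by rewrite sqr_sqrtr.
have rs0 : Num.sqrt 2 * s != 0 by rewrite mulf_neq0 ?gt_eqF.
rewrite !normal_pdfE// normal_peak_sqrt2.
have := normal_peak_ge0 s; move: (normal_peak s) => pk pk0.
rewrite /gauss_const.
rewrite /normal_fun !subr0.
set E1 := expR (- _ / _); set E2 := expR (- _ / _).
have key : `|x| ^+ p * E1 <= p`!%:R * expR 1 * s ^+ p * E2.
  have [u uE] : exists u, u = `|x| / s by exists (`|x| / s).
  have u0 : 0 <= u by rewrite uE divr_ge0// ltW.
  have xE : `|x| = u * s by rewrite uE divfK.
  have x2 : x ^+ 2 = u ^+ 2 * s ^+ 2 by rewrite -exprMn -xE real_normK// num_real.
  have -> : E1 = expR (- u ^+ 2 / 2).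
    by rewrite /E1 x2; congr expR; rewrite -mulr_natl; field.
  have -> : E2 = expR (- u ^+ 2 / 4).
    by rewrite /E2 x2 [(_ * s) ^+ 2]exprMn r2; congr expR; rewrite -mulr_natl; field.
  rewrite xE exprMn.
  have -> : u ^+ p * s ^+ p * expR (- u ^+ 2 / 2) =
     s ^+ p * (u ^+ p * expR (- u ^+ 2 / 2)) by ring.
  have -> : p`!%:R * expR 1 * s ^+ p * expR (- u ^+ 2 / 4) =
     s ^+ p * (p`!%:R * (expR 1 * expR (- u ^+ 2 / 4))) by ring.
  have sp0 : 0 <= s ^+ p by rewrite exprn_ge0// ltW.
  rewrite ler_wpM2l//.
  apply: (@le_trans _ _ (p`!%:R * expR u * expR (- u ^+ 2 / 2))).
    by rewrite ler_wpM2r ?expR_ge0// expr_le_fact_expR.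
  rewrite -mulrA -!expRD ler_wpM2l// ler_expR.
  by have := sqr_ge0 (u / 2 - 1); rewrite sqrrB exprMn; lra.
have -> : p`!%:R * expR 1 * Num.sqrt 2 * s ^+ p * ((Num.sqrt 2)^-1 * pk * E2) =
   pk * (p`!%:R * expR 1 * s ^+ p * E2).
  by field; rewrite gt_eqF.
by rewrite mulrCA ler_wpM2l.
Qed.

Lemma measurable_normX p : measurable_fun [set: R] (EFin \o (fun x : R => `|x| ^+ p)).
Proof.
by apply/measurable_EFinP/measurable_funX; exact: normr_measurable.
Qed.

Lemma normal_abs_moment_le p :
  (\int[nu]_x (`|x| ^+ p)%:E <= (gauss_const p * s ^+ p)%:E)%E.
Proof.
rewrite normal_density_ge0//; last exact: measurable_normX.
have mp (r : R) : measurable_fun [set: R] (EFin \o normal_pdf 0 r).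
  by apply/measurable_EFinP; exact: measurable_normal_pdf.
have -> : (gauss_const p * s ^+ p)%:E =
   (\int[mu]_x ((gauss_const p * s ^+ p)%:E * (normal_pdf 0 (Num.sqrt 2 * s) x)%:E))%E.
  rewrite ge0_integralZl//.
  - by rewrite integral_normal_pdf mule1.
  - exact: mp.
  - by move=> x _; rewrite lee_fin normal_pdf_ge0.
  - by rewrite lee_fin mulr_ge0 ?gauss_const_ge0// exprn_ge0 ?ltW.
apply: ge0_le_integral => //.
- by move=> x _; rewrite mule_ge0// lee_fin ?exprn_ge0// normal_pdf_ge0.
- apply: emeasurable_funM; last exact: mp.
  exact: measurable_normX.
- by apply: emeasurable_funM => //; exact: mp.
- by move=> x _; rewrite -!EFinM lee_fin normal_pdf_moment_le.
Qed.

Lemma integrable_normal_moment p : nu.-integrable setT (EFin \o (fun x => x ^+ p)).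
Proof.
apply/integrableP; split.
  by apply/measurable_EFinP; apply: measurable_funX.
under eq_integral do rewrite /= normrX.
exact: le_lt_trans (normal_abs_moment_le p) (ltry _).
Qed.

Lemma integrable_normal_pdf_moment p :
  mu.-integrable setT (EFin \o (fun x => x ^+ p * pdf x)).
Proof.
apply/integrableP; split.
  apply/measurable_EFinP; apply: measurable_funM; first exact: measurable_funX.
  exact: measurable_normal_pdf.
under eq_integral do rewrite /= normrM normrX [X in _ * X]ger0_norm ?normal_pdf_ge0// EFinM.
rewrite -normal_density_ge0//; last exact: measurable_normX.
exact: le_lt_trans (normal_abs_moment_le p) (ltry _).
Qed.

Lemma normal_moment_density p :
  \int[nu]_x (x ^+ p) = \int[mu]_x (x ^+ p * pdf x).
Proof.
have dom := normal_prob_dominates (0:R) s.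
rewrite /Rintegral; congr fine.
rewrite -(Radon_Nikodym_change_of_variables dom)//=; last first.
  exact: integrable_normal_moment.
have mp : measurable_fun [set: R] (EFin \o pdf).
  by apply/measurable_EFinP; exact: measurable_normal_pdf.
have mx : measurable_fun [set: R] (fun x : R => (x ^+ p)%:E).
  by apply/measurable_EFinP; exact: measurable_funX.
under [RHS]eq_integral do rewrite EFinM.
apply: ae_eq_integral => //.
- apply: emeasurable_funM => //; apply: (measurable_int mu).
- exact: emeasurable_funM.
apply: ae_eqe_mul2l => /=.
rewrite Radon_NikodymE//=.
case: cid => /= h [h1 h2 h3].
apply: integral_ae_eq => //=.
by move=> E _ mE; rewrite -h3.
Qed.

(* Fundamental theorem of calculus on [[-n, n]], with [n] going to infinity. *)
Lemma Rintegral_derivative_eq0 (f F : R -> R) :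
  continuous f -> (forall x, is_derive x (1 : R) F (f x)) ->
  mu.-integrable setT (EFin \o f) ->
  (F n%:R - F (- n%:R)) @[n --> \oo] --> (0 : R) ->
  \int[mu]_x f x = 0.
Proof.
move=> cf dF fi F0.
have mf : measurable_fun setT f by apply: continuous_measurable_fun.
pose g n (x : R) : \bar R := (f x * \1_`[- n%:R, n%:R] x)%:E.
have [_ _ gc] : [/\ mu.-integrable setT (EFin \o f),
    [sequence \int[mu]_x `|g n x - (EFin \o f) x|]_n @ \oo --> 0 &
    [sequence \int[mu]_x g n x]_n @ \oo --> \int[mu]_x (EFin \o f) x]%E.
  apply: (@dominated_convergence _ _ _ mu setT measurableT g (EFin \o f)
     (fun x => `|(f x)%:E|%E)).
  - move=> n; apply/measurable_EFinP; apply: measurable_funM => //.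
  - exact/measurable_EFinP.
  - apply: aeW => x _; apply: cvg_near_cst.
    near=> n; rewrite /g indicE mem_set ?mulr1//=.
    rewrite in_itv/= -ler_norml.
    near: n; exact: nbhs_infty_ger.
  - exact: integrable_abse.
  - apply: aeW => x n _; rewrite /g !abse_EFin lee_fin normrM ler_piMr//.
    by rewrite indicE; case: (_ \in _); rewrite ?normr1 ?normr0.
have gE n : (0 < n)%N -> (\int[mu]_x g n x)%E = (F n%:R - F (- n%:R))%:E.
  move=> n0; have n0' : (- n%:R : R) < n%:R.
    by rewrite gtrN// ltr0n.
  rewrite EFinB -(@continuous_FTC2 _ f F _ _ n0')//.
  - rewrite [RHS]integral_mkcond/=; apply: eq_integral => x _.
    by rewrite /g patchE indicE; case: (_ \in _); rewrite ?mulr1 ?mulr0.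
  - exact: continuous_subspaceT.
  - have cF : continuous F.
      move=> x; apply/differentiable_continuous/derivable1_diffP.
      by case: (dF x).
    split.
    + by move=> x _; case: (dF x).
    + apply: cvg_at_right_filter; exact: cF.
    + apply: cvg_at_left_filter; exact: cF.
  - by move=> x _; rewrite derive1E derive_val.
rewrite /Rintegral.
have -> : (\int[mu]_x (f x)%:E = 0)%E; last by [].
have : (\int[mu]_x g n x)%E @[n --> \oo] --> (0%:E : \bar R).
  have : ((F n%:R - F (- n%:R))%:E) @[n --> \oo] --> (0%:E : \bar R).
    by apply: cvg_EFin => //; exact: nearW.
  apply: cvg_trans; apply: near_eq_cvg.
  near=> n; rewrite gE//; near: n; exact: nbhs_infty_gt.
by move=> h; exact: (cvg_unique _ gc h).
Unshelve. all: end_near. Qed.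

Lemma is_derive_normal_pdf (x : R) :
  is_derive x (1 : R) pdf (- (x / s ^+ 2) * pdf x).
Proof.
have -> : pdf = fun y : R => normal_peak s * expR (- y ^+ 2 / (s ^+ 2 *+ 2)).
  by rewrite normal_pdfE//; apply/funext => y; rewrite /normal_fun subr0.
apply: trigger_derive; rewrite /GRing.scale/=.
move: (normal_peak s) (expR _) => a e.
by rewrite -[s ^+ 2 *+ 2]mulr_natl; field.
Qed.

Lemma integrable_normal_pdf_lincomb (a b : R) p q :
  mu.-integrable setT (EFin \o (fun x => a * (x ^+ p * pdf x) + b * (x ^+ q * pdf x))).
Proof.
have -> : EFin \o (fun x => a * (x ^+ p * pdf x) + b * (x ^+ q * pdf x)) =
   (fun x => (a%:E * (x ^+ p * pdf x)%:E) + (b%:E * (x ^+ q * pdf x)%:E))%E.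
  by apply/funext => x; rewrite /= EFinD !EFinM.
by apply: integrableD => //; apply: integrableZl => //;
  exact: integrable_normal_pdf_moment.
Qed.

Lemma normal_pdf_even x : pdf (- x) = pdf x.
Proof. by rewrite normal_pdfE//= /normal_fun !subr0 sqrrN. Qed.

(** The integrand is the derivative of -s^2 [pdf], an even function, so the boundary terms at n and
    -n cancel exactly. *)
Lemma normal_mean : \int[nu]_x x = 0.
Proof.
have -> : \int[nu]_x x = \int[nu]_x (x ^+ 1) by apply: eq_Rintegral => x _; rewrite expr1.
rewrite normal_moment_density.
have s20 : s ^+ 2 != 0 by rewrite expf_neq0.
have fE : (fun x => x ^+ 1 * pdf x) = (fun x => - s ^+ 2 * (- (x / s ^+ 2) * pdf x)).
  by apply/funext => x; rewrite expr1; field.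
apply: (@Rintegral_derivative_eq0 (fun x => x ^+ 1 * pdf x) (fun x => - s ^+ 2 * pdf x)).
- rewrite fE => x; apply: cvgM; first exact: cvg_cst.
  apply: cvgM; last exact: continuous_normal_pdf.
  by apply: cvgN; apply: cvgM; [exact: cvg_id|exact: cvg_cst].
- move=> x; have -> : x ^+ 1 * pdf x = - s ^+ 2 * (- (x / s ^+ 2) * pdf x).
    by rewrite expr1; field.
  by apply: is_deriveZ; exact: is_derive_normal_pdf.
- exact: integrable_normal_pdf_moment.
- under eq_fun do rewrite normal_pdf_even subrr.
  exact: cvg_cst.
Qed.

(** Integration by parts: the derivative of x [pdf] is [pdf] - x^2 [pdf] / s^2, and the total mass
    is 1. *)
Lemma normal_variance : \int[nu]_x (x ^+ 2) = s ^+ 2.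
Proof.
rewrite normal_moment_density.
have s20 : s ^+ 2 != 0 by rewrite expf_neq0.
have h : \int[mu]_x (1 * (x ^+ 0 * pdf x) + (- (s ^+ 2)^-1) * (x ^+ 2 * pdf x)) = 0.
  apply: (@Rintegral_derivative_eq0 (fun x => 1 * (x ^+ 0 * pdf x)
    + (- (s ^+ 2)^-1) * (x ^+ 2 * pdf x)) (fun x => x * pdf x)).
  - move=> x; have cp := @continuous_normal_pdf _ 0 s sn0.
    apply: cvgD; (apply: cvgM; first exact: cvg_cst); apply: cvgM => //.
    + exact: exprn_continuous.
    + exact: cp.
    + exact: exprn_continuous.
    + exact: cp.
  - move=> x; have dp := is_derive_normal_pdf x.
    apply: trigger_derive; rewrite /GRing.scale/= expr0.
    by move: (pdf x) => a; field.
  - exact: integrable_normal_pdf_lincomb.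
  - apply/cvgrPdist_le => e e0; near=> n.
    have n0 : (0 : R) < n%:R by rewrite ltr0n; near: n; exact: nbhs_infty_gt.
    rewrite sub0r normrN normal_pdf_even mulNr opprK -mulr2n normrMn.
    rewrite ger0_norm ?mulr_ge0 ?normal_pdf_ge0//.
    pose C := gauss_const 2 * s ^+ 2 * normal_peak (Num.sqrt 2 * s).
    (* The domination of x^2 [pdf] by a multiple of a wider normal density bounds it by a constant;
       one division by n makes the boundary terms vanish. *)
    have key : n%:R * pdf n%:R <= C / n%:R.
      rewrite ler_pdivlMr// mulrAC -expr2.
      have := normal_pdf_moment_le 2 n%:R; rewrite (@ger0_norm _ n%:R)// => /le_trans; apply.
      have rs : Num.sqrt 2 * s != 0 by rewrite mulf_neq0// gt_eqF// sqrtr_gt0.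
      apply: ler_wpM2l; last exact: normal_pdf_ub.
      by rewrite mulr_ge0 ?gauss_const_ge0 ?sqr_ge0.
    rewrite -[_ *+ 2]mulr_natl (@le_trans _ _ (2 * (C / n%:R)))// ?ler_wpM2l//.
    rewrite mulrA ler_pdivrMr// -ler_pdivrMl//.
    near: n; exact: nbhs_infty_ger.
have i0 := integrable_normal_pdf_moment 0.
have i2 := integrable_normal_pdf_moment 2.
have iZ (a : R) p : mu.-integrable setT (EFin \o (fun x => a * (x ^+ p * pdf x))).
  have -> : EFin \o (fun x => a * (x ^+ p * pdf x)) = (fun x => a%:E * (x ^+ p * pdf x)%:E)%E.
    by apply/funext => x; rewrite /= EFinM.
  by apply: integrableZl => //; exact: integrable_normal_pdf_moment.
move: h; rewrite RintegralD// !RintegralZl//; last exact: integrable_normal_pdf.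
have -> : \int[mu]_x pdf x = 1 by rewrite /Rintegral integral_normal_pdf.
set V := \int[mu]_x _ => h.
have : V / s ^+ 2 = 1 by lra.
by move/(congr1 ( *%R^~ (s ^+ 2))); rewrite divfK// mul1r.
Unshelve. all: end_near. Qed.

End NormalDensity.

(** * Expectations and filtrations *)

Section RealExpectation.
Context (disp : measure_display) (T : measurableType disp) (R : realType)
  (P : probability T R).
Implicit Types (f g Y V : T -> R).

Definition Rintegrable (f : T -> R) := P.-integrable [set: T] (EFin \o f).

Definition mfun_of (d2 : measure_display) (U : measurableType d2) (Y : T -> U)
    (mY : measurable_fun [set: T] Y) : {mfun T >-> U} :=
  MeasurableFun.Pack (MeasurableFun.Class (isMeasurableFun.Build _ _ _ _ Y mY)).

Lemma Rintegrable_measurable f : Rintegrable f -> measurable_fun setT f.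
Proof. by move=> /measurable_int/measurable_EFinP. Qed.

Lemma RintegrableP f : measurable_fun setT f ->
  (\int[P]_w `|f w|%:E < +oo)%E -> Rintegrable f.
Proof. by move=> mf fi; apply/integrableP; split; [exact/measurable_EFinP|]. Qed.

Lemma Rintegrable_le f g : measurable_fun setT f -> Rintegrable g ->
  (forall w, `|f w| <= `|g w|) -> Rintegrable f.
Proof.
move=> mf ig fg; apply: (le_integrable measurableT _ _ ig).
- exact/measurable_EFinP.
- by move=> w _ /=; rewrite lee_fin.
Qed.

Lemma Rintegrable_cst (c : R) : Rintegrable (cst c).
Proof.
exact: finite_measure_integrable_cst.
Qed.

Lemma RintegrableD f g : Rintegrable f -> Rintegrable g -> Rintegrable (fun w => f w + g w).
Proof.
move=> fi gi; rewrite /Rintegrable.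
have -> : EFin \o (fun w => f w + g w) = (fun w => (EFin \o f) w + (EFin \o g) w)%E.
  by apply/funext => w; rewrite /= EFinD.
exact: integrableD.
Qed.

Lemma RintegrableZ c f : Rintegrable f -> Rintegrable (fun w => c * f w).
Proof.
move=> fi; rewrite /Rintegrable.
have -> : EFin \o (fun w => c * f w) = (fun w => c%:E * (EFin \o f) w)%E.
  by apply/funext => w; rewrite /= EFinM.
exact: integrableZl.
Qed.

Lemma Rintegrable_sum (I : Type) (r : seq I) (f : I -> T -> R) :
  (forall i, Rintegrable (f i)) -> Rintegrable (fun w => \sum_(i <- r) f i w).
Proof.
move=> fi; elim: r => [|i r IH].
  by under eq_fun do rewrite big_nil; exact: Rintegrable_cst.
by under eq_fun do rewrite big_cons; exact: RintegrableD.
Qed.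

Lemma Rintegrable_norm f : Rintegrable f -> Rintegrable (fun w => `|f w|).
Proof.
move=> fi; apply: (Rintegrable_le _ fi) => [|w]; last by rewrite normr_id.
by apply: measurableT_comp => //; exact: Rintegrable_measurable.
Qed.

Lemma Rintegrable_bounded f (C : R) : measurable_fun setT f ->
  (forall w, `|f w| <= C) -> Rintegrable f.
Proof.
move=> mf fC; apply: (Rintegrable_le mf (Rintegrable_cst C)) => w.
by rewrite (le_trans (fC w))// ler_norm.
Qed.

Lemma RintegrableM_bounded f g (C : R) : measurable_fun setT f ->
  (forall w, `|f w| <= C) -> Rintegrable g -> Rintegrable (fun w => f w * g w).
Proof.
move=> mf fC ig; apply: (Rintegrable_le _ (RintegrableZ C ig)) => [|w].
  by apply: measurable_funM => //; exact: Rintegrable_measurable.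
rewrite !normrM ler_wpM2r//.
by rewrite (le_trans (fC w))// ler_norm.
Qed.

Lemma EFin_Rintegral f : Rintegrable f -> ((\int[P]_w f w)%:E = \int[P]_w (f w)%:E)%E.
Proof. by move=> fi; rewrite /Rintegral fineK//; exact: integrable_fin_num. Qed.

Lemma mean_cst (c : R) : \int[P]_w cst c w = c.
Proof. by rewrite Rintegral_cst// [X in fine X](probability_setT P)/= mulr1. Qed.

Lemma meanD f g : Rintegrable f -> Rintegrable g ->
  \int[P]_w (f w + g w) = \int[P]_w f w + \int[P]_w g w.
Proof. exact: RintegralD. Qed.

Lemma meanZ c f : Rintegrable f -> \int[P]_w (c * f w) = c * \int[P]_w f w.
Proof. exact: RintegralZl. Qed.

Lemma mean_sum (I : Type) (r : seq I) (f : I -> T -> R) :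
  (forall i, Rintegrable (f i)) ->
  \int[P]_w (\sum_(i <- r) f i w) = \sum_(i <- r) \int[P]_w f i w.
Proof.
move=> fi; elim: r => [|i r IH].
  by rewrite big_nil; under eq_Rintegral do rewrite big_nil; exact: mean_cst.
rewrite big_cons -IH -meanD//; last exact: Rintegrable_sum.
by apply: eq_Rintegral => w _; rewrite big_cons.
Qed.

Lemma le_mean f g : Rintegrable f -> Rintegrable g -> (forall w, f w <= g w) ->
  \int[P]_w f w <= \int[P]_w g w.
Proof. by move=> fi gi fg; apply: le_Rintegral. Qed.

Lemma ler_norm_mean f : Rintegrable f -> `|\int[P]_w f w| <= \int[P]_w `|f w|.
Proof. by move=> fi; apply: le_normr_Rintegral. Qed.

(** Independence identifies the joint law with a product measure. Tonelli's theorem then gives the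
    integrability of the product, and Fubini's theorem its mean. *)
Lemma mean_indep (Y V : T -> R) :
  measurable_fun setT Y -> measurable_fun setT V ->
  (forall U W : set R, measurable U -> measurable W ->
     P (Y @^-1` U `&` V @^-1` W) = (P (Y @^-1` U) * P (V @^-1` W))%E) ->
  Rintegrable Y -> Rintegrable V ->
  Rintegrable (fun w => Y w * V w) /\
  \int[P]_w (Y w * V w) = (\int[P]_w Y w) * (\int[P]_w V w).
Proof.
move=> mY mV YV iY iV.
pose Yf := mfun_of mY; pose Vf := mfun_of mV.
have mZ : measurable_fun setT (fun w => (Y w, V w)) by exact: measurable_fun_pair.
pose Zf := mfun_of mZ.
pose m1 := distribution P Yf; pose m2 := distribution P Vf.
pose m := distribution P Zf.
have mE X : measurable X -> (m1 \x m2)%E X = m X.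
  apply: product_measure_unique => A B mA mB.
  by rewrite /m /m1 /m2 /distribution /pushforward/= -YV.
pose f (z : R * R) : \bar R := (z.1 * z.2)%:E.
have mf : measurable_fun setT f.
  by apply/measurable_EFinP; exact: measurable_funM.
have absY : (\int[m1]_y `|y|%:E = \int[P]_w `|Y w|%:E)%E.
  by rewrite ge0_integral_distribution//; apply/measurable_EFinP; exact: normr_measurable.
have absV : (\int[m2]_y `|y|%:E = \int[P]_w `|V w|%:E)%E.
  by rewrite ge0_integral_distribution//; apply/measurable_EFinP; exact: normr_measurable.
have fY : (\int[P]_w `|Y w|%:E < +oo)%E by move/integrableP : iY => [].
have fV : (\int[P]_w `|V w|%:E < +oo)%E by move/integrableP : iV => [].
have mn : measurable_fun [set: R] (fun y : R => `|y|%:E).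
  by apply/measurable_EFinP; exact: normr_measurable.
have ifm : (m1 \x m2)%E.-integrable setT f.
  apply/integrable12ltyP => //.
  have -> : (\int[m1]_x \int[m2]_y `|f (x, y)| =
     \int[m1]_x (`|x|%:E * \int[P]_w `|V w|%:E))%E.
    apply: eq_integral => x _; rewrite -absV -ge0_integralZl//.
    by apply: eq_integral => y _; rewrite /f/= -EFinM -normrM.
  rewrite ge0_integralZr//; last exact: integral_ge0.
  rewrite absY lte_mul_pinfty// ?integral_ge0//.
  by rewrite ge0_fin_numE// integral_ge0.
have ifP : Rintegrable (fun w => Y w * V w).
  apply: RintegrableP; first exact: measurable_funM.
  have -> : (\int[P]_w `|Y w * V w|%:E = \int[m]_z `|f z|)%E.
    rewrite ge0_integral_distribution//.
    exact: measurableT_comp.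
  have -> : (\int[m]_z `|f z| = \int[(m1 \x m2)%E]_z `|f z|)%E.
    by apply: eq_measure_integral => A mA _; exact/esym/mE.
  by move/integrableP : ifm => [].
split => //.
apply: EFin_inj; rewrite EFin_Rintegral// EFinM !EFin_Rintegral//.
have -> : (\int[P]_w (Y w * V w)%:E = \int[m]_z f z)%E.
  by rewrite integral_distribution.
have -> : (\int[m]_z f z = \int[(m1 \x m2)%E]_z f z)%E.
  by apply: eq_measure_integral => A mA _; exact/esym/mE.
rewrite -integral12_prod_meas1// /fubini_F.
have im2 : (\int[P]_w (V w)%:E = \int[m2]_y y%:E)%E.
  by rewrite integral_distribution//; exact/measurable_EFinP.
have im1 : (\int[P]_w (Y w)%:E = \int[m1]_y y%:E)%E.
  by rewrite integral_distribution//; exact/measurable_EFinP.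
have i2 : m2.-integrable setT (fun y => y%:E).
  apply/integrableP; split; first exact/measurable_EFinP.
  by rewrite absV.
have i1 : m1.-integrable setT (fun y => y%:E).
  apply/integrableP; split; first exact/measurable_EFinP.
  by rewrite absY.
rewrite im1 im2.
have -> : (\int[m1]_x \int[m2]_y f (x, y) =
   \int[m1]_x (x%:E * (fine (\int[m2]_y y%:E))%:E))%E.
  apply: eq_integral => x _; rewrite fineK; last exact: integrable_fin_num.
  by rewrite -integralZl//; apply: eq_integral => y _; rewrite /f EFinM.
by rewrite integralZr// fineK//; exact: integrable_fin_num.
Qed.

(** Sets containing 0 are excluded because the intended variables are products with indicators:
    their laws are proportional away from 0, while the masses at 0 differ. The value 0 contributes
    nothing to an integral, so both integrals are restricted to ]0, +oo[. *)
Lemma ge0_scaled_law (Y1 Y2 : T -> R) (c : R) :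
  measurable_fun setT Y1 -> measurable_fun setT Y2 -> 0 <= c ->
  (forall w, 0 <= Y1 w) -> (forall w, 0 <= Y2 w) ->
  (forall U : set R, measurable U -> ~ U 0 -> P (Y1 @^-1` U) = (c%:E * P (Y2 @^-1` U))%E) ->
  (\int[P]_w (Y1 w)%:E = c%:E * \int[P]_w (Y2 w)%:E)%E.
Proof.
move=> m1 m2 c0 p1 p2 law.
pose Y1f := mfun_of m1; pose Y2f := mfun_of m2.
pose f (y : R) : \bar R := (Num.max y 0)%:E.
have mf : measurable_fun setT f.
  by apply/measurable_EFinP; exact: measurable_maxr.
have f0 y : (0 <= f y)%E by rewrite lee_fin le_max lexx orbT.
have E (Y : T -> R) (mY : measurable_fun setT Y) : (forall w, 0 <= Y w) ->
   (\int[P]_w (Y w)%:E = \int[distribution P (mfun_of mY)]_(y in `]0%R, +oo[) f y)%E.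
  move=> pY; rewrite [RHS]integral_mkcond ge0_integral_distribution//.
  - apply: eq_integral => w _; rewrite /= patchE /f.
    case: ifPn => [_|]; first by rewrite max_l.
    rewrite notin_setE/= in_itv/= andbT => /negP; rewrite -leNgt => Y0.
    by congr EFin; apply/eqP; rewrite eq_le Y0 pY.
  - by apply/(measurable_restrictT _ _).1 => //; exact: measurable_funTS.
  - by move=> y; rewrite patchE; case: ifP.
rewrite (E Y1 m1 p1) (E Y2 m2 p2).
have cE : c = (NngNum c0)%:num by [].
rewrite cE -ge0_integral_mscale//; last exact: measurable_funTS.
apply: eq_measure_integral => A mA A0 /=.
rewrite /distribution /pushforward/= law//.
by move=> /A0/=; rewrite in_itv/= ltxx.
Qed.

(** The positive and negative parts are functions vanishing at 0, so the preimage under them of a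
    set avoiding 0 again avoids 0. *)
Lemma scaled_law (Y1 Y2 : T -> R) (c : R) : Rintegrable Y1 -> Rintegrable Y2 -> 0 <= c ->
  (forall U : set R, measurable U -> ~ U 0 -> P (Y1 @^-1` U) = (c%:E * P (Y2 @^-1` U))%E) ->
  \int[P]_w Y1 w = c * \int[P]_w Y2 w.
Proof.
move=> i1 i2 c0 law.
have m1 := Rintegrable_measurable i1; have m2 := Rintegrable_measurable i2.
have key (f : R -> R) : measurable_fun setT f -> f 0 = 0 -> (forall y, 0 <= f y) ->
    (forall y, `|f y| <= `|y|) ->
    \int[P]_w f (Y1 w) = c * \int[P]_w f (Y2 w).
  move=> mf f0 fp fle.
  have s1 : Rintegrable (f \o Y1) by apply: (Rintegrable_le _ i1) => [|w]; [exact: measurableT_comp|exact: fle].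
  have s2 : Rintegrable (f \o Y2) by apply: (Rintegrable_le _ i2) => [|w]; [exact: measurableT_comp|exact: fle].
  apply: EFin_inj; rewrite EFinM !EFin_Rintegral//.
  apply: ge0_scaled_law => //; [exact: measurableT_comp|exact: measurableT_comp|].
  move=> U mU U0; apply: (law (f @^-1` U)).
  - by rewrite -[X in measurable X]setTI; exact: mf.
  - by rewrite /preimage/= f0.
pose p (y : R) := Num.max y 0; pose n (y : R) := Num.max (- y) 0.
have mp : measurable_fun setT p by exact: measurable_maxr.
have mn : measurable_fun setT n by apply: measurable_maxr => //; exact: measurable_oppr.
have pE y : `|p y| <= `|y|.
  by rewrite /p; case: (leP y 0) => y0; rewrite ?normr0.
have nE y : `|n y| <= `|y|.
  by rewrite /n; case: (leP (- y) 0) => y0; rewrite ?normr0 ?normrN.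
have dE y : y = p y + (-1) * n y.
  by rewrite /p /n; case: (leP y 0) => y0; case: (leP (- y) 0) => y0'; lra.
have sp Y : Rintegrable Y -> Rintegrable (fun w => p (Y w)).
  by move=> iY; apply: (Rintegrable_le _ iY) => [|//]; apply: measurableT_comp => //; exact: Rintegrable_measurable.
have sn Y : Rintegrable Y -> Rintegrable (fun w => n (Y w)).
  by move=> iY; apply: (Rintegrable_le _ iY) => [|//]; apply: measurableT_comp => //; exact: Rintegrable_measurable.
have split Y : Rintegrable Y -> \int[P]_w Y w = \int[P]_w p (Y w) + (-1) * \int[P]_w n (Y w).
  move=> iY; rewrite -meanZ ?sn// -meanD ?sp//; last exact/RintegrableZ/sn.
  by apply: eq_Rintegral => w _; exact: dE.
rewrite (split Y1)// (split Y2)// (key p) ?(key n)//.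
- by rewrite mulrDr mulrCA.
- by rewrite /n oppr0 maxxx.
- by move=> y; rewrite /n le_max lexx orbT.
- by rewrite /p maxxx.
- by move=> y; rewrite /p le_max lexx orbT.
Qed.

End RealExpectation.

(** * Measurability with respect to generated sigma-algebras *)

Section Adapted.
Context (disp : measure_display) (T : measurableType disp) (R : realType)
  (P : probability T R).
Implicit Types (G H : set (set T)) (Y : T -> R).

(** Stated as measurability on the type carrying the generated sigma-algebra, so that the usual
    closure properties of measurable functions apply as they are. *)
Definition adapted G Y := @measurable_fun _ _ (g_sigma_algebraType G) R setT Y.

Lemma adaptedP G Y :
  adapted G Y <-> forall U : set R, measurable U -> <<s G >> (Y @^-1` U).
Proof.
split=> [mY U mU|mY _ U mU].
  by have := mY (@measurableT _ (g_sigma_algebraType G)) U mU; rewrite setTI.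
by rewrite setTI; exact: mY.
Qed.

Lemma adapted_sub G H Y : G `<=` <<s H >> -> adapted G Y -> adapted H Y.
Proof.
move=> GH /adaptedP mY; apply/adaptedP => U mU.
have := mY U mU; apply: smallest_sub => //; exact: smallest_sigma_algebra.
Qed.

Lemma sub_sigma_measurable G : G `<=` measurable -> <<s G >> `<=` (@measurable _ T).
Proof.
by move=> Gm; apply: smallest_sub => //; exact: sigma_algebra_measurable.
Qed.

Lemma adapted_measurable G Y :
  G `<=` measurable -> adapted G Y -> measurable_fun setT Y.
Proof.
move=> Gm /adaptedP mY _ U mU; rewrite setTI.
by apply: (sub_sigma_measurable Gm); exact: mY.
Qed.

Lemma adaptedD G Y1 Y2 : adapted G Y1 -> adapted G Y2 -> adapted G (fun w => Y1 w + Y2 w).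
Proof. exact: (@measurable_funD _ (g_sigma_algebraType G)). Qed.

Lemma adaptedM G Y1 Y2 : adapted G Y1 -> adapted G Y2 -> adapted G (fun w => Y1 w * Y2 w).
Proof. exact: (@measurable_funM _ (g_sigma_algebraType G)). Qed.

Lemma adaptedB G Y1 Y2 : adapted G Y1 -> adapted G Y2 -> adapted G (fun w => Y1 w - Y2 w).
Proof. exact: (@measurable_funB _ (g_sigma_algebraType G)). Qed.

Lemma adapted_cst G (c : R) : adapted G (cst c).
Proof. exact: measurable_cst. Qed.

Lemma adaptedX G Y k : adapted G Y -> adapted G (fun w => Y w ^+ k).
Proof. exact: (@measurable_funX _ (g_sigma_algebraType G)). Qed.

Lemma adapted_indic G (E : set T) : <<s G >> E -> adapted G (\1_E).
Proof. exact: (@measurable_indic _ (g_sigma_algebraType G)). Qed.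

(** The intersections [A] with [C] are stable under intersection and generate the join, so the
    uniqueness theorem for measures applies. *)
Lemma join_measure_unique (G H : set (set T)) (m1 m2 : {measure set T -> \bar R}) :
  G `<=` measurable -> H `<=` measurable -> (m1 setT < +oo)%E ->
  (forall A C, <<s G >> A -> <<s H >> C -> m1 (A `&` C) = m2 (A `&` C)) ->
  forall E, <<s G `|` H >> E -> m1 E = m2 E.
Proof.
move=> Gm Hm m1f m12 E EE.
have sT K : <<s K >> (setT : set T).
  by move=> C [[C0 CD _] _]; rewrite -(setD0 setT); exact: CD.
pose K : set (set T) := [set E | exists2 A, <<s G >> A & exists2 C, <<s H >> C & E = A `&` C].
apply: (g_sigma_algebra_measure_unique K _ (fun=> setT)).
- by move=> _ [A GA [C HC ->]]; apply: measurableI; [exact: (sub_sigma_measurable Gm GA)|exact: (sub_sigma_measurable Hm HC)].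
- by move=> _; exists setT => //; exists setT => //; rewrite setIT.
- by apply/seteqP; split => // x _; exists 0%N.
- move=> _ _ [A1 hA1 [C1 hC1 ->]] [A2 hA2 [C2 hC2 ->]].
  exists (A1 `&` A2).
    exact: (@measurableI _ (g_sigma_algebraType G)).
  exists (C1 `&` C2); last by rewrite setIACA.
  exact: (@measurableI _ (g_sigma_algebraType H)).
- by move=> _ [A GA [C HC ->]]; exact: m12.
- by [].
- move: E EE; apply: smallest_sub; first exact: smallest_sigma_algebra.
  move=> A hA; suff : K A by exact: sub_sigma_algebra.
  case: hA => [GA|HA].
    exists A; first by apply: sub_sigma_algebra; exact: GA.
    by exists setT; [exact: sT|rewrite setIT].
  exists setT; first exact: sT.
  by exists A; [by apply: sub_sigma_algebra; exact: HA|rewrite setTI].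
Qed.

(** Both facts to be extended to a larger past, the independence of the increments and the Markov
    property, have this form: two traces of [P] that are proportional. It then suffices to check
    events of the two components separately. *)
Lemma join_scaled (G H : set (set T)) (D D' : set T) (c : R) :
  G `<=` measurable -> H `<=` measurable -> measurable D -> measurable D' -> 0 <= c ->
  (forall A C, <<s G >> A -> <<s H >> C ->
     P (A `&` C `&` D) = (c%:E * P (A `&` C `&` D'))%E) ->
  forall E, <<s G `|` H >> E -> P (E `&` D) = (c%:E * P (E `&` D'))%E.
Proof.
move=> Gm Hm mD mD' c0 h E EE.
apply: (@join_measure_unique G H (mrestr P mD) (mscale (NngNum c0) (mrestr P mD'))) => //.
exact: (le_lt_trans (probability_le1 P (measurableI _ _ measurableT mD)) (ltry _)).
Qed.

End Adapted.

Section Filtration.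
Context (disp : measure_display) (T : measurableType disp) (R : realType)
  (P : probability T R) (d : nat) (Q : 'M[R]_d)
  (X : R -> T -> 'I_d) (B : R -> {RV P >-> R}).
Hypothesis hX : is_markov_chain P Q X.
Hypothesis hB : is_brownian_motion B.
Hypothesis hXB : independent_chain_real X B.

(** Only the generators are collected here; the sigma-algebra they generate is
    [joint_filtration X B s]. *)
Definition history (s : R) : set (set T) :=
  chain_events X `[0, s] `|` real_events B `[0, s].

(* Adding the whole trajectory of [X] to the past of [B] keeps it independent of
   the later increments of [B]. *)
Definition chain_history (s : R) : set (set T) :=
  chain_events X `[0, +oo[ `|` real_events B `[0, s].

Lemma chain_events_measurable (J : set R) : J `<=` `[0, +oo[ ->
  chain_events X J `<=` measurable.
Proof.
move=> J0 _ [s Js [i ->]]; have [mX _ _] := hX.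
by apply: mX; have := J0 _ Js; rewrite /= in_itv/= andbT.
Qed.

Lemma real_events_measurable (J : set R) : real_events B J `<=` measurable.
Proof.
move=> _ [s Js [U mU ->]]; rewrite -[X in measurable X]setTI.
exact: (measurable_funP (B s)).
Qed.

Lemma itv0_sub (s : R) : [set` `[0, s]] `<=` [set` `[0, +oo[].
Proof. by move=> x /=; rewrite !in_itv/= andbT => /andP[]. Qed.

Lemma chain_events_sub (J K : set R) : J `<=` K ->
  chain_events X J `<=` chain_events X K.
Proof. by move=> JK _ [s Js [i ->]]; exists s; [exact: JK|exists i]. Qed.

Lemma real_events_sub (J K : set R) : J `<=` K ->
  real_events B J `<=` real_events B K.
Proof. by move=> JK _ [s Js [U mU ->]]; exists s; [exact: JK|exists U]. Qed.

Lemma sub_sigma (G H : set (set T)) : G `<=` H -> <<s G >> `<=` <<s H >>.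
Proof. exact: sub_smallest2r. Qed.

Lemma history_measurable s : history s `<=` measurable.
Proof.
move=> A [|]; last exact: real_events_measurable.
by apply: chain_events_measurable; exact: itv0_sub.
Qed.

Lemma le_history s t : s <= t -> history s `<=` <<s history t >>.
Proof.
move=> st A hA; apply: sub_sigma_algebra.
have ss : [set` `[0, s]] `<=` [set` `[0, t]].
  by move=> x /=; rewrite !in_itv/= => /andP[-> /le_trans]; apply.
by case: hA => hA; [left; exact: chain_events_sub hA|right; exact: real_events_sub hA].
Qed.

Lemma history_chain_history s : history s `<=` <<s chain_history s >>.
Proof.
move=> A hA; apply: sub_sigma_algebra.
by case: hA => hA; [left; apply: chain_events_sub hA; exact: itv0_sub|right].
Qed.

Lemma adapted_brownian s u : 0 <= u -> u <= s -> adapted (history s) (B u).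
Proof.
move=> u0 us; apply/adaptedP => U mU; apply: sub_sigma_algebra; right.
by exists u => /=; [rewrite in_itv/= u0 us|exists U].
Qed.

Lemma history_chain s u i : 0 <= u -> u <= s ->
  <<s history s >> (X u @^-1` [set i]).
Proof.
move=> u0 us; apply: sub_sigma_algebra; left.
by exists u => /=; [rewrite in_itv/= u0 us|exists i].
Qed.

Lemma chain_history_chain s u i : 0 <= u ->
  <<s chain_history s >> (X u @^-1` [set i]).
Proof.
move=> u0; apply: sub_sigma_algebra; left.
by exists u => /=; [rewrite in_itv/= u0|exists i].
Qed.

Lemma chain_measurable u i : 0 <= u -> measurable (X u @^-1` [set i]).
Proof. by move=> u0; have [+ _ _] := hX; exact. Qed.

Definition increment (s t : R) (w : T) : R := B t w - B s w.

Lemma measurable_increment s t : measurable_fun setT (increment s t).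
Proof. by apply: measurable_funB. Qed.

(** For [A] in the sigma-algebra of the chain and [C] in the past of [B], independence of [X] and
    [B] splits off [A], then independence of the increments splits off [C]; [join_scaled] with the
    whole space as second trace extends this to the join. *)
Lemma increment_indep s t (E : set T) (U : set R) : 0 <= s -> s <= t ->
  <<s chain_history s >> E -> measurable U ->
  P (E `&` increment s t @^-1` U) = (P E * P (increment s t @^-1` U))%E.
Proof.
move=> s0; rewrite le_eqVlt => /predU1P[<-|st] hE mU.
  have -> : increment s s @^-1` U = if 0 \in U then setT else set0.
    apply/seteqP; split=> w; rewrite /increment/= subrr; case: ifPn => //.
      by rewrite notin_setE.
    by rewrite inE.
  case: ifPn => _; first by rewrite setIT [X in (_ * X)%E]probability_setT mule1.
  by rewrite setI0 measure0 mule0.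
have [_ _ _ ind] := hB.
set D := increment s t @^-1` U.
have mD : measurable D.
  by rewrite -[D]setTI; apply: measurable_increment.
have PDf : P D \is a fin_num by exact: fin_num_measure.
have PD0 : 0 <= fine (P D) by exact: fine_ge0.
rewrite muleC -[P D]fineK// -[in RHS](setIT E).
apply: (@join_scaled _ _ _ P (chain_events X `[0, +oo[) (real_events B `[0, s])) => //.
- exact: chain_events_measurable.
- exact: real_events_measurable.
move=> A C hA hC.
have sB : <<s real_events B `[0, s] >> `<=` <<s real_events B `[0, +oo[ >>.
  by apply: sub_sigma; apply: real_events_sub; exact: itv0_sub.
have t0 : 0 <= t by rewrite (le_trans s0)// ltW.
have aB u : 0 <= u -> adapted (real_events B `[0, +oo[) (B u).
  move=> u0; apply/adaptedP => V mV; apply: sub_sigma_algebra.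
  by exists u => /=; [rewrite in_itv/= u0|exists V].
have hD : <<s real_events B `[0, +oo[ >> D.
  by have /adaptedP := adaptedB (aB t t0) (aB s s0); apply.
rewrite fineK// setIT -setIA (hXB hA); last first.
  exact: (@measurableI _ (g_sigma_algebraType (real_events B `[0, +oo[)) _ _ (sB _ hC) hD).
rewrite (hXB hA (sB _ hC)) [C `&` D]setIC.
rewrite (ind s t s0 st D C)//; last by apply: sub_sigma_algebra; exists U.
by rewrite muleCA.
Qed.

(** An event of the past of [B] factors out of both sides by independence, leaving the Markov
    property of [X] alone. The sign condition makes the transition probability a legitimate factor
    for a measure. *)
Lemma markov_history s t (E : set T) i j : 0 <= s -> s <= t -> 0 <= expmx ((t - s) *: Q) i j ->
  <<s history s >> E ->
  P (E `&` (X s @^-1` [set i] `&` X t @^-1` [set j])) =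
    ((expmx ((t - s) *: Q) i j)%:E * P (E `&` X s @^-1` [set i]))%E.
Proof.
move=> s0 st p0.
have t0 : 0 <= t by rewrite (le_trans s0).
have [mX _ mk] := hX.
apply: join_scaled => //.
- by apply: chain_events_measurable; exact: itv0_sub.
- exact: real_events_measurable.
- by apply: measurableI; exact: mX.
- exact: mX.
move=> A C hA hC.
have sX : <<s chain_events X `[0, s] >> `<=` <<s chain_events X `[0, +oo[ >>.
  by apply: sub_sigma; apply: chain_events_sub; exact: itv0_sub.
have sB : <<s real_events B `[0, s] >> `<=` <<s real_events B `[0, +oo[ >>.
  by apply: sub_sigma; apply: real_events_sub; exact: itv0_sub.
have cX u k : 0 <= u -> <<s chain_events X `[0, +oo[ >> (X u @^-1` [set k]).
  by move=> u0; apply: sub_sigma_algebra; exists u; [rewrite /= in_itv/= u0|exists k].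
have mI (A1 A2 : set T) : <<s chain_events X `[0, +oo[ >> A1 ->
  <<s chain_events X `[0, +oo[ >> A2 -> <<s chain_events X `[0, +oo[ >> (A1 `&` A2).
  exact: (@measurableI _ (g_sigma_algebraType _)).
have eq1 (Z : set T) : A `&` C `&` Z = (A `&` Z) `&` C by rewrite setIAC.
have e1 := hXB (mI _ _ (sX _ hA) (mI _ _ (cX s i s0) (cX t j t0))) (sB _ hC).
have e2 := hXB (mI _ _ (sX _ hA) (cX s i s0)) (sB _ hC).
rewrite !eq1 e1 e2.
by rewrite setIA (mk s t i j A)// [(P _ * _%:E)%E]muleC muleA.
Qed.

End Filtration.

(** * Increments of B and the Markov property under expectations *)

Section ModelExpectations.
Context (disp : measure_display) (T : measurableType disp) (R : realType)
  (P : probability T R) (d : nat) (Q : 'M[R]_d)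
  (X : R -> T -> 'I_d) (B : R -> {RV P >-> R}).
Hypothesis hX : is_markov_chain P Q X.
Hypothesis hB : is_brownian_motion B.
Hypothesis hXB : independent_chain_real X B.

Local Notation dB := (increment B).
Local Notation hist := (history X B).
Local Notation chist := (chain_history X B).
Local Notation "\chi_ ( u , i ) " := (fun w => (X u w == i)%:R : R) (at level 0).
Local Notation Rintegrable := (Rintegrable P).

Lemma increment_law s t (U : set R) : 0 <= s -> s < t -> measurable U ->
  P (dB s t @^-1` U) = normal_prob 0 (Num.sqrt (t - s)) U.
Proof. by move=> s0 st mU; have [_ _ h _] := hB; exact: h. Qed.

Lemma increment_integral s t (f : R -> \bar R) : 0 <= s -> s < t ->
  measurable_fun setT f -> (forall y, (0 <= f y)%E) ->
  (\int[P]_w f (dB s t w) = \int[normal_prob 0 (Num.sqrt (t - s))]_y f y)%E.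
Proof.
move=> s0 st mf f0.
have mD := measurable_increment B s t.
pose D := @mfun_of _ T _ (measurableTypeR R) (dB s t) mD.
rewrite -(@ge0_integral_distribution _ _ _ (measurableTypeR R) _ P D)//.
apply: eq_measure_integral => A mA _ /=.
by rewrite /distribution /pushforward/= increment_law.
Qed.

Lemma increment_abs_moment s t q : 0 <= s -> s <= t ->
  (\int[P]_w (`|dB s t w| ^+ q)%:E <= (gauss_const R q * Num.sqrt (t - s) ^+ q)%:E)%E.
Proof.
move=> s0; rewrite le_eqVlt => /predU1P[<-|st].
  rewrite subrr sqrtr0.
  have -> : (\int[P]_w (`|dB s s w| ^+ q)%:E = \int[P]_w (cst (0 ^+ q)%:E) w)%E.
    by apply: eq_integral => w _; rewrite /increment subrr normr0.
  rewrite integral_cst// [X in (_ * X)%E]probability_setT mule1 lee_fin.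
  (* For q = 0 the moment of the zero increment is 1, and [gauss_const R 0] equals e sqrt 2, which
     is at least 1. *)
  case: q => [|q]; last by rewrite expr0n/= mulr0.
  rewrite !expr0 mulr1 /gauss_const fact0 mul1r.
  have e1 : 1 <= expR (1 : R) by rewrite -[leLHS]expR0 ler_expR.
  have r2 : 1 <= Num.sqrt (2 : R) by rewrite -[leLHS]sqrtr1 ler_wsqrtr// ler1n.
  by rewrite -[leLHS]mulr1 ler_pM.
rewrite (@increment_integral s t (fun y => (`|y| ^+ q)%:E))//.
- by apply: normal_abs_moment_le; rewrite sqrtr_gt0 subr_gt0.
- exact: measurable_normX.
Qed.

Lemma increment_Rintegrable s t q : 0 <= s -> s <= t -> Rintegrable (fun w => dB s t w ^+ q).
Proof.
move=> s0 st; apply: RintegrableP.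
  by apply: measurable_funX; exact: measurable_increment.
under eq_integral do rewrite normrX.
exact: le_lt_trans (increment_abs_moment q s0 st) (ltry _).
Qed.

Lemma increment_moment_le s t q : 0 <= s -> s <= t ->
  `|\int[P]_w (dB s t w ^+ q)| <= gauss_const R q * Num.sqrt (t - s) ^+ q.
Proof.
move=> s0 st; have i := increment_Rintegrable q s0 st.
rewrite (le_trans (ler_norm_mean i))// -lee_fin EFin_Rintegral//; last exact: Rintegrable_norm.
under eq_integral do rewrite normrX.
exact: increment_abs_moment.
Qed.

Lemma increment_moment s t q : 0 <= s -> s < t ->
  \int[P]_w (dB s t w ^+ q) = \int[normal_prob 0 (Num.sqrt (t - s))]_y (y ^+ q).
Proof.
move=> s0 st; have mD := measurable_increment B s t.
have i := increment_Rintegrable q s0 (ltW st).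
rewrite /Rintegral; congr fine.
pose D := @mfun_of _ T _ (measurableTypeR R) (dB s t) mD.
have -> : (\int[P]_w (dB s t w ^+ q)%:E =
    \int[distribution P D]_y (y ^+ q)%:E)%E.
  rewrite (@integral_distribution _ _ _ (measurableTypeR R) _ P D (fun y : R => (y ^+ q)%:E))//.
  by apply/measurable_EFinP; exact: measurable_funX.
apply: eq_measure_integral => A mA _ /=.
by rewrite /distribution /pushforward/= increment_law.
Qed.

Lemma increment_mean s t : 0 <= s -> s <= t -> \int[P]_w dB s t w = 0.
Proof.
move=> s0; rewrite le_eqVlt => /predU1P[<-|st].
  by under eq_Rintegral do rewrite /increment subrr; rewrite mean_cst.
have -> : \int[P]_w dB s t w = \int[P]_w (dB s t w ^+ 1).
  by apply: eq_Rintegral => w _; rewrite expr1.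
rewrite increment_moment//.
under eq_Rintegral do rewrite expr1.
by rewrite normal_mean// sqrtr_gt0 subr_gt0.
Qed.

Lemma increment_variance s t : 0 <= s -> s <= t -> \int[P]_w (dB s t w ^+ 2) = t - s.
Proof.
move=> s0; rewrite le_eqVlt => /predU1P[<-|st].
  by under eq_Rintegral do rewrite /increment subrr expr0n; rewrite subrr mean_cst.
rewrite increment_moment// normal_variance ?sqr_sqrtr// ?sqrtr_gt0 ?subr_gt0//.
by rewrite subr_ge0 ltW.
Qed.

Lemma mean_mul_increment s t (Y : T -> R) q : 0 <= s -> s <= t ->
  adapted (chist s) Y -> Rintegrable Y ->
  Rintegrable (fun w => Y w * dB s t w ^+ q) /\
  \int[P]_w (Y w * dB s t w ^+ q) = \int[P]_w Y w * \int[P]_w (dB s t w ^+ q).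
Proof.
move=> s0 st aY iY; apply: mean_indep => //.
- exact: Rintegrable_measurable iY.
- by apply: measurable_funX; exact: measurable_increment.
- move=> U W mU mW; apply: (@increment_indep _ _ _ _ _ _ _ _ hX hB hXB s t _
     ((fun y => y ^+ q) @^-1` W) s0 st).
  + by move/adaptedP : aY; exact.
  + by rewrite -[X in measurable X]setTI; apply: measurable_funX.
- exact: increment_Rintegrable.
Qed.

Lemma chiE u i : \chi_(u, i) = \1_(X u @^-1` [set i]).
Proof.
apply/funext => w; rewrite indicE; congr (nat_of_bool _)%:R; apply/idP/idP => [/eqP h|].
  by rewrite inE.
by rewrite inE => /= ->.
Qed.

Lemma adapted_chi s u i : 0 <= u -> u <= s -> adapted (hist s) \chi_(u, i).
Proof. by move=> u0 us; rewrite chiE; apply: adapted_indic; exact: history_chain. Qed.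

Lemma adapted_chi_chain s u i : 0 <= u -> adapted (chist s) \chi_(u, i).
Proof. by move=> u0; rewrite chiE; apply: adapted_indic; exact: chain_history_chain. Qed.

Lemma measurable_chi u i : 0 <= u -> measurable_fun setT \chi_(u, i).
Proof. by move=> u0; rewrite chiE; apply: measurable_indic; exact: chain_measurable hX _ _ u0. Qed.

Lemma chi_le1 u i w : `|(X u w == i)%:R : R| <= 1.
Proof. by case: (X u w == i); rewrite ?normr1 ?normr0. Qed.

Lemma RintegrableM_chi u i (Y : T -> R) : 0 <= u -> Rintegrable Y ->
  Rintegrable (fun w => Y w * (X u w == i)%:R).
Proof.
move=> u0 iY; have -> : (fun w => Y w * (X u w == i)%:R) = (fun w => (X u w == i)%:R * Y w).
  by apply/funext => w; rewrite mulrC.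
by apply: (RintegrableM_bounded (measurable_chi i u0) (chi_le1 u i)).
Qed.

Lemma sum_chi u w : \sum_i ((X u w == i)%:R : R) = 1.
Proof.
rewrite (bigD1 (X u w))//= eqxx big1 ?addr0// => i.
by rewrite eq_sym => /negPf ->.
Qed.

(** The two integrands vanish off the events on the states; on sets that avoid 0 their laws are
    proportional by [markov_history], and [scaled_law] passes to the means. *)
Lemma mean_markov s t i j (Y : T -> R) : 0 <= s -> s <= t ->
  adapted (hist s) Y -> Rintegrable Y ->
  \int[P]_w (Y w * (X s w == i)%:R * (X t w == j)%:R) =
    expmx ((t - s) *: Q) i j * \int[P]_w (Y w * (X s w == i)%:R).
Proof.
move=> s0 st aY iY; have t0 : 0 <= t by rewrite (le_trans s0).
set Y1 := fun w => _ * _ * _; set Y2 := fun w => Y w * _.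
have i2 : Rintegrable Y2 by exact: RintegrableM_chi.
have i1 : Rintegrable Y1 by exact: RintegrableM_chi.
have mA u k := @chain_measurable _ _ _ _ _ _ _ hX u k.
have E1 (U : set R) : ~ U 0 -> Y1 @^-1` U =
    Y @^-1` U `&` (X s @^-1` [set i] `&` X t @^-1` [set j]).
  move=> U0; apply/seteqP; split => w; rewrite /Y1 /=.
    have [->|] := eqVneq (X s w) i; have [->|] := eqVneq (X t w) j;
      rewrite ?mulr1 ?mulr0 ?mul0r //.
  by move=> [UY [-> ->]]; rewrite !eqxx !mulr1.
have E2 (U : set R) : ~ U 0 -> Y2 @^-1` U = Y @^-1` U `&` X s @^-1` [set i].
  move=> U0; apply/seteqP; split => w; rewrite /Y2 /=.
    by have [->|] := eqVneq (X s w) i; rewrite ?mulr1 ?mulr0.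
  by move=> [UY ->]; rewrite !eqxx !mulr1.
have hY (U : set R) : measurable U -> <<s hist s >> (Y @^-1` U) by move/adaptedP : aY; exact.
have mY (U : set R) : measurable U -> measurable (Y @^-1` U).
  move=> mU; apply: (sub_sigma_measurable _ (hY U mU)).
  exact: history_measurable hX _.
(* If the state [i] has probability 0 at time [s], both sides vanish: each law is 0 times itself
   away from 0. The Markov property says nothing about the sign of the matrix entry in this case. *)
have [Pi|Pi] := eqVneq (P (X s @^-1` [set i])) 0%E.
  have z2 (U : set R) : measurable U -> ~ U 0 -> P (Y2 @^-1` U) = (0%:E * P (Y2 @^-1` U))%E.
    move=> mU U0; rewrite mul0e E2//; apply/eqP; rewrite -measure_le0 -Pi.
    by apply: le_measure; rewrite ?inE//; [apply: measurableI; [exact: mY|exact: mA]|exact: mA].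
  have z1 (U : set R) : measurable U -> ~ U 0 -> P (Y1 @^-1` U) = (0%:E * P (Y2 @^-1` U))%E.
    move=> mU U0; rewrite mul0e E1//; apply/eqP; rewrite -measure_le0 -Pi.
    apply: le_measure; rewrite ?inE//; [|exact: mA|by move=> w [_ []]].
    by apply: measurableI; [exact: mY|apply: measurableI; exact: mA].
  rewrite (scaled_law i1 i2 (lexx _) z1) mul0r.
  by rewrite (scaled_law i2 i2 (lexx _) z2) mul0r mulr0.
(* Otherwise the Markov property with the full event exhibits the entry as the ratio of two
   probabilities. *)
have p0 : 0 <= expmx ((t - s) *: Q) i j.
  have [_ _ mk] := hX.
  have := mk s t i j setT s0 st (@measurableT _ (g_sigma_algebraType _)).
  rewrite !setTI => h.
  have : (0 <= P (X s @^-1` [set i] `&` X t @^-1` [set j]))%E by exact: measure_ge0.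
  rewrite h pmule_rge0 ?lee_fin// lt_neqAle eq_sym Pi measure_ge0//.
apply: (scaled_law i1 i2 p0) => U mU U0.
by rewrite E1// E2//; apply: (markov_history hX hXB s0 st p0); exact: hY.
Qed.

(** Decomposing over the state [i] at time [s] gives the sum of P(X_s = i) (1 - p_ii), and each
    probability is at most 1. *)
Lemma prob_chain_leave s t : 0 <= s -> s <= t ->
  \int[P]_w ((X t w != X s w)%:R : R) <= \sum_i `|1 - expmx ((t - s) *: Q) i i|.
Proof.
move=> s0 st; have t0 : 0 <= t by rewrite (le_trans s0).
have E w : (X t w != X s w)%:R =
    \sum_i (1 * (X s w == i)%:R + (-1) * (1 * (X s w == i)%:R * (X t w == i)%:R)) :> R.
  rewrite (bigD1 (X s w))//= big1 ?addr0 => [|i]; last first.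
    by rewrite eq_sym => /negPf ->; rewrite !(mulr0, mul0r) addr0.
  rewrite eqxx; case: (X t w == X s w) => /=; rewrite !mul1r ?mulr1 ?mulr0; ring.
under eq_Rintegral do rewrite E.
have c1 := Rintegrable_cst P (1 : R).
have ic i : Rintegrable (fun w => 1 * (X s w == i)%:R) by exact: (RintegrableM_chi i s0 c1).
have icc i : Rintegrable (fun w => 1 * (X s w == i)%:R * (X t w == i)%:R) by exact: RintegrableM_chi.
rewrite mean_sum; last by move=> i; apply: RintegrableD => //; exact: RintegrableZ.
apply: ler_sum => i _.
rewrite meanD//; last exact: RintegrableZ.
have a1 : adapted (hist s) (cst (1 : R)) by exact: adapted_cst.
have /= mk := mean_markov i i s0 st a1 c1.
rewrite (meanZ (-1) (icc i)) mk.
set m := \int[P]_w _.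
have m0 : 0 <= m by apply: Rintegral_ge0 => w _; rewrite mulr_ge0.
have m1 : m <= 1.
  rewrite -[leRHS](mean_cst P) le_mean// => w.
  by rewrite mul1r; case: (X s w == i).
have -> : m + -1 * (expmx ((t - s) *: Q) i i * m) = (1 - expmx ((t - s) *: Q) i i) * m by ring.
apply: (le_trans (ler_norm _)); rewrite normrM (ger0_norm m0).
by rewrite ler_piMr.
Qed.

End ModelExpectations.

(** * Ito isometry for step processes *)

Section ItoIsometry.
Context (disp : measure_display) (T : measurableType disp) (R : realType)
  (P : probability T R) (d : nat) (Q : 'M[R]_d)
  (X : R -> T -> 'I_d) (B : R -> {RV P >-> R}).
Hypothesis hX : is_markov_chain P Q X.
Hypothesis hB : is_brownian_motion B.
Hypothesis hXB : independent_chain_real X B.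

Local Notation dB := (increment B).
Local Notation hist := (history X B).
Local Notation chist := (chain_history X B).
Local Notation Rintegrable := (Rintegrable P).

Definition overlap (a b a' b' : R) : R := Num.max 0 (Num.min b b' - Num.max a a').

Lemma overlapC a b a' b' : overlap a b a' b' = overlap a' b' a b.
Proof. by rewrite /overlap minC maxC [Num.max a a']maxC maxC. Qed.

Lemma mean_adapted_increment s t (Z : T -> R) : 0 <= s -> s <= t ->
  adapted (hist s) Z -> Rintegrable Z ->
  [/\ Rintegrable (fun w => Z w * dB s t w), Rintegrable (fun w => Z w * dB s t w ^+ 2),
      \int[P]_w (Z w * dB s t w) = 0 &
      \int[P]_w (Z w * dB s t w ^+ 2) = (t - s) * \int[P]_w Z w].
Proof.
move=> s0 st aZ iZ.
have aZ' : adapted (chist s) Z by apply: adapted_sub aZ; exact: history_chain_history.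
have [i2 e2] := mean_mul_increment hX hB hXB 2 s0 st aZ' iZ.
have [i1 e1] := mean_mul_increment hX hB hXB 1 s0 st aZ' iZ.
have E1 : (fun w => Z w * dB s t w ^+ 1) = (fun w => Z w * dB s t w).
  by apply/funext => w; rewrite expr1.
rewrite E1 in i1; split => //.
  transitivity (\int[P]_w (Z w * dB s t w ^+ 1)); first by rewrite E1.
  rewrite e1; under [X in _ * X]eq_Rintegral do rewrite expr1.
  by rewrite (increment_mean hB)// mulr0.
by rewrite e2 (increment_variance hB)// mulrC.
Qed.

Lemma adapted_increment s u v : 0 <= u -> u <= v -> v <= s -> adapted (hist s) (dB u v).
Proof.
move=> u0 uv vs; apply: adaptedB; apply: adapted_brownian => //.
- exact: le_trans uv.
- exact: le_trans vs.
Qed.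

Lemma adapted_le s t (Y : T -> R) : s <= t -> adapted (hist s) Y -> adapted (hist t) Y.
Proof. by move=> st; apply: adapted_sub; exact: le_history. Qed.

(** With [a <= a'], everything before [a'] can be put into an adapted factor, and only the increment
    over the common part of the two intervals contributes. Adaptedness is asked for nonempty
    intervals only: when partition times are truncated at a final time, the intervals beyond it
    collapse while their coefficients are not adapted to that time. *)
Lemma elementary_cross (a b a' b' : R) (c c' : T -> R) (C C' : R) :
  0 <= a -> a <= b -> 0 <= a' -> a' <= b' ->
  measurable_fun setT c -> measurable_fun setT c' ->
  (a < b -> adapted (hist a) c) -> (a' < b' -> adapted (hist a') c') ->
  (forall w, `|c w| <= C) -> (forall w, `|c' w| <= C') ->
  Rintegrable (fun w => c w * dB a b w * (c' w * dB a' b' w)) /\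
  \int[P]_w (c w * dB a b w * (c' w * dB a' b' w)) =
    overlap a b a' b' * \int[P]_w (c w * c' w).
Proof.
wlog aa' : a b a' b' c c' C C' / a <= a'.
  move=> H; have [aa'|/ltW a'a] := leP a a'; first exact: H.
  move=> a0 ab a'0 ab' mc mc' ac ac' cC cC'.
  have [i e] := H a' b' a b c' c C' C a'a a'0 ab' a0 ab mc' mc ac' ac cC' cC.
  have E : (fun w => c w * dB a b w * (c' w * dB a' b' w)) =
     (fun w => c' w * dB a' b' w * (c w * dB a b w)).
    by apply/funext => w; rewrite mulrC.
  rewrite E e overlapC; split => //; congr (_ * _).
  by apply: eq_Rintegral => w _; rewrite mulrC.
move=> a0 ab a'0 ab' mc mc' ac ac' cC cC'.
have zero (f : T -> R) : (forall w, f w = 0) -> Rintegrable f /\ \int[P]_w f w = 0.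
  move=> f0; have -> : f = cst 0 by apply/funext.
  by split; [exact: Rintegrable_cst|exact: mean_cst].
have [ab0|ab1] := eqVneq a b.
  have [|i e] := zero (fun w => c w * dB a b w * (c' w * dB a' b' w)).
    by move=> w; rewrite /increment ab0 subrr mulr0 mul0r.
  split => //; rewrite e /overlap ab0 max_l ?mul0r// subr_le0.
  by rewrite (@le_trans _ _ b)// ?ge_min ?lexx// le_max lexx.
have [ab0'|ab1'] := eqVneq a' b'.
  have [|i e] := zero (fun w => c w * dB a b w * (c' w * dB a' b' w)).
    by move=> w; rewrite /increment ab0' subrr mulr0 mulr0.
  split => //; rewrite e /overlap ab0' max_l ?mul0r// subr_le0.
  by rewrite (@le_trans _ _ b')// ?ge_min ?lexx ?orbT// le_max lexx orbT.
have {}ac : adapted (hist a') c.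
  by apply: (adapted_le aa'); apply: ac; rewrite lt_neqAle ab1.
have {}ac' : adapted (hist a') c' by apply: ac'; rewrite lt_neqAle ab1'.
pose Y w := c w * c' w.
have aY : adapted (hist a') Y by exact: adaptedM.
have mY : measurable_fun setT Y by exact: measurable_funM.
have YC w : `|Y w| <= C * C' by rewrite normrM ler_pM.
have iY : Rintegrable Y := Rintegrable_bounded P mY YC.
have incr u v : 0 <= u -> u <= v -> Rintegrable (dB u v).
  move=> u0 uv; have := increment_Rintegrable hB 1 u0 uv.
  by under eq_fun do rewrite expr1.
have YdB u v : 0 <= u -> u <= v -> Rintegrable (fun w => Y w * dB u v w).
  by move=> u0 uv; apply: RintegrableM_bounded mY YC _; exact: incr.
have [ba'|a'b] := leP b a'.
  have aZ : adapted (hist a') (fun w => Y w * dB a b w).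
    by apply: adaptedM => //; exact: adapted_increment.
  have [i _ e _] := mean_adapted_increment a'0 ab' aZ (YdB _ _ a0 ab).
  have E : (fun w => c w * dB a b w * (c' w * dB a' b' w)) =
     (fun w => Y w * dB a b w * dB a' b' w).
    by apply/funext => w; rewrite /Y; ring.
  rewrite E; split => //; rewrite e /overlap max_l ?mul0r// subr_le0.
  by rewrite (@le_trans _ _ b)// ?ge_min ?lexx// le_max ba' orbT.
set m := Num.min b b'; pose mx := Num.max b b'.
have a'm : a' <= m by rewrite /m le_min ab' ltW.
have m0 : 0 <= m by exact: le_trans a'm.
have mmx : m <= mx by rewrite /m /mx ge_min le_max lexx.
have -> : overlap a b a' b' = m - a'.
  by rewrite /overlap -/m [Num.max a a']max_r// max_r// subr_ge0.
(* Cutting at [a'] and at the smaller right end point leaves one square; the other two products end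
   with an increment that is independent of an adapted integrable factor, so their means are 0. *)
have E : (fun w => c w * dB a b w * (c' w * dB a' b' w)) =
   (fun w => (Y w * dB a a' w * dB a' b' w + Y w * dB a' m w ^+ 2)
     + Y w * dB a' m w * dB m mx w).
  apply/funext => w; rewrite /Y /increment /m /mx.
  by case: (leP b b') => _; ring.
have aZ : adapted (hist a') (fun w => Y w * dB a a' w).
  by apply: adaptedM => //; exact: adapted_increment.
have aZm : adapted (hist m) (fun w => Y w * dB a' m w).
  by apply: adaptedM; [exact: adapted_le aY|exact: adapted_increment].
have [i1 _ e1 _] := mean_adapted_increment a'0 ab' aZ (YdB _ _ a0 aa').
have [_ i2 _ e2] := mean_adapted_increment a'0 a'm aY iY.
have [i3 _ e3 _] := mean_adapted_increment m0 mmx aZm (YdB _ _ a'0 a'm).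
rewrite E; split; first by do 2 apply: RintegrableD => //.
by rewrite meanD//; [rewrite meanD// e1 e2 e3 add0r addr0|exact: RintegrableD].
Qed.

Section Family.
Variables (I : finType) (c : I -> T -> R) (a b : I -> R) (C : I -> R).
Hypotheses (a0 : forall i, 0 <= a i) (ab : forall i, a i <= b i)
  (mc : forall i, measurable_fun setT (c i))
  (ac : forall i, a i < b i -> adapted (hist (a i)) (c i))
  (cC : forall i w, `|c i w| <= C i).

(** By [step_square_integral] this is the integral over time of the squared step integrand, along
    the path [w]. *)
Definition elementary_energy (w : T) : R :=
  \sum_i \sum_j overlap (a i) (b i) (a j) (b j) * (c i w * c j w).

(** The intervals are arbitrary and may overlap, hence the double sum instead of a sum of
    squares. *)
Lemma elementary_isometry :
  [/\ Rintegrable (fun w => (\sum_i c i w * dB (a i) (b i) w) ^+ 2),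
      Rintegrable elementary_energy &
      \int[P]_w ((\sum_i c i w * dB (a i) (b i) w) ^+ 2) =
      \int[P]_w elementary_energy w].
Proof.
have cross i j := elementary_cross (a0 i) (ab i) (a0 j) (ab j) (mc i) (mc j)
  (@ac i) (@ac j) (cC i) (cC j).
have icc i j : Rintegrable (fun w => c i w * c j w).
  apply: (@Rintegrable_bounded _ _ _ _ _ (C i * C j)); first exact: measurable_funM.
  by move=> w; rewrite normrM ler_pM.
have E : (fun w => (\sum_i c i w * dB (a i) (b i) w) ^+ 2) =
  (fun w => \sum_i \sum_j c i w * dB (a i) (b i) w * (c j w * dB (a j) (b j) w)).
  apply/funext => w; rewrite expr2 mulr_suml; apply: eq_bigr => i _.
  by rewrite mulr_sumr.
rewrite E; split.
- by apply: Rintegrable_sum => i; apply: Rintegrable_sum => j; exact: (cross i j).1.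
- by apply: Rintegrable_sum => i; apply: Rintegrable_sum => j; exact: RintegrableZ.
rewrite /elementary_energy mean_sum; last first.
  by move=> i; apply: Rintegrable_sum => j; exact: (cross i j).1.
rewrite mean_sum; last first.
  by move=> i; apply: Rintegrable_sum => j; exact: RintegrableZ.
apply: eq_bigr => i _.
rewrite mean_sum; last by move=> j; exact: (cross i j).1.
rewrite mean_sum; last by move=> j; exact: RintegrableZ.
apply: eq_bigr => j _.
by rewrite meanZ// (cross i j).2.
Qed.

End Family.

Lemma itv_oc_setI (a b a' b' : R) :
  [set` `]a, b]] `&` [set` `]a', b']] = [set` `]Num.max a a', Num.min b b']].
Proof.
apply/seteqP; split => x /=; rewrite !in_itv/= gt_max le_min.
  by move=> [/andP[-> ->] /andP[-> ->]].
by move=> /andP[/andP[-> ->] /andP[-> ->]].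
Qed.

Lemma lebesgue_overlap (a b a' b' : R) :
  lebesgue_measure ([set` `]a, b]] `&` [set` `]a', b']]) = (overlap a b a' b')%:E.
Proof.
rewrite itv_oc_setI.
rewrite lebesgue_measure_itv/= lte_fin /overlap.
case: ltP => h; last by rewrite [Num.max 0 _]max_l// subr_le0.
by rewrite -EFinB [Num.max 0 _]max_r// subr_ge0 ltW.
Qed.

Lemma step_square_integral (I : finType) (c a b : I -> R) (t : R) :
  (forall i, 0 <= a i) -> (forall i, b i <= t) ->
  (\int[lebesgue_measure]_(s in `[0%R, t])
     ((\sum_i c i * ((a i < s) && (s <= b i))%:R) ^+ 2)%:E =
   (\sum_i \sum_j overlap (a i) (b i) (a j) (b j) * (c i * c j))%:E)%E.
Proof.
move=> a0 bt.
pose K i j := [set` `]a i, b i]] `&` [set` `]a j, b j]].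
have mK i j : measurable (K i j) by apply: measurableI.
have E (s : R) : (\sum_i c i * ((a i < s) && (s <= b i))%:R) ^+ 2 =
    \sum_i \sum_j c i * c j * \1_(K i j) s.
  rewrite expr2 mulr_suml; apply: eq_bigr => i _; rewrite mulr_sumr.
  apply: eq_bigr => j _; rewrite /K indicI /= !indicE !mem_setE/= !in_itv/=; ring.
have KI i j : K i j `<=` [set` `[0, t]].
  move=> s [/=]; rewrite !in_itv/= => /andP[ai bi] _.
  by rewrite (le_trans (a0 i) (ltW ai)) (le_trans bi (bt i)).
have fin i j : lebesgue_measure (K i j) = (overlap (a i) (b i) (a j) (b j))%:E.
  exact: lebesgue_overlap.
have int0 i j : lebesgue_measure.-integrable [set` `[0, t]] (EFin \o \1_(K i j)).
  by rewrite /K itv_oc_setI; apply: integrableS (integrable_indic_itv _ _ _ _).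
have int1 i j : lebesgue_measure.-integrable [set` `[0, t]]
    (fun s : R => (c i * c j)%:E * (\1_(K i j) s)%:E)%E.
  apply: integrableZl => //; exact: int0.
under eq_integral do rewrite E.
have E2 (s : R) : (\sum_i \sum_j c i * c j * \1_(K i j) s)%:E =
    (\sum_(i : I) \sum_(j : I) ((c i * c j)%:E * (\1_(K i j) s)%:E))%E.
  rewrite -sumEFin; apply: eq_bigr => i _; rewrite -sumEFin; apply: eq_bigr => j _.
  by rewrite EFinM.
under eq_integral do rewrite E2.
rewrite integral_sum//; last by move=> i; apply: integrable_sum.
rewrite -sumEFin; apply: eq_bigr => i _; rewrite integral_sum//.
rewrite -sumEFin; apply: eq_bigr => j _.
rewrite integralZl//; last exact: int0.
rewrite integral_indic//; last exact: mK.
by rewrite setIidl// [X in (_ * X)%E]fin -EFinM mulrC.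
Qed.

End ItoIsometry.

(** * Time spent by the chain away from its grid values *)

Section Monotonicity.
Import HBNNSimple.

(** The integral of a nonnegative function is a supremum over the simple functions below it, so
    monotonicity holds for arbitrary functions. This serves for inner integrals whose measurability
    in [w] is not established. *)
Lemma ge0_integral_mono (disp : measure_display) (T : measurableType disp)
    (R : realType) (mu : {measure set T -> \bar R}) (f g : T -> \bar R) :
  (forall x, 0 <= f x)%E -> (forall x, f x <= g x)%E ->
  (\int[mu]_x f x <= \int[mu]_x g x)%E.
Proof.
move=> f0 fg; have g0 x : (0 <= g x)%E := le_trans (f0 x) (fg x).
rewrite !ge0_integralTE//; apply: ereal_sup_le => _ [h hf <-].
by exists h => //= x; apply: le_trans (fg x); exact: hf.
Qed.

End Monotonicity.

Section JointMeasurability.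
Context (disp : measure_display) (T : measurableType disp) (R : realType)
  (P : probability T R) (d : nat) (Q : 'M[R]_d)
  (X : R -> T -> 'I_d) (G : set T).
Hypothesis hX : is_markov_chain P Q X.
Hypothesis mG : measurable G.
Hypothesis hG : forall w, G w -> forall t : R, 0 <= t ->
        \forall s \near t^'+, X s w = X t w.
Local Notation RT := (measurableTypeR R * T)%type.

Definition chain_graph (i : 'I_d) : set RT :=
  [set z | [/\ 0 <= z.1, G z.2 & X z.1 z.2 = i]].

Definition chain_graph_approx (n : nat) (i : 'I_d) : set RT :=
  \bigcup_k ([set` `[k%:R / n.+1%:R, k.+1%:R / n.+1%:R[]
     `*` (X (k.+1%:R / n.+1%:R) @^-1` [set i])).

Lemma measurable_chain_graph_approx n i : measurable (chain_graph_approx n i).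
Proof.
apply: bigcupT_measurable => k; apply: measurableX => //.
by apply: (chain_measurable hX); rewrite divr_ge0.
Qed.

(** Right-continuity in a discrete space means local constancy to the right, so replacing [X] on
    each cell by its value at the right end point is exact for all fine enough cells. The graph is
    thus a lower limit of countable unions of rectangles, hence jointly measurable. *)
Lemma chain_graphE i : chain_graph i =
  ([set` `[0, +oo[] `*` G) `&` \bigcup_N \bigcap_(n in [set n | (N <= n)%N]) chain_graph_approx n i.
Proof.
apply/seteqP; split => -[s w] /=.
  move=> [s0 Gw Xi]; split; first by split=> //=; rewrite in_itv/= s0.
  have [e /= e0 He] := hG Gw s0.
  have [N _ NE] : \forall n \near \oo, n.+1%:R^-1 < e by exact: near_infty_natSinv_lt (PosNum e0).
  (* The truncation of s (n+1) is the index of the cell containing [s]; its right end point lies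
     strictly to the right of [s], at distance at most 1 / (n+1). *)
  exists N => // n /= Nn; exists (Num.truncn (s * n.+1%:R)) => //.
  have n0 : (0 : R) < n.+1%:R by rewrite ltr0n.
  have /andP[l1 l2] := truncn_itv (mulr_ge0 s0 (ltW n0)).
  split => /=; first by rewrite in_itv/= ler_pdivrMr// l1 ltr_pdivlMr.
  rewrite -Xi; apply: He => /=; last by rewrite ltr_pdivlMr.
  rewrite /ball/= distrC ger0_norm; last by rewrite subr_ge0 ler_pdivlMr// ltW.
  apply: le_lt_trans (NE n Nn); rewrite lerBlDr ler_pdivrMr//.
  by rewrite mulrDl mulVf ?gt_eqF// -natr1 addrC lerD2l.
move=> [[/= s0 Gw] [N _ HN]]; rewrite in_itv/= andbT in s0.
split => //.
have [e /= e0 He] := hG Gw s0.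
have [N' _ NE] : \forall n \near \oo, n.+1%:R^-1 < e by exact: near_infty_natSinv_lt (PosNum e0).
pose n := maxn N N'.
have n0 : (0 : R) < n.+1%:R by rewrite ltr0n.
have [k _ [/=]] := HN n (leq_maxl _ _).
rewrite in_itv/= => /andP[l1 l2] <-.
apply/esym; apply: He => //=.
rewrite /ball/= distrC ger0_norm; last by rewrite subr_ge0 ltW.
apply: le_lt_trans (NE n (leq_maxr _ _)).
rewrite lerBlDr -[k.+1]addn1 natrD mulrDl div1r addrC lerD2l//.
Qed.

Lemma measurable_chain_graph i : measurable (chain_graph i).
Proof.
rewrite chain_graphE; apply: measurableI; first exact: measurableX.
apply: bigcupT_measurable => N; apply: bigcap_measurableType => // n _.
exact: measurable_chain_graph_approx.
Qed.

(** The restriction to [G], where the paths are right-continuous, is what makes this set jointly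
    measurable. *)
Definition mismatch (u v : R) : set RT :=
  [set z | [/\ u < z.1, z.1 <= v, G z.2 & X z.1 z.2 != X u z.2]].

Lemma measurable_mismatch u v : 0 <= u -> measurable (mismatch u v).
Proof.
move=> u0.
have -> : mismatch u v = ([set` `]u, v]] `*` setT) `&`
    \big[setU/set0]_(i < d) (chain_graph i `&` (setT `*` ~` (X u @^-1` [set i]))).
  apply/seteqP; split => -[s w] /=.
    move=> [us sv Gw /eqP ne]; split; first by split=> //=; rewrite in_itv/= us sv.
    rewrite -bigcup_seq; exists (X s w); rewrite //= ?mem_index_enum//.
    split; first by split=> //=; rewrite (le_trans u0)// ltW.
    by split => //= e; apply: ne.
  move=> [[/= + _]]; rewrite in_itv/= => /andP[us sv].
  rewrite -bigcup_seq => -[i _ [[/= _ Gw Xi] [_ ne]]]; split => //=.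
  by apply/eqP; rewrite Xi => e; apply: ne.
apply: measurableI; first exact: measurableX.
apply: bigsetU_measurable => i _; apply: measurableI; first exact: measurable_chain_graph.
apply: measurableX => //; apply: measurableC; exact: (chain_measurable hX).
Qed.

Definition mismatch_time (u v : R) (w : T) : \bar R :=
  (\int[lebesgue_measure]_s (\1_(mismatch u v) (s, w))%:E)%E.

Let f_meas u v : 0 <= u -> measurable_fun setT (fun z : RT => (\1_(mismatch u v) z)%:E : \bar R).
Proof.
by move=> u0; apply/measurable_EFinP; apply: measurable_indic; exact: measurable_mismatch.
Qed.

Lemma measurable_mismatch_time u v : 0 <= u -> measurable_fun setT (mismatch_time u v).
Proof.
move=> u0; apply: (@measurable_fun_fubini_tonelli_G _ _ _ _ R (@lebesgue_measure R)
  (fun z : RT => (\1_(mismatch u v) z)%:E)); first exact: f_meas.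
by move=> z; rewrite lee_fin.
Qed.

Lemma mismatch_time_ge0 u v w : (0 <= mismatch_time u v w)%E.
Proof. by apply: integral_ge0 => s _; rewrite lee_fin. Qed.

Lemma measurable_mismatch_section u v w : 0 <= u ->
  measurable_fun setT (fun s : measurableTypeR R => \1_(mismatch u v) (s, w) : R).
Proof.
move=> u0; have h : measurable_fun setT ((\1_(mismatch u v) : RT -> R) \o
    (fun s : measurableTypeR R => (s, w))).
  apply: measurableT_comp; last exact: pair2_measurable.
  by apply: measurable_indic; exact: measurable_mismatch.
exact: h.
Qed.

Lemma mismatch_time_fin u v w : 0 <= u -> mismatch_time u v w \is a fin_num.
Proof.
move=> u0; rewrite ge0_fin_numE ?mismatch_time_ge0//.
apply: (@le_lt_trans _ _ (\int[lebesgue_measure]_s (\1_([set` `]u, v]]) s)%:E)%E).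
  apply: ge0_integral_mono => s; first by rewrite lee_fin.
  rewrite lee_fin !indicE ler_nat; case: (boolP ((s, w) \in _)) => //.
  by rewrite inE => -[/= us sv _ _]; rewrite mem_set//= in_itv/= us sv.
rewrite integral_indic//= setIT lebesgue_measure_itv/=.
by case: ifPn => _; rewrite ?ltry// -EFinB ltry.
Qed.

(** Tonelli's theorem: at each time of ]u, v] the mismatch has probability at most L (v - u), and
    the length of the interval supplies the second factor. Over the t / h blocks of a grid this sums
    to O(h). *)
Lemma mean_mismatch_time (L : R) u v : 0 <= L -> 0 <= u -> u <= v ->
  (forall s, u <= s -> s <= v -> \int[P]_w ((X s w != X u w)%:R : R) <= L * (v - u)) ->
  (\int[P]_w mismatch_time u v w <= (L * (v - u) ^+ 2)%:E)%E.
Proof.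
move=> L0 u0 uv hL.
have -> : (\int[P]_w mismatch_time u v w =
   \int[lebesgue_measure]_s \int[P]_w (\1_(mismatch u v) (s, w))%:E)%E.
  have := @fubini_tonelli _ _ _ _ R (@lebesgue_measure R) P
     (fun z : RT => (\1_(mismatch u v) z)%:E) (f_meas v u0).
  by rewrite /fubini_F /fubini_G => -> // z; rewrite lee_fin.
apply: (@le_trans _ _ (\int[lebesgue_measure]_s ((L * (v - u)) * \1_([set` `]u, v]]) s)%:E)%E).
  apply: ge0_integral_mono => s; first by apply: integral_ge0 => w _; rewrite lee_fin.
  rewrite indicE; case: (boolP (s \in [set` `]u, v]])) => [|ns]; last first.
    rewrite mulr0 integral0_eq// => w _; rewrite indicE memNset// => -[/= us sv _ _].
    by move/negP: ns; apply; rewrite inE/= in_itv/= us sv.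
  rewrite inE/= in_itv/= => /andP[us sv]; rewrite mulr1.
  apply: (@le_trans _ _ (\int[P]_w ((X s w != X u w)%:R : R)%:E)%E).
    apply: ge0_integral_mono => w; first by rewrite lee_fin.
    rewrite lee_fin indicE ler_nat; case: (boolP ((s, w) \in _)) => //.
    by rewrite inE => -[/= _ _ _ ->].
  rewrite -EFin_Rintegral; first by rewrite lee_fin; apply: hL => //; exact: ltW.
  apply: (@Rintegrable_bounded _ _ _ _ _ 1).
    have -> : (fun w => (X s w != X u w)%:R : R) =
       (fun w => \sum_i (X u w == i)%:R * (1 - (X s w == i)%:R)).
      apply/funext => w; rewrite (bigD1 (X u w))//= big1 ?addr0 => [|i].
        by rewrite eqxx mul1r; case: (X s w == X u w); rewrite /= ?subrr ?subr0.
      by rewrite eq_sym => /negPf ->; rewrite mul0r.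
    apply: measurable_sum => i; apply: measurable_funM; first exact: (measurable_chi hX).
    apply: measurable_funB => //; apply: (measurable_chi hX).
    by rewrite (le_trans u0)// ltW.
  by move=> w; case: (_ != _); rewrite ?normr1 ?normr0.
have Lv0 : 0 <= L * (v - u) by rewrite mulr_ge0// subr_ge0.
under eq_integral do rewrite EFinM.
rewrite ge0_integralZl//; last by apply/measurable_EFinP; exact: measurable_indic.
rewrite integral_indic//= setIT lebesgue_measure_itv/= lte_fin.
case: ifPn => [_|]; first by rewrite -EFinB -EFinM expr2 mulrA.
by rewrite mule0 lee_fin mulr_ge0// sqr_ge0.
Qed.

End JointMeasurability.

Section LeaveRate.
Context (disp : measure_display) (T : measurableType disp) (R : realType)
  (P : probability T R) (d : nat) (Q : 'M[R]_d)
  (X : R -> T -> 'I_d) (B : R -> {RV P >-> R}).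
Hypothesis hX : is_markov_chain P Q X.
Hypothesis hXB : independent_chain_real X B.

(** The first term is the rate of leaving [i]; the second bounds the Taylor remainder of the
    transition matrix over times at most 1. *)
Definition leave_rate : R := \sum_i (`|Q i i| + mxnorm1 Q ^+ 2 * expR (mxnorm1 Q)).

Lemma leave_rate_ge0 : 0 <= leave_rate.
Proof. by apply: sumr_ge0 => i _; nonneg. Qed.

Lemma leave_rateP s t : 0 <= s -> s <= t -> t - s <= 1 ->
  \int[P]_w ((X t w != X s w)%:R : R) <= leave_rate * (t - s).
Proof.
move=> s0 st ts1; rewrite (le_trans (prob_chain_leave hX hXB s0 st))//.
rewrite mulr_suml; apply: ler_sum => i _.
set h := t - s in ts1 *; have h0 : 0 <= h by rewrite subr_ge0.
have := expmx_step Q i i (lexx 0) h0; rewrite add0r expmx0 mulmx1 [1%:M i i]mxE eqxx => e.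
have -> : 1 - expmx (h *: Q) i i = - (expmx (h *: Q) i i - 1 - h * Q i i) + - (h * Q i i).
  by ring.
rewrite (le_trans (ler_normD _ _))// !normrN [leRHS]mulrDl [leRHS]addrC lerD//; last first.
  by rewrite normrM (ger0_norm h0) mulrC.
rewrite (le_trans e)//; have c0 := mxnorm1_ge0 Q.
have -> : (mxnorm1 Q * h) ^+ 2 * expR (mxnorm1 Q * h) =
   mxnorm1 Q ^+ 2 * (h * expR (mxnorm1 Q * h)) * h by ring.
rewrite ler_wpM2r// ler_wpM2l ?sqr_ge0// -[leRHS]mul1r.
by apply: ler_pM; rewrite ?expR_ge0// ler_expR ler_piMr.
Qed.

End LeaveRate.

(** * Approximation of the stochastic integral on a grid *)

Section Grid.
Context (R : realType).

Lemma grid_block (h s : R) j : 0 < s -> s <= j%:R * h ->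
  exists2 i : 'I_j, i%:R * h < s & s <= i.+1%:R * h.
Proof.
elim: j => [|j IH] s0 sj; first by move: sj; rewrite mul0r leNgt s0.
have [sj'|sj'] := leP s (j%:R * h).
  by have [i i1 i2] := IH s0 sj'; exists (widen_ord (leqnSn j) i).
by exists ord_max.
Qed.

Lemma grid_step_value (h s : R) j (c : nat -> R) (i : 'I_j) : 0 <= h ->
  i%:R * h < s -> s <= i.+1%:R * h ->
  \sum_(k < j) c k * ((k%:R * h < s) && (s <= k.+1%:R * h))%:R = c i.
Proof.
move=> h0 i1 i2; rewrite (bigD1 i)//= i1 i2 mulr1 big1 ?addr0// => k ki.
have [ki'|ki'|/val_inj ki'] := ltngtP k i; last by rewrite ki' eqxx in ki.
- have : k.+1%:R * h < s by rewrite (le_lt_trans _ i1)// ler_wpM2r// ler_nat.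
  by move=> /lt_geF ->; rewrite andbF mulr0.
- have : s <= k%:R * h by rewrite (le_trans i2)// ler_wpM2r// ler_nat.
  by move=> /le_gtF ->; rewrite mulr0.
Qed.

End Grid.

Section ItoGrid.
Context (disp : measure_display) (T : measurableType disp) (R : realType)
  (P : probability T R) (d : nat) (Q : 'M[R]_d)
  (X : R -> T -> 'I_d) (B : R -> {RV P >-> R}) (G : set T).
Hypothesis hX : is_markov_chain P Q X.
Hypothesis hXB : independent_chain_real X B.
Hypothesis mG : measurable G.
Hypothesis hG : forall w, G w -> forall t : R, 0 <= t ->
        \forall s \near t^'+, X s w = X t w.

Local Notation mtime := (mismatch_time X G).
Local Notation mu := (@lebesgue_measure R).

Lemma measurable_chain_path (f : 'I_d -> R) (t : R) w : G w ->
  measurable_fun [set` `[0, t]] (fun s : R => f (X s w)).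
Proof.
move=> Gw.
pose g (s : R) := \sum_(l < d) f l * \1_(chain_graph X G l) (s, w).
apply: (@eq_measurable_fun _ _ _ _ _ g).
  move=> s; rewrite inE/= in_itv/= => /andP[s0 _].
  rewrite /g (bigD1 (X s w))//= indicE mem_set ?mulr1// big1 ?addr0// => l lX.
  rewrite indicE memNset ?mulr0// => -[_ _ /= e].
  by rewrite e eqxx in lX.
apply: measurable_funTS; apply: measurable_sum => l; apply: measurable_funM => //.
have h : measurable_fun setT ((\1_(chain_graph X G l) : (measurableTypeR R * T)%type -> R) \o
    (fun s : measurableTypeR R => (s, w))).
  apply: measurableT_comp; last exact: pair2_measurable.
  by apply: measurable_indic; exact: (measurable_chain_graph hX mG hG).
exact: h.
Qed.

Definition mismatch_total (h : R) (j : nat) (w : T) : \bar R :=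
  (\sum_(i < j) mtime (i%:R * h)%R (i.+1%:R * h)%R w)%E.

Lemma measurable_mismatch_total h j : 0 <= h -> measurable_fun setT (mismatch_total h j).
Proof.
move=> h0; apply: emeasurable_sum => i.
by apply: (measurable_mismatch_time hX mG hG); rewrite mulr_ge0.
Qed.

Lemma mismatch_total_ge0 h j w : (0 <= mismatch_total h j w)%E.
Proof. by apply: sume_ge0 => i _; exact: mismatch_time_ge0. Qed.

Lemma mismatch_total_fin h j w : 0 <= h -> mismatch_total h j w \is a fin_num.
Proof.
move=> h0; apply/sum_fin_numP => i _ _.
by apply: mismatch_time_fin; rewrite mulr_ge0.
Qed.

Lemma mean_mismatch_total h j : 0 <= h -> h <= 1 ->
  (\int[P]_w mismatch_total h j w <= (leave_rate Q * (j%:R * h) * h)%:E)%E.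
Proof.
move=> h0 h1; rewrite ge0_integral_sum//; last 2 first.
- by move=> i; apply: (measurable_mismatch_time hX mG hG); rewrite mulr_ge0.
- by move=> i w _; exact: mismatch_time_ge0.
have -> : (leave_rate Q * (j%:R * h) * h)%:E = (\sum_(i < j) (leave_rate Q * h ^+ 2)%:E)%E.
  rewrite sumEFin sumr_const card_ord -[_ *+ j]mulr_natl; congr EFin; ring.
apply: lee_sum => i _.
have E : i.+1%:R * h - i%:R * h = h by rewrite -[i.+1]addn1 natrD mulrDl mul1r addrAC subrr add0r.
have := @mean_mismatch_time _ _ _ _ _ _ _ _ hX mG hG (leave_rate Q) (i%:R * h) (i.+1%:R * h).
rewrite E => H; apply: H.
- exact: leave_rate_ge0.
- by rewrite mulr_ge0.
- by rewrite ler_wpM2r// ler_nat.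
- move=> s is1 is2.
  have sh : s - i%:R * h <= h by rewrite -[leRHS]E lerD2r.
  rewrite (le_trans (leave_rateP hX hXB _ is1 _)) ?mulr_ge0//.
    exact: le_trans sh h1.
  by rewrite ler_wpM2l ?leave_rate_ge0.
Qed.

(* On a block, the path differs from its value at the left end point only on the
   mismatch set; the point [0] lies in no block. *)
Lemma step_mismatch (h : R) j w (s : R) (f : R -> R) (D e : R) : 0 <= h -> G w ->
  0 <= D -> 0 <= e -> 0 <= s -> s <= j%:R * h ->
  (forall i : 'I_j, i%:R * h < s -> s <= i.+1%:R * h ->
     `|f s - f (i%:R * h)| <= D * (X s w != X (i%:R * h) w)%:R + e) ->
  s != 0 ->
  `|f s - \sum_(k < j) f (k%:R * h) * ((k%:R * h < s) && (s <= k.+1%:R * h))%:R|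
   <= D * \sum_(k < j) \1_(mismatch X G (k%:R * h) (k.+1%:R * h)) (s, w) + e.
Proof.
move=> h0 Gw D0 e0 s0 sj H sn0.
have sp : 0 < s by rewrite lt_neqAle eq_sym sn0.
have [i i1 i2] := grid_block sp sj.
rewrite (@grid_step_value _ h s j (fun k => f (k%:R * h)) i)//.
rewrite (le_trans (H i i1 i2))// lerD2r ler_wpM2l// (bigD1 i)//=.
have : (X s w != X (i%:R * h) w)%:R <= \1_(mismatch X G (i%:R * h) (i.+1%:R * h)) (s, w) :> R.
  rewrite indicE ler_nat; case: (boolP (X s w != X (i%:R * h) w)) => // ne.
  by rewrite mem_set.
by move=> /le_trans; apply; rewrite lerDl sumr_ge0.
Qed.

Lemma integral_mismatch_le (h : R) j w (D : R) : 0 <= h -> 0 <= D ->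
  (\int[mu]_s (D * (\sum_(k < j) \1_(mismatch X G (k%:R * h) (k.+1%:R * h)) (s, w)))%:E
    = D%:E * mismatch_total h j w)%E.
Proof.
move=> h0 D0; have mI (k : 'I_j) : measurable_fun setT
    (fun s : measurableTypeR R => (\1_(mismatch X G (k%:R * h) (k.+1%:R * h)) (s, w) : R)%:E).
  apply/measurable_EFinP; apply: (measurable_mismatch_section hX mG hG).
  by rewrite mulr_ge0.
under eq_integral do rewrite EFinM -sumEFin.
rewrite ge0_integralZl//.
- by rewrite ge0_integral_sum.
- exact: emeasurable_sum.
- by move=> s _; apply: sume_ge0.
Qed.

Variable sigma : 'cV[R]_d.
Local Notation sig i := (sigma i 0).

Definition coef_bound : R := \sum_i `|sig i|.

Lemma coef_diff_le i k : `|sig i - sig k| <= 2 * coef_bound * (i != k)%:R.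
Proof.
have [->|_] := eqVneq i k; first by rewrite subrr normr0 mulr0.
have le (l : 'I_d) : `|sig l| <= coef_bound by rewrite /coef_bound (bigD1 l)//= lerDl sumr_ge0.
by rewrite mulr1 (le_trans (ler_normB _ _))// mulr_natl mulr2n lerD.
Qed.

Lemma coef_bound_ge0 : 0 <= coef_bound.
Proof. exact: sumr_ge0. Qed.

Definition sigma_step (h : R) (j : nat) (s : R) (w : T) : R :=
  \sum_(k < j) sig (X (k%:R * h) w) * ((k%:R * h < s) && (s <= k.+1%:R * h))%:R.

Lemma energy_mismatch (h : R) j w : 0 <= h -> G w ->
  (\int[mu]_(s in [set` `[0%R, (j%:R * h)%R]]) ((sig (X s w) - sigma_step h j s w) ^+ 2)%:E
   <= (4 * coef_bound ^+ 2)%:E * mismatch_total h j w)%E.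
Proof.
move=> h0 Gw; set c := 4 * _; have c0 : 0 <= c by rewrite mulr_ge0 ?sqr_ge0.
rewrite integral_mkcond.
pose g (s : R) : R := \sum_(k < j) \1_(mismatch X G (k%:R * h) (k.+1%:R * h)) (s, w).
have g0 s : 0 <= g s by apply: sumr_ge0.
have sb0 := coef_bound_ge0.
(* The indicator of the point 0 pays for the time 0, which lies in no block: there the step function
   is 0 while sigma need not be. It has integral 0. *)
apply: (@le_trans _ _ (\int[mu]_s (((c * g s)%:E) + (c * \1_[set (0:R)] s)%:E))%E).
  apply: ge0_integral_mono => s; rewrite patchE; case: ifPn => //.
  - by move=> _; rewrite lee_fin sqr_ge0.
  - rewrite -EFinD lee_fin; case: (eqVneq s 0) => [->|sn0].
      rewrite inE/= in_itv/= lexx/= => _; rewrite [X in _ + _ * X]indicE mem_set// mulr1.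
      rewrite /sigma_step big1 ?subr0 => [|k _]; last first.
        by rewrite ltNge mulr_ge0//= mulr0.
      rewrite (le_trans (_ : _ <= c))//; last by rewrite lerDr mulr_ge0.
      rewrite /c -real_normK ?num_real//.
      have : `|sig (X 0 w)| <= coef_bound.
        by rewrite /coef_bound (bigD1 (X 0 w))//= lerDl sumr_ge0.
      have := normr_ge0 (sig (X 0 w)); nra.
    rewrite inE/= in_itv/= => /andP[s0 sj].
    have key : `|sig (X s w) - sigma_step h j s w| <= 2 * coef_bound * g s + 0.
      apply: (@step_mismatch h j w s (fun s => sig (X s w)) (2 * coef_bound) 0) => //.
        by rewrite mulr_ge0.
      by move=> i i1 i2; rewrite addr0; exact: coef_diff_le.
    (* The blocks are disjoint, so at most one indicator is 1 and [g s] is its own square; the bound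
       stays linear in the mismatch time. *)
    have g1 : g s = 0 \/ g s = 1.
      have [i i1 i2] := grid_block (ltac:(by rewrite lt_neqAle eq_sym sn0) : 0 < s) sj.
      rewrite /g (bigD1 i)//= big1 ?addr0.
        by rewrite indicE; case: (_ \in _); [right|left].
      move=> k ki; rewrite indicE memNset// => -[/= k1 k2 _ _].
      have [ki'|ki'|/val_inj ki'] := ltngtP k i; last by rewrite ki' eqxx in ki.
        by move: i1; rewrite ltNge (le_trans k2)// ler_wpM2r// ler_nat.
      by move: k1; rewrite ltNge (le_trans i2)// ler_wpM2r// ler_nat.
    rewrite -real_normK ?num_real//.
    rewrite (@le_trans _ _ ((2 * coef_bound * g s) ^+ 2))//.
      by rewrite lerXn2r ?nnegrE ?mulr_ge0//; move: key; rewrite addr0.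
    rewrite exprMn exprMn -natrX -/c.
    have -> : g s ^+ 2 = g s by case: g1 => ->; rewrite ?expr0n ?expr1n.
    by rewrite lerDl mulr_ge0.
  - by move=> _; rewrite adde_ge0// lee_fin mulr_ge0.
rewrite ge0_integralD//.
- rewrite integral_mismatch_le//.
  under [X in (_ + X <= _)%E]eq_integral do rewrite EFinM.
  rewrite ge0_integralZl//; last by apply/measurable_EFinP; exact: measurable_indic.
  by rewrite integral_indic//= setIT lebesgue_measure_set1 mule0 adde0.
- by move=> s _; rewrite lee_fin mulr_ge0.
- apply/measurable_EFinP; apply: measurable_funM => //; apply: measurable_sum => k.
  by apply: (measurable_mismatch_section hX mG hG); rewrite mulr_ge0.
- by move=> s _; rewrite lee_fin mulr_ge0.
- by apply/measurable_EFinP; apply: measurable_funM => //; exact: measurable_indic.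
Qed.

End ItoGrid.

Section ItoGridError.
Context (disp : measure_display) (T : measurableType disp) (R : realType)
  (P : probability T R) (d : nat) (Q : 'M[R]_d)
  (X : R -> T -> 'I_d) (B : R -> {RV P >-> R}) (G : set T).
Hypothesis hX : is_markov_chain P Q X.
Hypothesis hB : is_brownian_motion B.
Hypothesis hXB : independent_chain_real X B.
Hypothesis mG : measurable G.
Hypothesis PG : P (~` G) = 0%E.
Hypothesis hG : forall w, G w -> forall t : R, 0 <= t ->
        \forall s \near t^'+, X s w = X t w.

Local Notation dB := (increment B).
Local Notation hist := (history X B).
Local Notation mu := (@lebesgue_measure R).
Variable sigma : 'cV[R]_d.
Local Notation sig i := (sigma i 0).

Lemma chain_fun_sum (f : 'I_d -> R) u :
  (fun w => f (X u w)) = (fun w => \sum_i f i * (X u w == i)%:R).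
Proof.
apply/funext => w; rewrite (bigD1 (X u w))//= eqxx mulr1 big1 ?addr0// => i.
by rewrite eq_sym => /negPf ->; rewrite mulr0.
Qed.

Lemma adapted_sum (F : set (set T)) (I : Type) (r : seq I) (f : I -> T -> R) :
  (forall i, adapted F (f i)) -> adapted F (fun w => \sum_(i <- r) f i w).
Proof.
move=> fi; elim: r => [|i r IH].
  by under eq_fun do rewrite big_nil; exact: adapted_cst.
by under eq_fun do rewrite big_cons; exact: adaptedD.
Qed.

Lemma adapted_chain_fun (f : 'I_d -> R) u s : 0 <= u -> u <= s ->
  adapted (hist s) (fun w => f (X u w)).
Proof.
move=> u0 us; rewrite chain_fun_sum; apply: adapted_sum => i.
apply: adaptedM; first exact: adapted_cst.
exact: adapted_chi.
Qed.

Lemma measurable_chain_fun (f : 'I_d -> R) u : 0 <= u ->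
  measurable_fun setT (fun w => f (X u w)).
Proof.
move=> u0; apply: adapted_measurable (adapted_chain_fun f u0 (lexx u)).
exact: (history_measurable hX).
Qed.

Lemma chain_fun_le (f : 'I_d -> R) u w : `|f (X u w)| <= \sum_i `|f i|.
Proof. by rewrite (bigD1 (X u w))//= lerDl sumr_ge0. Qed.

Definition ito_grid (h : R) (j : nat) (w : T) : R :=
  \sum_(k < j) sig (X (k%:R * h) w) * dB (k%:R * h) (k.+1%:R * h) w.

Lemma measurable_ito_grid h j : 0 <= h -> measurable_fun setT (ito_grid h j).
Proof.
move=> h0; apply: measurable_sum => k; apply: measurable_funM.
  by apply: (measurable_chain_fun (fun i => sig i)); rewrite mulr_ge0.
exact: measurable_increment.
Qed.

Lemma sqr_le_split (x y z : R) : (x - y) ^+ 2 <= 2 * (x - z) ^+ 2 + 2 * (z - y) ^+ 2.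
Proof. by have := sqr_ge0 ((x - z) - (z - y)); nra. Qed.

Lemma integral_sqr_split (disp' : measure_display) (T' : measurableType disp')
   (m : {measure set T' -> \bar R}) (D : set T') (f g k : T' -> R) : measurable D ->
   measurable_fun D f -> measurable_fun D g -> measurable_fun D k ->
   (\int[m]_(x in D) ((f x - g x) ^+ 2)%:E <=
     2%:E * \int[m]_(x in D) ((f x - k x) ^+ 2)%:E
     + 2%:E * \int[m]_(x in D) ((k x - g x) ^+ 2)%:E)%E.
Proof.
move=> mD mf mg mk.
have ms (a b : T' -> R) : measurable_fun D a -> measurable_fun D b ->
    measurable_fun D (fun x => ((a x - b x) ^+ 2)%:E).
  by move=> ma mb; apply/measurable_EFinP; apply: measurable_funX; exact: measurable_funB.
have pos (a b : T' -> R) x : D x -> (0 <= ((a x - b x) ^+ 2)%:E)%E.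
  by move=> _; rewrite lee_fin sqr_ge0.
rewrite -!ge0_integralZl//; try exact: ms; try exact: pos.
rewrite -ge0_integralD//.
- apply: ge0_le_integral => //.
  + exact: pos.
  + exact: ms.
  + by apply: emeasurable_funD; apply: emeasurable_funM => //; exact: ms.
  + by move=> x _; rewrite -!EFinM -EFinD lee_fin sqr_le_split.
- by move=> x _; rewrite -EFinM lee_fin mulr_ge0// sqr_ge0.
- by apply: emeasurable_funM => //; exact: ms.
- by move=> x _; rewrite -EFinM lee_fin mulr_ge0// sqr_ge0.
- by apply: emeasurable_funM => //; exact: ms.
Qed.

Lemma measurable_step_indic (D : set R) (u v : R) :
  measurable_fun D (fun s : R => ((u < s) && (s <= v))%:R : R).
Proof.
rewrite (_ : (fun s : R => ((u < s) && (s <= v))%:R) = \1_([set` `]u, v]])).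
  exact: measurable_indic.
by apply/funext => s; rewrite indicE mem_setE/= in_itv.
Qed.

Section OneApproximation.
Variables (h : R) (j : nat) (S : simple_process T R).
Hypotheses (h0 : 0 <= h) (h1 : h <= 1).
Hypothesis hS : simple_adapted (joint_filtration X B) S.
Local Notation tau := (j%:R * h).

(** The simple integral minus the grid sum is treated as a single family: the times of the simple
    process are truncated at the final time, and the grid coefficients enter with a minus sign. *)
Let I := ('I_(sp_size S) + 'I_j)%type.
Let c (i : I) : T -> R := match i with
  | inl k => sp_coef S k | inr k => fun w => - sig (X (k%:R * h) w) end.
Let a (i : I) : R := match i with
  | inl k => Num.min (sp_time S k) tau | inr k => k%:R * h end.
Let b (i : I) : R := match i with
  | inl k => Num.min (sp_time S k.+1) tau | inr k => k.+1%:R * h end.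

Let tau0 : 0 <= tau. Proof. by rewrite mulr_ge0. Qed.

Let time0 k : 0 <= sp_time S k.
Proof.
have [t0 tS _ _] := hS; elim: k => // k IH; exact: le_trans (tS k).
Qed.

Let a0 i : 0 <= a i.
Proof. by case: i => k /=; rewrite ?le_min ?time0 ?tau0// mulr_ge0. Qed.

Let ab i : a i <= b i.
Proof.
have [_ tS _ _] := hS; case: i => k /=; last by rewrite ler_wpM2r// ler_nat.
by rewrite le_min !ge_min lexx orbT andbT tS.
Qed.

Let bt i : b i <= tau.
Proof.
case: i => k /=; first by rewrite ge_min lexx orbT.
by rewrite ler_wpM2r// ler_nat.
Qed.

Lemma simple_coef_adapted k : adapted (hist (sp_time S k)) (sp_coef S k).
Proof. by have [_ _ _ aS] := hS; apply/adaptedP => U mU; exact: aS. Qed.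

Lemma measurable_simple_coef k : measurable_fun setT (sp_coef S k).
Proof.
apply: (adapted_measurable _ (@simple_coef_adapted k)); exact: (history_measurable hX).
Qed.

Let mc i : measurable_fun setT (c i).
Proof.
case: i => k /=; first exact: measurable_simple_coef.
apply: measurable_funN; apply: (measurable_chain_fun (fun i => sig i)).
by rewrite mulr_ge0.
Qed.

Let ac i : a i < b i -> adapted (hist (a i)) (c i).
Proof.
case: i => k /= lt.
  (* A truncated interval of positive length starts before the final time, so truncation has not
     moved its left end and the coefficient is adapted there. *)
  have E : Num.min (sp_time S k) tau = sp_time S k.
    rewrite min_l// leNgt; apply/negP => h2; move: lt.
    rewrite [X in X < _]min_r ?ltW// lt_min ltxx andbF//.
  by rewrite E; exact: simple_coef_adapted.
apply: (adapted_chain_fun (fun i => - sig i)) => //.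
by rewrite mulr_ge0.
Qed.

Lemma measurable_simple_integral t : measurable_fun setT (simple_integral S B t).
Proof.
apply: measurable_sum => k; apply: measurable_funM; first exact: measurable_simple_coef.
by apply: measurable_funB.
Qed.

(** After the isometry, the squared difference of the two step integrands is split through
    sigma(X_s): one part is the distance from [S] to the integrand, the other is bounded by the
    mismatch time. The constant 8 is 2 times the 4 of [energy_mismatch]. *)
Lemma simple_grid_isometry :
  (\int[P]_w ((simple_integral S B tau w - ito_grid h j w) ^+ 2)%:E
   <= 2%:E * (\int[P]_w \int[mu]_(s in `[0%R, (j%:R * h)%R])
           ((simple_value S s w - sig (X s w)) ^+ 2)%:E)
     + (8 * coef_bound sigma ^+ 2 * (leave_rate Q * tau * h))%:E)%E.
Proof.
have [_ _ bS _] := hS.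
have [C CP] := choice bS.
pose CC (i : I) : R := match i with inl k => C k | inr k => coef_bound sigma end.
have cC i w : `|c i w| <= CC i.
  by case: i => k /=; [exact: CP|rewrite normrN; exact: chain_fun_le (fun i => sig i) _ _].
have [iL iq eq] := elementary_isometry hX hB hXB a0 ab mc ac cC.
pose q := elementary_energy c a b.
have E1 w : simple_integral S B tau w - ito_grid h j w =
    \sum_i c i w * dB (a i) (b i) w.
  rewrite big_sumType/= /simple_integral /ito_grid; congr (_ + _).
  by rewrite -sumrN; apply: eq_bigr => k _; rewrite mulNr.
under eq_integral do rewrite E1.
rewrite -EFin_Rintegral// eq EFin_Rintegral//.
(* For times up to the horizon, truncating the partition times does not change which intervals
   contain them, so the energy is that of the original step integrands. *)
have E2 w : (q w)%:E = (\int[mu]_(s in `[0%R, tau])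
    ((simple_value S s w - sigma_step X sigma h j s w) ^+ 2)%:E)%E.
  rewrite /q /elementary_energy -(@step_square_integral R I (fun i => c i w) a b tau a0 bt).
  apply: eq_integral => s; rewrite inE/= in_itv/= => /andP[s0 st].
  congr (_ ^+ 2)%:E; rewrite big_sumType/= /simple_value /sigma_step; congr (_ + _).
    apply: eq_bigr => k _; congr (_ * (nat_of_bool _)%:R).
    by rewrite gt_min le_min st andbT [tau < s]ltNge st orbF.
  by rewrite -sumrN; apply: eq_bigr => k _; rewrite mulNr.
pose F w := (\int[mu]_(s in `[0%R, tau]) ((simple_value S s w - sig (X s w)) ^+ 2)%:E)%E.
have F0 w : (0 <= F w)%E by apply: integral_ge0 => s _; rewrite lee_fin sqr_ge0.
pose K w := fine (mismatch_total X G h j w).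
have KE w : (K w)%:E = mismatch_total X G h j w by rewrite fineK// mismatch_total_fin.
have K0 w : 0 <= K w by rewrite fine_ge0// mismatch_total_ge0.
pose D := 8 * coef_bound sigma ^+ 2.
have D0 : 0 <= D by rewrite mulr_ge0// sqr_ge0.
have qF w : G w -> ((q w)%:E <= 2%:E * F w + (D * K w)%:E)%E.
  move=> Gw; rewrite E2.
  apply: (@le_trans _ _ (2%:E * F w + 2%:E *
     (\int[mu]_(s in `[0%R, tau]) ((sig (X s w) - sigma_step X sigma h j s w) ^+ 2)%:E))%E).
    apply: integral_sqr_split => //.
    - apply: measurable_sum => k; apply: measurable_funM => //.
      exact: measurable_step_indic.
    - apply: measurable_sum => k; apply: measurable_funM => //.
      exact: measurable_step_indic.
    - by apply: (measurable_chain_path hX mG hG (fun i => sig i)).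
  apply: leeD => //.
  have -> : (D * K w)%:E = (2%:E * ((4 * coef_bound sigma ^+ 2)%:E * mismatch_total X G h j w))%E.
    by rewrite -KE -!EFinM; congr EFin; rewrite /D; ring.
  apply: lee_wpmul2l => //; exact: (energy_mismatch hX mG hG).
have mK : measurable_fun setT K.
  apply/measurable_EFinP; rewrite (_ : EFin \o K = mismatch_total X G h j).
    exact: (measurable_mismatch_total hX mG hG).
  by apply/funext => w; rewrite -KE.
have mq : measurable_fun setT q := Rintegrable_measurable iq.
(* The pathwise energy bound involves [F], not known to be measurable, so it cannot be integrated
   additively. The measurable function [f] lies between: it is at most 2 [F] everywhere, and [q] is
   at most [f + D * K] on [G]. *)
pose f w : R := Num.max 0 (q w - D * K w) * \1_G w.
have f0 w : 0 <= f w by rewrite mulr_ge0// le_max lexx.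
have mf : measurable_fun setT f.
  apply: measurable_funM; last exact: measurable_indic.
  apply: measurable_maxr => //; apply: measurable_funB => //.
  exact: measurable_funM.
have fF : (\int[P]_w (f w)%:E <= 2%:E * \int[P]_w F w)%E.
  have -> : (\int[P]_w (f w)%:E = 2%:E * \int[P]_w (2^-1 * f w)%:E)%E.
    rewrite -ge0_integralZl//.
    - by apply: eq_integral => w _; rewrite -EFinM mulrA divff ?mul1r.
    - by apply/measurable_EFinP; exact: measurable_funM.
    - by move=> w _; rewrite lee_fin mulr_ge0.
  apply: lee_wpmul2l => //; apply: ge0_integral_mono => w.
    by rewrite lee_fin mulr_ge0.
  rewrite /f indicE; case: (boolP (w \in G)) => [|_]; last by rewrite !mulr0.
  rewrite inE mulr1 => Gw; have := qF w Gw; have := F0 w.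
  case: (F w) => [r| |]; rewrite ?leey// -EFinM -EFinD !lee_fin => r0 qr.
  by case: (leP 0 (q w - D * K w)) => qDK; lra.
have q0 w : 0 <= q w.
  by rewrite -lee_fin E2; apply: integral_ge0 => s _; rewrite lee_fin sqr_ge0.
have DK0 w : 0 <= D * K w by rewrite mulr_ge0.
have mDK : measurable_fun setT (fun w => (D * K w)%:E).
  by apply/measurable_EFinP; exact: measurable_funM.
have mfE : measurable_fun setT (fun w => (f w)%:E) by exact/measurable_EFinP.
apply: (@le_trans _ _ (\int[P]_w ((f w)%:E + (D * K w)%:E))%E).
  apply: ae_ge0_le_integral => //.
  - by move=> w _; rewrite lee_fin q0.
  - exact/measurable_EFinP.
  - by move=> w _; rewrite -EFinD lee_fin addr_ge0.
  - exact: emeasurable_funD.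
  - exists (~` G); split => //; first exact: measurableC.
    move=> w; apply: contra_not => Gw _.
    rewrite -EFinD lee_fin /f indicE mem_set// mulr1 -/(q w).
    by case: (leP 0 (q w - D * K w)) => qDK; lra.
rewrite ge0_integralD//.
- apply: leeD => //.
  have -> : (\int[P]_w (D * K w)%:E = D%:E * \int[P]_w mismatch_total X G h j w)%E.
    rewrite -ge0_integralZl//.
    + by apply: eq_integral => w _; rewrite EFinM KE.
    + exact: (measurable_mismatch_total hX mG hG).
    + by move=> w _; exact: mismatch_total_ge0.
  have -> : (8 * coef_bound sigma ^+ 2 * (leave_rate Q * tau * h))%:E =
     (D%:E * (leave_rate Q * tau * h)%:E)%E by rewrite -EFinM.
  apply: lee_wpmul2l; first by rewrite lee_fin.
  exact: (mean_mismatch_total hX hXB mG hG).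
- by move=> w _; rewrite lee_fin.
- by move=> w _; rewrite lee_fin.
Qed.

End OneApproximation.

(** The grid is fixed while the simple processes approach the integrand. The triangle inequality
    doubles the 8 of the isometry bound, and the two approximation terms tend to 0. *)
Lemma ito_grid_error (h : R) (j : nat) (Y : T -> R) : 0 <= h -> h <= 1 ->
  measurable_fun setT Y ->
  is_ito_integral (joint_filtration X B) B (fun s w => sig (X s w)) (j%:R * h) Y ->
  (\int[P]_w ((Y w - ito_grid h j w) ^+ 2)%:E
    <= (16 * coef_bound sigma ^+ 2 * (leave_rate Q * (j%:R * h) * h))%:E)%E.
Proof.
move=> h0 h1 mY [S [hS cb ca]].
set tau := j%:R * h in ca cb *.
pose a_ n := (\int[P]_w ((Y w - simple_integral (S n) B tau w) ^+ 2)%:E)%E.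
pose b_ n := (\int[P]_w \int[mu]_(s in `[0%R, tau])
           ((simple_value (S n) s w - sig (X s w)) ^+ 2)%:E)%E.
set M := (16 * _ * _)%:E.
have ca' : a_ n @[n --> \oo] --> 0%E.
  apply: cvg_trans ca; apply: near_eq_cvg; near=> n.
  rewrite /a_ unlock; apply: eq_integral => w _.
  by rewrite -sqrrN opprB.
have lim : (2%:E * a_ n + (4%:E * b_ n + M))%E @[n --> \oo] --> M.
  rewrite -[X in _ --> X](_ : 2%:E * 0 + (4%:E * 0 + M) = M)%E; last first.
    by rewrite !mule0 !add0e.
  apply: cvgeD => //; first exact: cvgeZl.
  by apply: cvgeD => //; [exact: cvgeZl|exact: cvg_cst].
rewrite -(cvg_lim _ lim)//; apply: lime_ge; first exact: (cvgP _ lim).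
near=> n.
have mI := measurable_simple_integral (hS n) tau.
apply: (@le_trans _ _ (2%:E * a_ n + 2%:E * \int[P]_w
   ((simple_integral (S n) B tau w - ito_grid h j w) ^+ 2)%:E)%E).
  by apply: integral_sqr_split => //; exact: measurable_ito_grid.
apply: leeD => //.
have key (x : \bar R) (N : R) : (4%:E * x + (2 * N)%:E = 2%:E * (2%:E * x + N%:E))%E.
  rewrite muleDr ?fin_num_adde_defl// muleA -!EFinM.
  by congr (_%:E * _ + _)%E; ring.
have -> : M = (2 * (8 * coef_bound sigma ^+ 2 * (leave_rate Q * tau * h)))%:E.
  by rewrite /M; congr EFin; ring.
rewrite key.
apply: lee_wpmul2l => //.
exact: simple_grid_isometry.
Unshelve. all: end_near. Qed.
End ItoGridError.

(** * Pathwise convergence of the Euler scheme *)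

Section GeometricDecay.
Context (disp : measure_display) (T : measurableType disp) (R : realType)
  (P : probability T R).

(** The means are summable, so the series of the [F l] is almost surely finite, and each term is at
    most the corresponding tail. *)
Lemma ae_cvg0_geometric (F : nat -> T -> \bar R) (C : R) : 0 <= C ->
  (forall l, measurable_fun setT (F l)) -> (forall l w, (0 <= F l w)%E) ->
  (forall l, (\int[P]_w F l w <= (C * 2^-1 ^+ l)%:E)%E) ->
  {ae P, forall w, F ^~ w @ \oo --> 0%E}.
Proof.
move=> C0 mF F0 iF.
have sfin : (\int[P]_w (\sum_(l <oo) F l w) < +oo)%E.
  rewrite integral_nneseries//.
  apply: (@le_lt_trans _ _ (2 * C)%:E); last exact: ltry.
  apply: (@le_trans _ _ (\sum_(l <oo) (C * 2^-1 ^+ l)%:E)%E).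
    by apply: lee_nneseries => [l _ _|l _]; [apply: integral_ge0 => w _|exact: iF].
  apply: lime_le.
    by apply: is_cvg_nneseries => l _ _; rewrite lee_fin mulr_ge0// exprn_ge0.
  have E n : \sum_(0 <= i < n) (2^-1 : R) ^+ i = 2 - 2 * 2^-1 ^+ n.
    elim: n => [|n IH]; first by rewrite big_nil expr0 mulr1 subrr.
    by rewrite big_nat_recr//= IH exprS; field.
  near=> n; rewrite sumEFin lee_fin -mulr_sumr [leRHS]mulrC ler_wpM2l//.
  by rewrite E lerBlDr lerDl mulr_ge0// exprn_ge0.
have mS : measurable_fun setT (fun w => \sum_(l <oo) F l w)%E.
  exact: ge0_emeasurable_sum.
have S0 w : (0 <= \sum_(l <oo) F l w)%E by apply: nneseries_ge0.
have iS : P.-integrable setT (fun w => \sum_(l <oo) F l w)%E.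
  apply/integrableP; split => //.
  by under eq_integral do rewrite gee0_abs//.
have := integrable_ae measurableT iS.
apply: filterS => w /(_ Logic.I); rewrite ge0_fin_numE// => fin.
apply: (@squeeze_cvge _ _ _ _ (fun=> 0%E) _ (fun N => \sum_(N <= k <oo) F k w)%E).
- near=> N; rewrite F0/=.
  have := @nneseries_lim_ge R (F ^~ w) xpredT N N.+1 (fun n _ _ => F0 n w).
  by rewrite big_nat1.
- exact: cvg_cst.
- exact: nneseries_tail_cvg.
Unshelve. all: end_near. Qed.

End GeometricDecay.

(** The forcing enters through its sum and not through its maximum, because each error of the
    stochastic integral is controlled in mean only; sums commute with means, so no maximal
    inequality is called for. *)
Lemma gronwall_sum (R : realType) (x u : nat -> R) (b : R) n :
  0 <= b -> (forall i, 0 <= u i) -> (forall i, 0 <= x i) ->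
  (forall j, (j <= n)%N -> x j <= u j + b * \sum_(i < j) x i) ->
  x n <= u n + b * (expR (b * n%:R) * \sum_(i < n) u i).
Proof.
move=> b0 u0 x0 H; rewrite (le_trans (H n (leqnn n)))// lerD2l ler_wpM2l//.
suff S j : (j <= n)%N -> \sum_(i < j) x i <= expR (b * j%:R) * \sum_(i < j) u i by exact: S.
elim: j => [|j IH] jn; first by rewrite !big_ord0 mulr0.
rewrite !big_ord_recr/=.
have Hj := H j (ltnW jn); have IHj := IH (ltnW jn).
have U0 : 0 <= \sum_(i < j) u i by apply: sumr_ge0.
have e1 : 1 + b <= expR b := expR_ge1Dx b.
have -> : expR (b * j.+1%:R) = expR b * expR (b * j%:R).
  by rewrite -expRD -[j.+1]addn1 natrD mulrDr mulr1 addrC.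
have e2 : 1 <= expR (b * j%:R) by rewrite -[leLHS]expR0 ler_expR mulr_ge0.
move: Hj IHj e1 e2 U0 (u0 j).
move: (\sum_(i < j) x i) (\sum_(i < j) u i) (expR b) (expR _) (x j) (u j).
move=> S U eb ej xj uj Hj IHj e1 e2 U0 uj0.
have s1 : S + xj <= (1 + b) * S + uj by lra.
have s2 : (1 + b) * S <= (1 + b) * (ej * U) by rewrite ler_wpM2l// addr_ge0.
have s3 : (1 + b) * (ej * U) <= eb * (ej * U).
  by rewrite ler_wpM2r// mulr_ge0// (le_trans _ e2).
have s4 : uj <= eb * ej * uj.
  by rewrite ler_peMl// -[leLHS]mulr1 ler_pM//; lra.
by rewrite mulrDr -mulrA; lra.
Qed.

Section DriftQuadrature.
Context (disp : measure_display) (T : measurableType disp) (R : realType)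
  (P : probability T R) (d : nat) (Q : 'M[R]_d)
  (X : R -> T -> 'I_d) (B : R -> {RV P >-> R}) (G : set T).
Hypothesis hX : is_markov_chain P Q X.
Hypothesis mG : measurable G.
Hypothesis hG : forall w, G w -> forall t : R, 0 <= t ->
        \forall s \near t^'+, X s w = X t w.
Local Notation mu := (@lebesgue_measure R).

Lemma lebesgue_itv_oc (u v : R) : u <= v -> mu [set` `]u, v]] = (v - u)%:E.
Proof.
rewrite le_eqVlt => /predU1P[->|uv].
  by rewrite set_itvoc0 measure0 subrr.
by rewrite lebesgue_measure_itv/= lte_fin uv EFinB.
Qed.

Lemma bounded_integrable_itv (f : R -> R) (v C : R) :
  measurable_fun [set` `]0, v]] f -> (forall s, 0 < s -> s <= v -> `|f s| <= C) ->
  mu.-integrable [set` `]0, v]] (EFin \o f).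
Proof.
move=> mf fC; apply: measurable_bounded_integrable => //.
  have [v0|v0] := leP 0 v.
    by rewrite [X in (X < _)%E](lebesgue_itv_oc v0) ltry.
  by rewrite set_itv_ge ?measure0// bnd_simp -leNgt ltW.
exists C; split; first exact: num_real.
move=> x Cx s /=; rewrite in_itv/= => /andP[s0 sv].
by rewrite (le_trans (fC s s0 sv))// ltW.
Qed.

Lemma integral_grid_step (h : R) j (c : nat -> R) : 0 <= h ->
  \int[mu]_(s in [set` `]0, j%:R * h]])
    (\sum_(k < j) c k * ((k%:R * h < s) && (s <= k.+1%:R * h))%:R) =
  h * \sum_(k < j) c k.
Proof.
move=> h0.
have blk (k : 'I_j) : [set` `]k%:R * h, k.+1%:R * h]] `<=` [set` `]0, j%:R * h]].
  move=> s /=; rewrite !in_itv/= => /andP[s1 s2].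
  rewrite (le_lt_trans _ s1) ?mulr_ge0//= (le_trans s2)// ler_wpM2r// ler_nat.
  by [].
pose I (k : 'I_j) := [set` `]k%:R * h, k.+1%:R * h]] : set R.
have E (s : R) : (\sum_(k < j) c k * ((k%:R * h < s) && (s <= k.+1%:R * h))%:R)%:E =
   (\sum_(k < j) ((c k)%:E * (\1_(I k) s)%:E))%E.
  rewrite -sumEFin; apply: eq_bigr => k _; rewrite -EFinM indicE mem_setE/= in_itv//.
rewrite /Rintegral; under eq_integral do rewrite E.
have i1 (k : 'I_j) : mu.-integrable [set` `]0, j%:R * h]] (EFin \o \1_(I k)).
  by apply: integrableS (integrable_indic_itv _ _ _ _).
rewrite integral_sum//; last by move=> k; apply: integrableZl => //; exact: i1.
have -> : (\sum_(k < j) \int[mu]_(s in [set` `]0%R, (j%:R * h)%R]]) ((c k)%:E * (\1_(I k) s)%:E))%E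
   = (\sum_(k < j) (h * c k)%:E)%E.
  apply: eq_bigr => k _; rewrite integralZl//; last exact: i1.
  rewrite integral_indic//; last exact: measurable_itv.
  rewrite setIidl; last exact: blk.
  rewrite [X in (_ * X)%E]lebesgue_itv_oc; last by rewrite ler_wpM2r// ler_nat.
  rewrite -EFinM mulrC; congr (_ * _)%:E.
  by rewrite -[k.+1]addn1 natrD mulrDl mul1r addrAC subrr add0r.
by rewrite sumEFin/= mulr_sumr.
Qed.

(** The left-point rule pays [D] during the mismatch time of the chain and [e] per unit of time for
    the variation that remains. *)
Lemma drift_quadrature (h : R) j w (f : R -> R) (D e C : R) : 0 <= h -> G w ->
  0 <= D -> 0 <= e ->
  measurable_fun [set` `[0, j%:R * h]] f ->
  (forall s, 0 <= s -> s <= j%:R * h -> `|f s| <= C) ->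
  (forall s (i : 'I_j), i%:R * h < s -> s <= i.+1%:R * h ->
     `|f s - f (i%:R * h)| <= D * (X s w != X (i%:R * h) w)%:R + e) ->
  `|\int[mu]_(s in [set` `[0, j%:R * h]]) f s - h * \sum_(k < j) f (k%:R * h)|
    <= D * fine (mismatch_total X G h j w) + e * (j%:R * h).
Proof.
move=> h0 Gw D0 e0 mf fC fD.
set tau := j%:R * h in mf fC *; have tau0 : 0 <= tau by rewrite mulr_ge0.
pose st s := \sum_(k < j) f (k%:R * h) * ((k%:R * h < s) && (s <= k.+1%:R * h))%:R.
have mf' : measurable_fun [set` `]0, tau]] f.
  apply: measurable_funS mf => // s /=; rewrite !in_itv/= => /andP[s0 ->].
  by rewrite ltW.
have mst D' : measurable_fun D' st.
  by apply: measurable_sum => k; apply: measurable_funM => //; exact: measurable_step_indic.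
have if_ : mu.-integrable [set` `]0, tau]] (EFin \o f).
  by apply: (bounded_integrable_itv (C := C)) => // s s0 sv; apply: fC => //; exact: ltW.
have ist : mu.-integrable [set` `]0, tau]] (EFin \o st).
  apply: (bounded_integrable_itv (C := \sum_(k < j) `|f (k%:R * h)|)) => // s _ _.
  rewrite /st (le_trans (ler_norm_sum _ _ _))//; apply: ler_sum => k _.
  by rewrite normrM ler_piMr//; case: (_ && _); rewrite ?normr1 ?normr0.
(* The point 0, which belongs to no block, is dropped from the domain of integration. *)
rewrite -(@Rintegral_itv_obnd_cbnd _ 0 (BRight tau))//.
rewrite -(integral_grid_step j (fun k => f (k%:R * h)) h0) -/tau -RintegralB//.
have ifs : mu.-integrable [set` `]0, tau]] (EFin \o (fun s => f s - st s)).
  rewrite (_ : EFin \o _ = (fun s => (EFin \o f) s - (EFin \o st) s)%E).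
    exact: integrableB.
  by apply/funext => s; rewrite /= EFinB.
rewrite (le_trans (le_normr_Rintegral _ ifs))//.
rewrite -lee_fin.
have -> : (D * fine (mismatch_total X G h j w) + e * tau)%:E =
   (D%:E * mismatch_total X G h j w + (e * tau)%:E)%E.
  by rewrite EFinD EFinM fineK// mismatch_total_fin.
rewrite /Rintegral fineK; last first.
  apply: integrable_fin_num => //.
  exact: (integrable_abse ifs).
pose g (s : R) : R := \sum_(k < j) \1_(mismatch X G (k%:R * h) (k.+1%:R * h)) (s, w).
have g0 s : 0 <= g s by apply: sumr_ge0.
rewrite integral_mkcond.
apply: (@le_trans _ _ (\int[mu]_s ((D * g s)%:E + (e * \1_([set` `]0, tau]]) s)%:E))%E).
  apply: ge0_integral_mono => s; rewrite patchE; case: ifPn => //.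
  - rewrite inE/= in_itv/= => /andP[s0 st'].
    rewrite -EFinD lee_fin indicE mem_set/=; last by rewrite in_itv/= s0.
    rewrite mulr1; apply: (step_mismatch h0 Gw D0 e0 (ltW s0) st') => //.
    + by move=> i; exact: fD.
    + by rewrite gt_eqF.
  - by move=> _; rewrite adde_ge0// lee_fin mulr_ge0.
rewrite ge0_integralD//.
- rewrite (integral_mismatch_le hX mG hG)// leeD2l//.
  under eq_integral do rewrite EFinM.
  rewrite ge0_integralZl//; last by apply/measurable_EFinP; exact: measurable_indic.
  by rewrite integral_indic//= setIT [X in (_ * X)%E]lebesgue_itv_oc// subr0.
- by move=> s _; rewrite lee_fin mulr_ge0.
- apply/measurable_EFinP; apply: measurable_funM => //; apply: measurable_sum => k.
  by apply: (measurable_mismatch_section hX mG hG); rewrite mulr_ge0.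
- by move=> s _; rewrite lee_fin mulr_ge0.
- by apply/measurable_EFinP; apply: measurable_funM => //; exact: measurable_indic.
Qed.

End DriftQuadrature.

Section HalfLineContinuity.
Context (R : realType) (m : R -> R).
Hypothesis cm : {within `[0, +oo[, continuous m}.

Lemma within_continuous_at (x e : R) : 0 <= x -> 0 < e ->
  exists2 r : R, 0 < r & forall s, 0 <= s -> `|x - s| < r -> `|m x - m s| <= e.
Proof.
move=> x0 e0; move/subspace_continuousP : cm => /(_ x).
rewrite /= in_itv/= x0 => /(_ isT) /cvgrPdist_le /(_ e e0).
rewrite near_withinE => -[r /= r0 H].
by exists r => // s s0 xs; apply: H => //=; rewrite in_itv/= s0.
Qed.

(** Compactness in its near-covering form: nearby base points and small radii are treated jointly,
    so one radius works on all of [[0, t]]. The other point may lie beyond [t]. *)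
Lemma heine_half_line (t e : R) : 0 < e ->
  exists2 dl : R, 0 < dl & forall s s', 0 <= s -> s <= t -> 0 <= s' ->
    `|s - s'| <= dl -> `|m s - m s'| <= e.
Proof.
move=> e0.
have /compact_near_coveringP := @segment_compact R 0 t.
pose Pr (dl x : R) := forall s', 0 <= s' -> `|x - s'| <= dl -> 0 <= x -> `|m x - m s'| <= e.
move=> /(_ R (0 : R)^'+ Pr _)[].
  move=> x; rewrite /= in_itv/= => /andP[x0 xt].
  have e20 : 0 < e / 2 by rewrite divr_gt0.
  have [r r0 H] := within_continuous_at x0 e20.
  have r20 : 0 < r / 2 by rewrite divr_gt0.
  near=> y dl => s' s'0 ys' y0.
  have xy : `|x - y| < r / 2 by near: y; exact: cvgr_dist_lt.
  have dlr : dl < r / 2 by near: dl; exact: nbhs_right_lt.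
  have h1 : `|m x - m y| <= e / 2 by apply: H => //; lra.
  have h2 : `|m x - m s'| <= e / 2.
    apply: H => //; rewrite (le_lt_trans (ler_distD y _ _))//.
    by rewrite (splitr r) ltrD// (le_lt_trans ys').
  by rewrite (le_trans (ler_distD (m x) _ _))// (splitr e) lerD// distrC.
move=> dl0 /= dl00 H; exists (dl0 / 2); first by rewrite divr_gt0.
move=> s s' s0 st s'0 ss'.
apply: (H (dl0 / 2)) => //=; rewrite ?divr_gt0// ?in_itv/= ?s0//.
by rewrite sub0r normrN gtr0_norm ?divr_gt0// ltr_pdivrMr// ltr_pMr// ltr1n.
Unshelve. all: end_near. Qed.

Lemma bounded_half_line (t : R) :
  exists C : R, forall s, 0 <= s -> s <= t -> `|m s| <= C.
Proof.
have cK : compact (m @` [set` `[0, t]]).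
  apply: continuous_compact; last exact: segment_compact.
  apply: continuous_subspaceW cm.
  by move=> s /=; rewrite !in_itv/= => /andP[->].
have [C [_ H]] := compact_bounded cK.
exists (C + 1) => s s0 st; apply: H; first by rewrite ltrDl.
by exists s => //=; rewrite in_itv/= s0 st.
Qed.

Lemma measurable_half_line (t : R) : measurable_fun [set` `[0, t]] m.
Proof.
apply: subspace_continuous_measurable_fun => //.
apply: continuous_subspaceW cm.
by move=> s /=; rewrite !in_itv/= => /andP[->].
Qed.

End HalfLineContinuity.

(** * The Euler scheme compared with one path *)

Section EulerScheme.
Context (disp : measure_display) (T : measurableType disp) (R : realType)
  (P : probability T R) (d : nat) (Q : 'M[R]_d)
  (X : R -> T -> 'I_d) (B : R -> {RV P >-> R}) (G : set T).
Hypothesis hX : is_markov_chain P Q X.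
Hypothesis mG : measurable G.
Hypothesis hG : forall w, G w -> forall t : R, 0 <= t ->
        \forall s \near t^'+, X s w = X t w.
Local Notation mu := (@lebesgue_measure R).
Local Notation dB := (increment B).
Variables (alpha gamma sigma : 'cV[R]_d) (m0 : R).
Local Notation al i := (alpha i 0).
Local Notation ga i := (gamma i 0).
Local Notation sig i := (sigma i 0).

Fixpoint euler (h : R) (j : nat) (w : T) : R :=
  match j with
  | 0%N => m0
  | k.+1 => euler h k w + h * (al (X (k%:R * h) w) - ga (X (k%:R * h) w) * euler h k w)
      + sig (X (k%:R * h) w) * dB (k%:R * h) (k.+1%:R * h) w
  end.

Lemma euler_sum h j w : euler h j w =
  m0 + h * \sum_(k < j) (al (X (k%:R * h) w) - ga (X (k%:R * h) w) * euler h k w)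
   + ito_grid X B sigma h j w.
Proof.
elim: j => [|j IH]; first by rewrite /ito_grid !big_ord0 mulr0 !addr0.
by rewrite /ito_grid !big_ord_recr/= -/(ito_grid _ _ _ h j w) {1}IH; ring.
Qed.

(** A deterministic statement about one path. [N] is the error of the stochastic integral at the
    grid times, while [Mx] and [e] may depend on the path; no moment of the process enters. *)
Lemma euler_path_error (h t : R) n w (m : R -> R) (N : nat -> R) (Mx e : R) :
  0 <= h -> n%:R * h = t -> G w -> {within `[0, +oo[, continuous m} ->
  (forall j, (j <= n)%N -> m (j%:R * h) = m0 +
     \int[mu]_(s in [set` `[0, j%:R * h]]) (al (X s w) - ga (X s w) * m s)
     + (ito_grid X B sigma h j w + N j)) ->
  (forall s, 0 <= s -> s <= t -> `|m s| <= Mx) -> 0 <= e ->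
  (forall s s', 0 <= s -> s <= t -> 0 <= s' -> `|s - s'| <= h -> `|m s - m s'| <= e) ->
  let C := 2 * coef_bound alpha + 2 * coef_bound gamma * Mx in
  let ep := C * fine (mismatch_total X G h n w) + coef_bound gamma * e * t in
  `|m t - euler h n w| <= (`|N n| + ep) + coef_bound gamma * h *
     (expR (coef_bound gamma * t) * \sum_(i < n) (`|N i| + ep)).
Proof.
move=> h0 nht Gw cm eqm mM e0 mosc /=.
set C := 2 * coef_bound alpha + _; set ep := C * _ + _.
have sa0 := coef_bound_ge0 alpha; have sg0 := coef_bound_ge0 gamma.
have t0 : 0 <= t by rewrite -nht mulr_ge0.
have M0 : 0 <= Mx by apply: le_trans (mM 0 (lexx _) t0).
have C0 : 0 <= C by rewrite addr_ge0// !mulr_ge0.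
have K0 j : 0 <= fine (mismatch_total X G h j w) by rewrite fine_ge0// mismatch_total_ge0.
have ep0 : 0 <= ep by rewrite addr_ge0 ?mulr_ge0.
pose D j := `|m (j%:R * h) - euler h j w|.
have gle (i : 'I_d) : `|ga i| <= coef_bound gamma.
  by rewrite /coef_bound (bigD1 i)//= lerDl sumr_ge0.
have ale (i : 'I_d) : `|al i| <= coef_bound alpha.
  by rewrite /coef_bound (bigD1 i)//= lerDl sumr_ge0.
have -> : `|m t - euler h n w| = D n by rewrite /D nht.
have -> : coef_bound gamma * t = coef_bound gamma * h * n%:R by rewrite -nht; ring.
apply: (@gronwall_sum R D (fun i => `|N i| + ep)).
- by rewrite mulr_ge0.
- by move=> i; rewrite addr_ge0.
- by move=> i; rewrite /D.
move=> j jn; rewrite /D eqm// euler_sum.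
have jt : j%:R * h <= t by rewrite -nht ler_wpM2r// ler_nat.
pose f s := al (X s w) - ga (X s w) * m s.
have mf : measurable_fun [set` `[0, j%:R * h]] f.
  apply: measurable_funB; first exact: (measurable_chain_path hX mG hG (fun i => al i)).
  apply: measurable_funM; first exact: (measurable_chain_path hX mG hG (fun i => ga i)).
  exact: measurable_half_line.
have fb s : 0 <= s -> s <= j%:R * h -> `|f s| <= coef_bound alpha + coef_bound gamma * Mx.
  move=> s0 sj; rewrite (le_trans (ler_normB _ _))// lerD// normrM ler_pM//.
  by apply: mM => //; exact: le_trans jt.
have fD s (i : 'I_j) : i%:R * h < s -> s <= i.+1%:R * h ->
    `|f s - f (i%:R * h)| <= C * (X s w != X (i%:R * h) w)%:R + coef_bound gamma * e.
  move=> i1 i2; have ih0 : 0 <= i%:R * h by rewrite mulr_ge0.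
  have st : s <= t.
    by rewrite (le_trans i2)// (le_trans _ jt)// ler_wpM2r// ler_nat.
  have s0 : 0 <= s by rewrite (le_trans ih0)// ltW.
  have sh : `|s - i%:R * h| <= h.
    rewrite ger0_norm; last by rewrite subr_ge0 ltW.
    rewrite lerBlDr (le_trans i2)//.
    by rewrite -[i.+1]addn1 natrD mulrDl mul1r addrC.
  (* The first two differences vanish unless the state has changed and give [C]; the last one is the
     oscillation of [m] within a block. *)
  have -> : f s - f (i%:R * h) = (al (X s w) - al (X (i%:R * h) w))
     + ((ga (X (i%:R * h) w) - ga (X s w)) * m s
     + ga (X (i%:R * h) w) * (m (i%:R * h) - m s)) by rewrite /f; ring.
  rewrite (le_trans (ler_normD _ _))// /C [X in _ <= X + _]mulrDl -[leRHS]addrA lerD ?coef_diff_le//.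
  rewrite (le_trans (ler_normD _ _))// lerD//.
    rewrite normrM mulrAC; apply: ler_pM => //; last exact: mM.
    by rewrite eq_sym; exact: coef_diff_le.
  rewrite normrM ler_pM// distrC; exact: mosc.
have := drift_quadrature hX mG hG h0 Gw C0 (mulr_ge0 sg0 e0) mf fb fD.
rewrite -/f; set E := \int[mu]_(s in _) f s - _ => hE.
have hE' : `|E| <= ep.
  rewrite (le_trans hE)// /ep lerD//.
    rewrite ler_wpM2l// fine_le ?mismatch_total_fin//.
    rewrite /mismatch_total -(subnKC jn) big_split_ord/= leeDl//.
    by apply: sume_ge0 => i _; exact: mismatch_time_ge0.
  by rewrite ler_wpM2l// mulr_ge0.
(* The grid noise cancels. There remain the forcing [N j + E] and a term linear in the previous
   errors, which Gronwall's inequality absorbs. *)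
have -> : m0 + \int[mu]_(s in [set` `[0, j%:R * h]]) f s + (ito_grid X B sigma h j w + N j) -
   (m0 + h * \sum_(k < j) (al (X (k%:R * h) w) - ga (X (k%:R * h) w) * euler h k w)
   + ito_grid X B sigma h j w)
   = N j + E + h * (\sum_(k < j) - ga (X (k%:R * h) w) * (m (k%:R * h) - euler h k w)).
  rewrite /E.
  have -> : \sum_(k < j) - ga (X (k%:R * h) w) * (m (k%:R * h) - euler h k w)
    = \sum_(k < j) f (k%:R * h) -
     \sum_(k < j) (al (X (k%:R * h) w) - ga (X (k%:R * h) w) * euler h k w).
    by rewrite -sumrB; apply: eq_bigr => k _; rewrite /f; ring.
  by ring.
rewrite (le_trans (ler_normD _ _))// lerD//.
  by rewrite (le_trans (ler_normD _ _))// lerD2l.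
rewrite normrM (ger0_norm h0) [coef_bound gamma * h]mulrC -mulrA ler_wpM2l//.
rewrite (le_trans (ler_norm_sum _ _ _))// mulr_sumr; apply: ler_sum => k _.
by rewrite normrM normrN ler_wpM2r.
Qed.

End EulerScheme.

Section EulerConvergence.
Context (disp : measure_display) (T : measurableType disp) (R : realType)
  (P : probability T R) (d : nat) (Q : 'M[R]_d)
  (X : R -> T -> 'I_d) (B M : R -> {RV P >-> R}).
Variables (alpha gamma sigma : 'cV[R]_d) (m0 : R).
Hypothesis hX : is_markov_chain P Q X.
Hypothesis hB : is_brownian_motion B.
Hypothesis hXB : independent_chain_real X B.
Local Notation mu := (@lebesgue_measure R).
Local Notation al i := (alpha i 0).
Local Notation ga i := (gamma i 0).
Local Notation eul := (euler X B alpha gamma sigma m0).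

Lemma right_continuity_set : exists G : set T,
  [/\ measurable G, P (~` G) = 0%E & forall w, G w -> forall t : R, 0 <= t ->
        \forall s \near t^'+, X s w = X t w].
Proof.
have [_ [N [mN N0 hN]] _] := hX.
exists (~` N); split; [exact: measurableC|by rewrite setCK|].
by move=> w Nw; apply: contrapT => h; apply: Nw; apply: hN.
Qed.

(** This weight turns a mean square of order h into a mean absolute value of order sqrt h, in place
    of the Cauchy-Schwarz inequality. *)
Lemma abs_le_sqrt_sqr (x h : R) : 0 < h -> `|x| <= Num.sqrt h + (Num.sqrt h)^-1 * x ^+ 2.
Proof.
move=> h0; have s0 : 0 < Num.sqrt h by rewrite sqrtr_gt0.
rewrite -real_normK ?num_real//; have := normr_ge0 x; move: `|x| => y y0.
move: (Num.sqrt h) s0 => s s0.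
rewrite -(ler_pM2r s0).
have -> : (s + s^-1 * y ^+ 2) * s = s ^+ 2 + y ^+ 2 by field; rewrite gt_eqF.
by have := sqr_ge0 (y - s); nra.
Qed.

Section FixedTime.
Variables (t : R) (l0 : nat) (G : set T) (I : R -> {RV P >-> R}).
Hypotheses (t0 : 0 < t) (tl0 : t <= 4 ^+ l0).
Hypothesis mG : measurable G.
Hypothesis PG : P (~` G) = 0%E.
Hypothesis hG : forall w, G w -> forall t : R, 0 <= t ->
        \forall s \near t^'+, X s w = X t w.
Hypothesis hI : forall t : R, 0 <= t ->
       is_ito_integral (joint_filtration X B) B
         (fun s w => sigma (X s w) 0) t (I t).

(* Powers of 4 give [sqrt (mesh l) <= 2^-l], so that the mean errors are summable. *)
Definition steps (l : nat) : nat := 4 ^ (l0 + l).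
Definition mesh (l : nat) : R := t / (steps l)%:R.

Lemma steps_gt0 l : (0 : R) < (steps l)%:R.
Proof. by rewrite ltr0n expn_gt0. Qed.

Lemma mesh_gt0 l : 0 < mesh l.
Proof. by rewrite divr_gt0// steps_gt0. Qed.

Lemma steps_mesh l : (steps l)%:R * mesh l = t.
Proof. by rewrite mulrC divfK// gt_eqF// steps_gt0. Qed.

Lemma mesh_le l : mesh l <= (2^-1 ^+ l) ^+ 2.
Proof.
rewrite /mesh ler_pdivrMr ?steps_gt0// /steps natrX exprD.
rewrite (le_trans tl0)// mulrCA ler_peMr ?exprn_ge0//.
rewrite -exprM mulnC exprM -exprMn.
have -> : (2^-1 : R) ^+ 2 * 4 = 1 by field.
by rewrite expr1n.
Qed.

Lemma mesh_le1 l : mesh l <= 1.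
Proof.
by rewrite (le_trans (mesh_le l))// !exprn_ile1// ?exprn_ge0// invf_le1// ler1n.
Qed.

Lemma sqrt_mesh_le l : Num.sqrt (mesh l) <= 2^-1 ^+ l.
Proof.
rewrite -[leRHS]ger0_norm ?exprn_ge0// -sqrtr_sqr ler_wsqrtr//; exact: mesh_le.
Qed.

Lemma mesh_le_sqrt l : mesh l <= Num.sqrt (mesh l).
Proof.
rewrite -[leLHS]sqr_sqrtr; last exact/ltW/mesh_gt0.
rewrite expr2 ler_piMl//.
by rewrite -[leRHS]sqrtr1 ler_wsqrtr// mesh_le1.
Qed.

Definition ito_defect l j w := I (j%:R * mesh l) w - ito_grid X B sigma (mesh l) j w.

Definition ito_const : R := 16 * coef_bound sigma ^+ 2 * leave_rate Q.

Lemma ito_const_ge0 : 0 <= ito_const.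
Proof. by rewrite mulr_ge0 ?leave_rate_ge0// mulr_ge0// sqr_ge0. Qed.

Lemma measurable_ito_defect l j : measurable_fun setT (ito_defect l j).
Proof.
apply: measurable_funB => //.
exact: (measurable_ito_grid B hX sigma j (ltW (mesh_gt0 l))).
Qed.

Lemma mean_abs_ito_defect l j : (j <= steps l)%N ->
  (\int[P]_w `|ito_defect l j w|%:E <= ((1 + ito_const * t) * Num.sqrt (mesh l))%:E)%E.
Proof.
move=> jn; have h0 := mesh_gt0 l; set h := mesh l in h0 *.
have s0 : 0 < Num.sqrt h by rewrite sqrtr_gt0.
have jh : j%:R * h <= t by rewrite -(steps_mesh l) ler_wpM2r ?ler_nat// ltW.
have jh0 : 0 <= j%:R * h by rewrite mulr_ge0// ltW.
have e := ito_grid_error hX hB hXB mG PG hG (ltW h0) (mesh_le1 l)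
   (measurable_funP (I (j%:R * h))) (hI jh0).
have m2 : measurable_fun setT (fun w => (ito_defect l j w ^+ 2)%:E).
  by apply/measurable_EFinP; apply: measurable_funX; exact: measurable_ito_defect.
apply: (@le_trans _ _ (\int[P]_w ((Num.sqrt h)%:E + (Num.sqrt h)^-1%:E * (ito_defect l j w ^+ 2)%:E))%E).
  apply: ge0_integral_mono => w; first by rewrite lee_fin.
  by rewrite -EFinM -EFinD lee_fin abs_le_sqrt_sqr.
rewrite ge0_integralD//; last first.
- by apply: emeasurable_funM.
- by move=> w _; rewrite -EFinM lee_fin mulr_ge0 ?sqr_ge0// invr_ge0 ltW.
rewrite integral_cst// [X in (_ * X + _)%E]probability_setT mule1.
have si0 : (0 <= (Num.sqrt h)^-1%:E)%E by rewrite lee_fin invr_ge0 ltW.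
have sq0 w : setT w -> (0 <= (ito_defect l j w ^+ 2)%:E)%E by move=> _; rewrite lee_fin sqr_ge0.
rewrite ge0_integralZl//.
rewrite mulrDl mul1r EFinD leeD2l//.
apply: (@le_trans _ _ ((Num.sqrt h)^-1%:E * (ito_const * t * h)%:E)%E).
  apply: lee_wpmul2l; first by rewrite lee_fin invr_ge0 ltW.
  apply: (le_trans e); rewrite lee_fin.
  have -> : 16 * coef_bound sigma ^+ 2 * (leave_rate Q * (j%:R * mesh l) * mesh l) =
     ito_const * (j%:R * h) * h by rewrite /ito_const /h; ring.
  by apply: ler_wpM2r; [exact: ltW|rewrite ler_wpM2l ?ito_const_ge0].
rewrite -EFinM lee_fin -{2}(sqr_sqrtr (ltW h0)).
by apply: eq_ler; field; rewrite gt_eqF.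
Qed.

(** These are the mesh-dependent random quantities in the bound of [euler_path_error]. The factors
    that depend on the path of [M] are left out, so that the mean can be estimated. *)
Definition euler_defect l (w : T) : \bar R :=
  (mismatch_total X G (mesh l) (steps l) w +
   (`|ito_defect l (steps l) w|%:E
     + (mesh l)%:E * \sum_(i < steps l) `|ito_defect l i w|%:E))%E.

Lemma euler_defect_ge0 l w : (0 <= euler_defect l w)%E.
Proof.
rewrite adde_ge0 ?mismatch_total_ge0// adde_ge0// mule_ge0//.
  by rewrite lee_fin ltW// mesh_gt0.
by apply: sume_ge0.
Qed.

Lemma measurable_euler_defect l : measurable_fun setT (euler_defect l).
Proof.
have m1 j : measurable_fun setT (fun w => `|ito_defect l j w|%:E).
  apply/measurable_EFinP; apply: measurableT_comp => //.
  exact: measurable_ito_defect.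
apply: emeasurable_funD.
  by apply: (measurable_mismatch_total hX mG hG); exact/ltW/mesh_gt0.
apply: emeasurable_funD => //; apply: emeasurable_funM => //.
by apply: emeasurable_sum.
Qed.

Definition defect_const : R :=
  leave_rate Q * t + (1 + ito_const * t) * (1 + t).

Lemma defect_const_ge0 : 0 <= defect_const.
Proof.
have l0' := leave_rate_ge0 Q; have i0 := ito_const_ge0; have t0' := ltW t0.
by rewrite /defect_const; nonneg.
Qed.

Lemma mean_euler_defect l :
  (\int[P]_w euler_defect l w <= (defect_const * 2^-1 ^+ l)%:E)%E.
Proof.
have h0 := mesh_gt0 l; have hs := mesh_le_sqrt l.
have m1 j : measurable_fun setT (fun w => `|ito_defect l j w|%:E).
  apply/measurable_EFinP; apply: measurableT_comp => //.
  exact: measurable_ito_defect.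
have K0 : 0 <= (1 + ito_const * t) * Num.sqrt (mesh l).
  by rewrite mulr_ge0// addr_ge0// mulr_ge0 ?ito_const_ge0// ltW.
have mS : measurable_fun setT (fun w => \sum_(i < steps l) `|ito_defect l i w|%:E)%E.
  exact: emeasurable_sum.
have S0 w : (0 <= \sum_(i < steps l) `|ito_defect l i w|%:E)%E by apply: sume_ge0.
have hE0 : (0 <= (mesh l)%:E)%E by rewrite lee_fin ltW.
have mhS : measurable_fun setT (fun w => (mesh l)%:E * \sum_(i < steps l) `|ito_defect l i w|%:E)%E.
  exact: emeasurable_funM.
rewrite ge0_integralD//; last 4 first.
- by move=> w _; exact: mismatch_total_ge0.
- by apply: (measurable_mismatch_total hX mG hG); exact: ltW.
- by move=> w _; rewrite adde_ge0// mule_ge0.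
- exact: emeasurable_funD.
rewrite ge0_integralD//; last by move=> w _; rewrite mule_ge0.
have sumE : (\int[P]_w (\sum_(i < steps l) `|ito_defect l i w|%:E) =
    \sum_(i < steps l) \int[P]_w `|ito_defect l i w|%:E)%E.
  by rewrite ge0_integral_sum.
rewrite ge0_integralZl// sumE.
have e1 := mean_mismatch_total hX hXB mG hG (steps l) (ltW h0) (mesh_le1 l).
rewrite steps_mesh in e1.
have e2 := mean_abs_ito_defect (leqnn (steps l)).
have e3 : (\sum_(i < steps l) \int[P]_w `|ito_defect l i w|%:E <=
   ((steps l)%:R * ((1 + ito_const * t) * Num.sqrt (mesh l)))%:E)%E.
  rewrite -[X in (_ <= X%:E)%E]/(_ * _)%R mulr_natl -[X in (_ *+ X)]card_ord -sumr_const -sumEFin.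
  apply: lee_sum => i _; apply: mean_abs_ito_defect; exact: ltnW.
apply: (@le_trans _ _ ((leave_rate Q * t * mesh l)%:E +
  (((1 + ito_const * t) * Num.sqrt (mesh l))%:E +
   (mesh l)%:E * ((steps l)%:R * ((1 + ito_const * t) * Num.sqrt (mesh l)))%:E))%E).
  by apply: leeD => //; apply: leeD => //; exact: lee_wpmul2l.
rewrite -!EFinM -!EFinD lee_fin.
rewrite (@le_trans _ _ (defect_const * Num.sqrt (mesh l)))//.
  have -> : mesh l * ((steps l)%:R * ((1 + ito_const * t) * Num.sqrt (mesh l))) =
     t * ((1 + ito_const * t) * Num.sqrt (mesh l)).
    by rewrite mulrA [mesh l * _]mulrC steps_mesh.
  have : leave_rate Q * t * mesh l <= leave_rate Q * t * Num.sqrt (mesh l).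
    by rewrite ler_wpM2l// mulr_ge0 ?leave_rate_ge0// ltW.
  by rewrite /defect_const; nra.
by rewrite ler_wpM2l ?sqrt_mesh_le ?defect_const_ge0.
Qed.

Hypothesis cM : {ae P, forall w, {within `[0, +oo[, continuous (fun s : R => M s w)}}.
Hypothesis eM : forall s : R, 0 <= s -> {ae P, forall w,
         M s w = m0
           + \int[mu]_(r in `[0, s]) (al (X r w) - ga (X r w) * M r w) + I s w}.

Lemma ae_euler_cvg :
  {ae P, forall w, eul (mesh l) (steps l) w @[l --> \oo] --> M t w}.
Proof.
have aeG : {ae P, forall w, G w}.
  by exists (~` G); split => //; exact: measurableC.
have ae0 : {ae P, forall w, euler_defect ^~ w @ \oo --> 0%E}.
  apply: (@ae_cvg0_geometric _ _ _ P euler_defect defect_const).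
  - exact: defect_const_ge0.
  - exact: measurable_euler_defect.
  - exact: euler_defect_ge0.
  - exact: mean_euler_defect.
(* The equation of [M] holds almost surely at each time; the grid times of all meshes are countably
   many, so one null set serves them all. *)
have aeE : {ae P, forall w, forall l j, M (j%:R * mesh l) w = m0
   + \int[mu]_(r in `[0, j%:R * mesh l]) (al (X r w) - ga (X r w) * M r w)
   + I (j%:R * mesh l) w}.
  apply/ae_foralln => l; apply/ae_foralln => j; apply: eM.
  by rewrite mulr_ge0// ltW// mesh_gt0.
apply: filterS2 (filterI aeG ae0) (filterI aeE cM) => w [Gw F0] [Ew cw].
apply/cvgrPdist_le => eta eta0.
have t0' := ltW t0.
pose g := coef_bound gamma; have g0 : 0 <= g by exact: coef_bound_ge0.
pose kap := g * expR (g * t); have k0 : 0 <= kap by rewrite mulr_ge0 ?expR_ge0.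
have [Mx hMx] := bounded_half_line cw t.
have M0 : 0 <= Mx by apply: le_trans (hMx 0 (lexx _) t0').
pose C := 2 * coef_bound alpha + 2 * g * Mx.
have C0 : 0 <= C by have := coef_bound_ge0 alpha => a0; rewrite /C; nonneg.
(* In the bound of [euler_path_error], [C2] is the total factor of the three defects and [A] that of
   the oscillation. The thresholds [r] and [e] below give each group at most half of [eta]; [A + 1]
   avoids dividing by a possibly zero [A]. *)
pose C2 := 1 + kap + C * (1 + kap * t).
have C20 : 0 < C2.
  by rewrite /C2 -addrA ltr_pwDl// addr_ge0// mulr_ge0// addr_ge0// mulr_ge0.
pose A := g * t * (1 + kap * t).
have A0 : 0 <= A by rewrite /A; nonneg.
pose e := eta / (2 * (A + 1)).
have A1 : 0 < A + 1 by rewrite ltr_wpDl.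
have e0 : 0 < e by rewrite divr_gt0// mulr_gt0.
have [dl dl0 osc] := heine_half_line cw t e0.
pose r := eta / (2 * C2); have r0 : 0 < r by rewrite divr_gt0// mulr_gt0.
move/fine_cvgP : F0 => [Ffin /cvgrPdist_le /(_ r r0) Fr].
have q1 : `|2^-1 : R| < 1 by rewrite ger0_norm// invf_lt1// ltr1n.
have /cvgrPdist_le /(_ dl dl0) Hq := cvg_expr q1.
near=> l.
have hl : mesh l <= dl.
  rewrite (le_trans (mesh_le l))//.
  have : `|0 - 2^-1 ^+ l| <= dl by near: l; exact: Hq.
  rewrite sub0r normrN ger0_norm ?exprn_ge0//; apply: le_trans.
  by rewrite expr2 ler_piMl ?exprn_ge0// exprn_ile1// invf_le1// ler1n.
have fl : euler_defect l w \is a fin_num by near: l.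
have : `|0 - fine (euler_defect l w)| <= r by near: l; exact: Fr.
have h0 := mesh_gt0 l; have h0' := ltW h0.
pose K := fine (mismatch_total X G (mesh l) (steps l) w).
pose S := \sum_(i < steps l) `|ito_defect l i w|.
have S0 : 0 <= S by apply: sumr_ge0.
have K0 : 0 <= K by rewrite fine_ge0// mismatch_total_ge0.
have -> : euler_defect l w = (K + (`|ito_defect l (steps l) w| + mesh l * S))%:E.
  rewrite /euler_defect !EFinD EFinM fineK; last exact: mismatch_total_fin.
  by rewrite /S sumEFin.
rewrite /= sub0r normrN ger0_norm => [Kr|]; last first.
  by rewrite addr_ge0// addr_ge0// mulr_ge0.
have N0 : 0 <= `|ito_defect l (steps l) w| by [].
have hS0 : 0 <= mesh l * S by rewrite mulr_ge0.
have key := @euler_path_error _ _ _ _ _ _ _ B G hX mG hG alpha gamma sigma m0 (mesh l) t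
  (steps l) w (fun s => M s w) (fun j => ito_defect l j w) Mx e h0' (steps_mesh l) Gw cw.
have := key _ hMx (ltW e0); rewrite -/g -/C -/K => {}key.
apply: (le_trans (key _ _)).
- by move=> j jn; rewrite Ew /ito_defect [_ + (I _ w - _)]addrC subrK.
- by move=> s s' s1 s2 s3 ss'; apply: osc => //; exact: le_trans hl.
rewrite big_split/= -/S sumr_const card_ord -[_ *+ steps l]mulr_natl.
set ep := C * K + g * e * t.
have -> : g * mesh l * (expR (g * t) * (S + (steps l)%:R * ep)) =
   kap * (mesh l * S) + kap * ((steps l)%:R * mesh l) * ep by rewrite /kap; ring.
rewrite steps_mesh.
have c1 : K <= r by clear -Kr N0 hS0; move: Kr; lra.
have c2 : `|ito_defect l (steps l) w| <= r by clear -Kr K0 hS0; move: Kr; lra.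
have c3 : mesh l * S <= r by clear -Kr K0 N0; move: Kr; lra.
have kt0 : 0 <= 1 + kap * t by nonneg.
have s1 : kap * (mesh l * S) <= kap * r by rewrite ler_wpM2l.
have s2 : C * K * (1 + kap * t) <= C * r * (1 + kap * t) by rewrite ler_wpM2r// ler_wpM2l.
have s3 : r * C2 = eta / 2 by rewrite /r; field; rewrite gt_eqF.
have s4 : e * A <= eta / 2.
  have -> : e * A = eta / 2 * (A / (A + 1)) by rewrite /e; field; rewrite gt_eqF.
  apply: ler_piMr; first by rewrite divr_ge0// ltW.
  by rewrite ler_pdivrMr// mul1r lerDl.
have -> : `|ito_defect l (steps l) w| + ep + (kap * (mesh l * S) + kap * t * ep)
  = `|ito_defect l (steps l) w| + kap * (mesh l * S) + C * K * (1 + kap * t) + e * A.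
  by rewrite /ep /A; ring.
rewrite [eta]splitr; apply: lerD => //; rewrite -s3.
have -> : r * C2 = r + kap * r + C * r * (1 + kap * t) by rewrite /C2; ring.
by apply: lerD => //; apply: lerD.
Unshelve. all: end_near. Qed.

End FixedTime.
End EulerConvergence.

(** * Moments of the Euler scheme *)

Section Expansion.
Context (R : realType).
Implicit Types (f g : R -> R) (a b c : R).

(* With [s] the square root of the step, [f] is [a + b h + O(h^(3/2))]. *)
Definition expands f a b := exists C : R, forall s, 0 <= s -> s <= 1 ->
  `|f s - (a + b * s ^+ 2)| <= C * s ^+ 3.

Lemma expands_eq f g a b a' b' :
  expands f a b -> (forall s, 0 <= s -> f s = g s) -> a = a' -> b = b' -> expands g a' b'.
Proof. by move=> [C h] fg <- <-; exists C => s s0 s1; rewrite -fg// h. Qed.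

Lemma expands_cst c : expands (fun=> c) c 0.
Proof. by exists 0 => s _ _; rewrite !mul0r addr0 subrr normr0. Qed.

Lemma expands_sqr : expands (fun s => s ^+ 2) 0 1.
Proof. by exists 0 => s _ _; rewrite mul1r add0r subrr normr0 mul0r. Qed.

Lemma expandsD f g a b a' b' : expands f a b -> expands g a' b' ->
  expands (fun s => f s + g s) (a + a') (b + b').
Proof.
move=> [C fC] [D gD]; exists (C + D) => s s0 s1.
have -> : f s + g s - (a + a' + (b + b') * s ^+ 2) =
  (f s - (a + b * s ^+ 2)) + (g s - (a' + b' * s ^+ 2)) by ring.
by rewrite (le_trans (ler_normD _ _))// mulrDl lerD ?fC ?gD.
Qed.

Lemma expands_bounded f a b : expands f a b ->
  exists2 C, 0 <= C & forall s, 0 <= s -> s <= 1 -> `|f s| <= C.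
Proof.
move=> [C fC]; exists (`|C| + (`|a| + `|b|)) => [|s s0 s1]; first by rewrite !addr_ge0.
rewrite -[f s](subrK (a + b * s ^+ 2)) (le_trans (ler_normD _ _))// lerD//.
  by rewrite (le_trans (fC s s0 s1))// (le_trans (ler_norm _))// normrM ler_piMr//
    ger0_norm ?exprn_ge0// exprn_ile1.
rewrite (le_trans (ler_normD _ _))// lerD2l normrM ler_piMr// ger0_norm ?exprn_ge0//.
by rewrite exprn_ile1.
Qed.

Lemma expandsM f g a b a' b' : expands f a b -> expands g a' b' ->
  expands (fun s => f s * g s) (a * a') (a * b' + b * a').
Proof.
move=> ef eg; have [G G0 gG] := expands_bounded eg.
case: ef eg => [C fC] [D gD].
exists (C * G + (`|a| + `|b|) * D + `|b * b'|) => s s0 s1.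
have s2 : 0 <= s ^+ 2 <= 1 by rewrite exprn_ge0 ?exprn_ile1.
case/andP: s2 => s2 s21.
have -> : f s * g s - (a * a' + (a * b' + b * a') * s ^+ 2) =
   (f s - (a + b * s ^+ 2)) * g s + (a + b * s ^+ 2) * (g s - (a' + b' * s ^+ 2))
    + b * b' * (s * s ^+ 3) by ring.
rewrite (le_trans (ler_normD _ _))// [leRHS]mulrDl lerD//; last first.
  by rewrite normrM ler_wpM2l// ger0_norm ?mulr_ge0 ?exprn_ge0// ler_piMl ?exprn_ge0.
rewrite (le_trans (ler_normD _ _))// [leRHS]mulrDl lerD//.
  rewrite normrM mulrAC ler_pM ?gG//; exact: fC.
rewrite normrM -mulrA ler_pM ?gD// (le_trans (ler_normD _ _))// lerD2l normrM.
by rewrite ler_piMr// ger0_norm.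
Qed.

Lemma expands_sum (I : Type) (r : seq I) (f : I -> R -> R) (a b : I -> R) :
  (forall i, expands (f i) (a i) (b i)) ->
  expands (fun s => \sum_(i <- r) f i s) (\sum_(i <- r) a i) (\sum_(i <- r) b i).
Proof.
move=> h; elim: r => [|i r IH].
  apply: (expands_eq (expands_cst 0)) => [s _||]; by rewrite big_nil.
by apply: (expands_eq (expandsD (h i) IH)) => [s _||]; rewrite big_cons.
Qed.

Lemma expandsZ c f a b : expands f a b -> expands (fun s => c * f s) (c * a) (c * b).
Proof.
move=> h; apply: (expands_eq (expandsM (expands_cst c) h)) => //.
by rewrite mul0r addr0.
Qed.

Definition pexpands (p : R -> {poly R}) (a b : {poly R}) :=
  forall i, expands (fun s => (p s)`_i) a`_i b`_i.

Lemma pexpandsM (p q : R -> {poly R}) (a b a' b' : {poly R}) :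
  pexpands p a b -> pexpands q a' b' ->
  pexpands (fun s => p s * q s) (a * a') (a * b' + b * a').
Proof.
move=> hp hq i.
apply: (expands_eq (expands_sum (index_enum 'I_i.+1)
   (fun j : 'I_i.+1 => expandsM (hp j) (hq (i - j)%N)))) => [s _||].
- by rewrite coefM.
- by rewrite coefM.
- by rewrite coefD !coefM -big_split.
Qed.

Lemma pexpandsX k (p : R -> {poly R}) (a b : {poly R}) :
  pexpands p a b -> pexpands (fun s => p s ^+ k) (a ^+ k) ((a ^+ k.-1 * b) *+ k).
Proof.
move=> h; elim: k => [|k IH] i.
  by apply: (expands_eq (expands_cst (1 : {poly R})`_i)) => //; rewrite ?expr0// mulr0n coef0.
apply: (expands_eq (pexpandsM h IH i)) => [s _||]; rewrite ?exprS//.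
congr (nth _ (polyseq _) _); case: k {IH} => [|k] /=; first by rewrite !mulr0n mulr0 expr0 mulr1 mul1r add0r.
by rewrite exprS [RHS]mulrS; ring.
Qed.

Lemma pexpandsZ (c : R -> R) a b (p : R -> {poly R}) (u v : {poly R}) :
  expands c a b -> pexpands p u v ->
  pexpands (fun s => c s *: p s) (a *: u) (a *: v + b *: u).
Proof.
move=> hc hp i; apply: (expands_eq (expandsM hc (hp i))) => [s _||];
  by rewrite ?coefD !coefZ.
Qed.

Lemma pexpands_sum (I : Type) (r : seq I) (p : I -> R -> {poly R}) (a b : I -> {poly R}) :
  (forall i, pexpands (p i) (a i) (b i)) ->
  pexpands (fun s => \sum_(i <- r) p i s) (\sum_(i <- r) a i) (\sum_(i <- r) b i).
Proof.
move=> h k; apply: (expands_eq (expands_sum r (fun i => h i k))) => [s _||];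
  by rewrite coef_sum.
Qed.

Lemma expands_expmx (d : nat) (Q : 'M[R]_d) i j :
  expands (fun s => expmx (s ^+ 2 *: Q) i j) (i == j)%:R (Q i j).
Proof.
exists (mxnorm1 Q ^+ 2 * expR (mxnorm1 Q)) => s s0 s1.
have h0 : 0 <= s ^+ 2 by rewrite exprn_ge0.
have h1 : s ^+ 2 <= 1 by rewrite exprn_ile1.
have := expmx_step Q i j (lexx 0) h0.
rewrite expmx0 add0r mulmx1 [1%:M i j]mxE => e.
have -> : expmx (s ^+ 2 *: Q) i j - ((i == j)%:R + Q i j * s ^+ 2) =
  expmx (s ^+ 2 *: Q) i j - (i == j)%:R - s ^+ 2 * Q i j by ring.
apply: (le_trans e); rewrite exprMn -[leLHS]mulrA -[leRHS]mulrA; apply: ler_wpM2l; first exact: sqr_ge0.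
rewrite mulrC; apply: ler_pM; rewrite ?expR_ge0 ?sqr_ge0//.
  by rewrite ler_expR ler_piMr// mxnorm1_ge0.
by rewrite -exprM (@ler_wiXn2l _ _ _ _ 4%N 3%N).
Qed.

End Expansion.

Section EulerPolynomial.
Context (R : realType) (al ga sig : R) (m : nat -> R -> R).
Hypothesis hm : forall q, expands (m q) (q == 0%N)%:R (q == 2%N)%:R.

Definition drift_poly (h : R) : {poly R} := (1 - h * ga) *: 'X + (h * al)%:P.

Lemma size_drift_poly h : (size (drift_poly h) <= 2)%N.
Proof.
rewrite (leq_trans (size_polyD _ _))// geq_max (leq_trans (size_scale_leq _ _)) ?size_polyX//.
by rewrite (leq_trans (size_polyC_leq1 _)).
Qed.

Lemma size_drift_polyX h r : (size (drift_poly h ^+ r) <= r.+1)%N.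
Proof.
elim: r => [|r IH]; first by rewrite expr0 size_poly1.
rewrite exprS (leq_trans (size_polyMleq _ _))//.
by move: (leq_add (size_drift_poly h) IH); case: (_ + _)%N.
Qed.

Lemma pexpands_drift_poly : pexpands (fun s => drift_poly (s ^+ 2)) 'X (al%:P - ga *: 'X).
Proof.
move=> i; exists 0 => s _ _.
rewrite /drift_poly mul0r -[leRHS](@normr0 R R); apply: eq_ler; congr `|_|.
by rewrite !coefD coefN !coefZ !coefX !coefC; case: eqP => _; case: eqP => _ /=; ring.
Qed.

(** The mean of the [k]-th power of a drift step plus [sig] times a variable with moments [m q s],
    expanded by the binomial formula as a polynomial in the present value. *)
Definition euler_poly (k : nat) (s : R) : {poly R} :=
  \sum_(q < k.+1) (('C(k, q))%:R * sig ^+ q * m q s) *: drift_poly (s ^+ 2) ^+ (k - q).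

(** The coefficient of x^p in L x^k, where L = (al - ga x) d/dx + (sig^2 / 2) d^2/dx^2 is the
    generator in a frozen state. *)
Definition generator_coef (k p : nat) : R :=
  (p == k)%:R * (- (k%:R * ga)) + (p.+1 == k)%:R * (k%:R * al) +
  (p.+2 == k)%:R * (2^-1 * k%:R * (k%:R - 1) * sig ^+ 2).

Lemma size_euler_poly k s : (size (euler_poly k s) <= k.+1)%N.
Proof.
rewrite /euler_poly (leq_trans (size_sum _ _ _))//; apply/bigmax_leqP => q _.
rewrite (leq_trans (size_scale_leq _ _))// (leq_trans (size_drift_polyX _ _))//.
by rewrite ltnS leq_subr.
Qed.

(** At first order only q = 0 contributes, through the derivative of the power of the drift step,
    and q = 2, through the variance. *)
Lemma expands_euler_poly k p :
  expands (fun s => (euler_poly k s)`_p) (p == k)%:R (generator_coef k p).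
Proof.
pose c (q : 'I_k.+1) : R := ('C(k, q))%:R * sig ^+ q.
have hq (q : 'I_k.+1) := pexpandsZ (expandsZ (c q) (hm q))
   (pexpandsX (k - q)%N pexpands_drift_poly).
apply: (expands_eq (pexpands_sum (index_enum _) hq p)) => //.
  rewrite big_ord_recl/= /c/= subn0 bin0 expr0 !mulr1 scale1r big1 ?addr0 ?coefXn// => q _.
  by rewrite mulr0 scale0r.
rewrite big_split/= coefD.
have -> : \sum_(q < k.+1) (c q * (nat_of_ord q == 0%N)%:R) *:
    ('X^((k - q).-1) * (al%:P - ga *: 'X) *+ (k - q)) = 'X^(k.-1) * (al%:P - ga *: 'X) *+ k.
  rewrite big_ord_recl/= /c/= subn0 bin0 expr0 !mulr1 scale1r big1 ?addr0// => q _.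
  by rewrite mulr0 scale0r.
rewrite /c.
(* For k < 2 there is no term q = 2, while [k - 2] truncates to 0; hence the factor [(1 < k)]. *)
have -> : \sum_(q < k.+1) (('C(k, q))%:R * sig ^+ q * (nat_of_ord q == 2%N)%:R) *: 'X^(k - q) =
   ((2^-1 * k%:R * (k%:R - 1) * sig ^+ 2) *: 'X^(k - 2)) *+ (1 < k)%N :> {poly R}.
  have [k2|k2] := ltnP 1 k.
    have k3 : (2 < k.+1)%N by [].
    rewrite (bigD1 (Ordinal k3))//= mulr1 big1 ?addr0; last first.
      by move=> q; rewrite -val_eqE/= => /negPf ->; rewrite mulr0 scale0r.
    rewrite mulr1n; congr (_ * _ *: _).
    case: k k2 {k3 c hq} => // k _.
    have -> : k.+1%:R - 1 = k%:R :> R by rewrite -natr1 addrK.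
    have : (k.+1 * k = 'C(k.+1, 2) * 2)%N.
      by have /= := mul_bin_diag k.+1 1; rewrite bin1 mulnC => ->; rewrite mulnC.
    move=> /(congr1 (fun x => x%:R : R)); rewrite !natrM -mulrA => ->.
    by rewrite mulrCA mulVf ?mulr1// pnatr_eq0.
  rewrite mulr0n big1// => q _; case: eqP => [q2|_]; rewrite ?mulr0 ?scale0r//.
  by have := ltn_ord q; rewrite q2 ltnS => /leq_trans/(_ k2).
rewrite /generator_coef coefMn mulrBr -[_ * (ga *: _)]scalerAr -exprSr coefB coefZ coefXn coefMC coefXn.
case: k {c hq} => [|k].
  by rewrite mulr0n !mul0r ?mulr0 oppr0 mulr0 !coefMn mulr0n; ring.
rewrite /= -[_ *+ k.+1]mulr_natl coefMn coefZ coefXn.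
case: k => [|k]; first by rewrite /= subrr; ring.
by rewrite subn2 mulr1n; ring.
Qed.

End EulerPolynomial.

Section EulerMoments.
Context (disp : measure_display) (T : measurableType disp) (R : realType)
  (P : probability T R) (d : nat) (Q : 'M[R]_d)
  (X : R -> T -> 'I_d) (B : R -> {RV P >-> R}).
Variables (alpha gamma sigma : 'cV[R]_d) (m0 : R).
Hypothesis hX : is_markov_chain P Q X.
Hypothesis hB : is_brownian_motion B.
Hypothesis hXB : independent_chain_real X B.
Local Notation dB := (increment B).
Local Notation hist := (history X B).
Local Notation Rintegrable := (Rintegrable P).
Local Notation al i := (alpha i 0).
Local Notation ga i := (gamma i 0).
Local Notation sig i := (sigma i 0).
Local Notation eul := (euler X B alpha gamma sigma m0).

(** The argument is the square root of the time step, as in [expands]. Increments starting at 0 are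
    enough by stationarity, see [increment_moment_shift]. *)
Definition increment_moment_fun (q : nat) (s : R) : R := \int[P]_w (dB 0 (s ^+ 2) w ^+ q).
Local Notation dmom := increment_moment_fun.

Lemma increment_moment_shift u v q : 0 <= u -> u <= v ->
  \int[P]_w (dB u v w ^+ q) = dmom q (Num.sqrt (v - u)).
Proof.
move=> u0 uv; rewrite /dmom sqr_sqrtr ?subr_ge0//.
move: uv; rewrite le_eqVlt => /predU1P[->|uv].
  by rewrite subrr; apply: eq_Rintegral => w _; rewrite /increment !subrr.
have vu : 0 < v - u by rewrite subr_gt0.
by rewrite (increment_moment hB q u0 uv) (increment_moment hB q (lexx 0) vu) subr0.
Qed.

Lemma expands_increment_moment q : expands (dmom q) (q == 0%N)%:R (q == 2%N)%:R.
Proof.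
have s2 s : 0 <= s ^+ 2 :> R by exact: sqr_ge0.
case: q => [|[|[|q]]].
- apply: (expands_eq (expands_cst (1 : R))) => // s _.
  by rewrite /dmom; under eq_Rintegral do rewrite expr0; rewrite mean_cst.
- apply: (expands_eq (expands_cst (0 : R))) => // s _.
  by rewrite /dmom; under eq_Rintegral do rewrite expr1; rewrite (increment_mean hB).
- apply: (expands_eq (expands_sqr R)) => // s _.
  by rewrite /dmom (increment_variance hB)// subr0.
exists (gauss_const R q.+3) => s s0 s1; rewrite !mul0r addr0 subr0.
rewrite (le_trans (increment_moment_le hB q.+3 (lexx 0) (s2 s)))// subr0 sqrtr_sqr ger0_norm//.
rewrite ler_wpM2l ?gauss_const_ge0//; exact: ler_wiXn2l.
Qed.

Section Step.
Variables (s : R) (s0 : 0 <= s).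
Local Notation h := (s ^+ 2).
Local Notation tm j := (j%:R * h).

Let tm0 j : 0 <= tm j. Proof. by rewrite mulr_ge0 ?sqr_ge0. Qed.
Let tmS j : tm j <= tm j.+1. Proof. by rewrite ler_wpM2r ?sqr_ge0// ler_nat. Qed.
Let tmB j : tm j.+1 - tm j = h.
Proof. by rewrite -mulrBl -natrB// subSnn mul1r. Qed.

Lemma adapted_euler j : adapted (hist (tm j)) (eul h j).
Proof.
elim: j => [|j IH] /=; first exact: adapted_cst.
have {}IH : adapted (hist (tm j.+1)) (eul h j) by apply: adapted_sub IH; exact: le_history.
have aX (f : 'I_d -> R) : adapted (hist (tm j.+1)) (fun w => f (X (tm j) w)).
  exact: adapted_chain_fun.
apply: adaptedD; last first.
  apply: adaptedM; first exact: (aX (fun i => sig i)).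
  by apply: adaptedB; apply: adapted_brownian.
apply: adaptedD => //; apply: adaptedM; first exact: adapted_cst.
apply: adaptedB; first exact: (aX (fun i => al i)).
by apply: adaptedM => //; exact: (aX (fun i => ga i)).
Qed.

Lemma adapted_horner (F : set (set T)) (p : {poly R}) (Y : T -> R) :
  adapted F Y -> adapted F (fun w => p.[Y w]).
Proof.
move=> aY; under eq_fun do rewrite horner_coef.
by apply: adapted_sum => i; apply: adaptedM; [exact: adapted_cst|exact: adaptedX].
Qed.

Lemma Rintegrable_horner (p : {poly R}) (Y : T -> R) :
  (forall k, Rintegrable (fun w => Y w ^+ k)) -> Rintegrable (fun w => p.[Y w]).
Proof.
move=> iY; under eq_fun do rewrite horner_coef.
by apply: Rintegrable_sum => i; exact: RintegrableZ.
Qed.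

Local Notation Yp j l r := (fun w => (drift_poly (al l) (ga l) h ^+ r).[eul h j w]).

(** Splitting over the present state turns the random coefficients into constants; the binomial
    formula then isolates the powers of the increment. *)
Lemma euler_powS j k w : eul h j.+1 w ^+ k =
  \sum_l \sum_(q < k.+1) ('C(k, q)%:R * sig l ^+ q) *
     (Yp j l (k - q)%N w * (X (tm j) w == l)%:R * dB (tm j) (tm j.+1) w ^+ q).
Proof.
rewrite (bigD1 (X (tm j) w))//= [X in _ = _ + X]big1 ?addr0; last first.
  move=> l; rewrite eq_sym => /negPf ->.
  by rewrite big1// => q _; rewrite mulr0 mul0r mulr0.
set l := X (tm j) w.
have -> : eul h j w + h * (al l - ga l * eul h j w) =
   (drift_poly (al l) (ga l) h).[eul h j w].
  by rewrite /drift_poly hornerD hornerZ hornerX hornerC; ring.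
rewrite exprDn; apply: eq_bigr => q _.
rewrite eqxx mulr1 horner_exp exprMn -mulr_natl; ring.
Qed.

Lemma euler_term_integrable j l r q : (forall k, Rintegrable (fun w => eul h j w ^+ k)) ->
  Rintegrable (fun w => Yp j l r w * (X (tm j) w == l)%:R * dB (tm j) (tm j.+1) w ^+ q).
Proof.
move=> iY.
have aC := adapted_sub (@history_chain_history _ _ _ _ _ X B (tm j)) (@adapted_euler j).
have [||i1 _] := mean_mul_increment hX hB hXB q (tm0 j) (tmS j)
   (Y := fun w => Yp j l r w * (X (tm j) w == l)%:R); last exact: i1.
- by apply: adaptedM; [exact: adapted_horner|exact: adapted_chi_chain].
- by apply: (RintegrableM_chi hX) => //; exact: Rintegrable_horner.
Qed.

Lemma euler_moment_integrable j k : Rintegrable (fun w => eul h j w ^+ k).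
Proof.
elim: j k => [|j IH] k; first exact: (Rintegrable_cst P (m0 ^+ k)).
under eq_fun do rewrite euler_powS.
apply: Rintegrable_sum => l; apply: Rintegrable_sum => q; apply: RintegrableZ.
exact: euler_term_integrable.
Qed.

Definition euler_moment j k : 'cV[R]_d :=
  \col_i \int[P]_w (eul h j w ^+ k * (X (tm j) w == i)%:R).

(** The increment is integrated first: it is independent of [chain_history], which already contains
    the chain at the next grid time. The Markov property then handles the two indicators. Since
    [euler_poly] has degree at most [k], the moments up to order [n] close among themselves. *)
Lemma mean_euler_step n j k i : (k <= n)%N ->
  euler_moment j.+1 k i 0 = \sum_l \sum_(p < n.+1)
    expmx (h *: Q) l i * (euler_poly (al l) (ga l) (sig l) dmom k s)`_p * euler_moment j p l 0.
Proof.
move=> kn; rewrite mxE.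
have iE := euler_moment_integrable j.
have aE := @adapted_euler j.
have aC := adapted_sub (@history_chain_history _ _ _ _ _ X B (tm j)) aE.
have aY l r : adapted (hist (tm j)) (fun w => Yp j l r w) by exact: adapted_horner.
have iY l r : Rintegrable (fun w => Yp j l r w) by exact: Rintegrable_horner.
have term l r q : Rintegrable (fun w => Yp j l r w * (X (tm j) w == l)%:R *
     (X (tm j.+1) w == i)%:R * dB (tm j) (tm j.+1) w ^+ q) /\
   \int[P]_w (Yp j l r w * (X (tm j) w == l)%:R *
     (X (tm j.+1) w == i)%:R * dB (tm j) (tm j.+1) w ^+ q) =
   expmx (h *: Q) l i * \int[P]_w (Yp j l r w * (X (tm j) w == l)%:R) * dmom q s.
  have [||i1 ->] := mean_mul_increment hX hB hXB q (tm0 j) (tmS j)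
   (Y := fun w => Yp j l r w * (X (tm j) w == l)%:R * (X (tm j.+1) w == i)%:R).
  - apply: adaptedM; last exact: adapted_chi_chain.
    by apply: adaptedM; [exact: adapted_horner|exact: adapted_chi_chain].
  - by apply: (RintegrableM_chi hX) => //; exact: (RintegrableM_chi hX).
  split => //.
  rewrite (mean_markov hX hXB l i (tm0 j) (tmS j) (aY l r) (iY l r)).
  by rewrite increment_moment_shift// tmB sqrtr_sqr ger0_norm.
transitivity (\int[P]_w (\sum_l \sum_(q < k.+1) ('C(k, q)%:R * sig l ^+ q) *
    (Yp j l (k - q)%N w * (X (tm j) w == l)%:R *
     (X (tm j.+1) w == i)%:R * dB (tm j) (tm j.+1) w ^+ q))).
  apply: eq_Rintegral => w _; rewrite euler_powS mulr_suml; apply: eq_bigr => l _.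
  by rewrite mulr_suml; apply: eq_bigr => q _; ring.
rewrite mean_sum => [|l]; last first.
  by apply: Rintegrable_sum => q; apply: RintegrableZ; case: (term l (k - q)%N q).
apply: eq_bigr => l _.
rewrite mean_sum => [|q]; last by apply: RintegrableZ; case: (term l (k - q)%N q).
transitivity (expmx (h *: Q) l i *
  \int[P]_w ((euler_poly (al l) (ga l) (sig l) dmom k s).[eul h j w] * (X (tm j) w == l)%:R)).
  transitivity (expmx (h *: Q) l i * \int[P]_w (\sum_(q < k.+1)
     ('C(k, q)%:R * sig l ^+ q * dmom q s) * (Yp j l (k - q)%N w * (X (tm j) w == l)%:R))).
    rewrite mean_sum => [|q]; last by apply/RintegrableZ/(RintegrableM_chi hX).
    rewrite mulr_sumr; apply: eq_bigr => q _.
    rewrite meanZ; last by case: (term l (k - q)%N q).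
    rewrite meanZ; last exact: (RintegrableM_chi hX).
    by case: (term l (k - q)%N q) => _ ->; ring.
  congr (_ * _); apply: eq_Rintegral => w _.
  rewrite /euler_poly horner_sum mulr_suml; apply: eq_bigr => q _.
  by rewrite hornerZ mulrA.
under eq_Rintegral do rewrite (horner_coef_wide _ (leq_trans (size_euler_poly _ _ _ _ _ _) (kn : (k.+1 <= n.+1)%N))) mulr_suml.
rewrite mean_sum => [|p]; last first.
  by apply: (RintegrableM_chi hX) => //; exact: RintegrableZ.
rewrite mulr_sumr; apply: eq_bigr => p _; rewrite -mulrA [euler_moment _ _ _ _]mxE; congr (_ * _).
rewrite -meanZ; last exact: (RintegrableM_chi hX).
by apply: eq_Rintegral => w _; rewrite mulrA.
Qed.

End Step.
End EulerMoments.

Section StepMatrix.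
Context (R : realType) (d : nat) (Q : 'M[R]_d) (alpha gamma sigma : 'cV[R]_d).
Variable m : nat -> R -> R.
Hypothesis hm : forall q, expands (m q) (q == 0%N)%:R (q == 2%N)%:R.
Local Notation al i := (alpha i 0).
Local Notation ga i := (gamma i 0).
Local Notation sig i := (sigma i 0).

(** A jump part, with [Q] transposed and no change of order, plus a part diagonal in the state:
    exactly the two first-order terms in the product of the expansions of the transition matrix and
    of [euler_poly]. *)
Lemma moment_blockE k p i l : moment_block Q alpha gamma sigma k p i l =
  (p == k)%:R * Q l i + (l == i)%:R * generator_coef (al l) (ga l) (sig l) k p.
Proof.
have n1 (x : nat) : (x == x.+1) = false by rewrite ltn_eqF.
have n2 (x : nat) : (x == x.+2) = false by rewrite ltn_eqF.
have n1' (x : nat) : (x.+1 == x) = false by rewrite gtn_eqF.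
have n2' (x : nat) : (x.+2 == x) = false by rewrite gtn_eqF.
rewrite /moment_block /generator_coef.
have [->|pk] := eqVneq p k.
  by rewrite n1' n2' !mxE eq_sym; case: eqP => [->|_]; rewrite ?mulr1n ?mulr0n; ring.
have [<-|pk1] := eqVneq p.+1 k.
  by rewrite n1' !mxE eq_sym; case: eqP => [->|_]; rewrite ?mulr1n ?mulr0n; ring.
have [<-|pk2] := eqVneq p.+2 k.
  by rewrite !mxE eq_sym; case: eqP => [->|_]; rewrite ?mulr1n ?mulr0n; ring.
by rewrite mxE /=; ring.
Qed.

Definition step_mx n (s : R) : 'M[R]_(\sum_(k < n.+1) d) :=
  \mxblock_(k < n.+1, p < n.+1) \matrix_(i, l)
    (expmx (s ^+ 2 *: Q) l i * (euler_poly (al l) (ga l) (sig l) m k s)`_p).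

Lemma expands_step_mx n a b :
  expands (fun s => step_mx n s a b) (a == b)%:R (moment_mx Q alpha gamma sigma n a b).
Proof.
pose k := tagnat.sig1 a; pose p := tagnat.sig1 b.
pose i : 'I_d := tagnat.sig2 a; pose l : 'I_d := tagnat.sig2 b.
have ab : (a == b) = (l == i) && (p == k).
  apply/eqP/andP => [ab|[/eqP li /eqP pk]]; first by rewrite /l /i /p /k ab !eqxx.
  have tE (x y : {i : 'I_n.+1 & 'I_d}) : tag x = tag y -> tagged x = tagged y :> 'I_d -> x = y.
    by case: x y => [x1 x2] [y1 y2] /= -> ->.
  by apply: tagnat.sig_inj; exact: tE.
apply: (expands_eq (expandsM (expands_expmx Q l i)
   (expands_euler_poly (al l) (ga l) (sig l) hm k p))) => [s _||].
- by rewrite /step_mx [RHS]mxE [RHS]mxE.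
- by rewrite ab -mulnb natrM.
- by rewrite /moment_mx mxE -/k -/p -/i -/l moment_blockE addrC [Q l i * _]mulrC.
Qed.

Lemma sum_cube_bound (I : Type) (r : seq I) (F : I -> R -> R) :
  (forall i, exists C, forall s, 0 <= s -> s <= 1 -> F i s <= C * s ^+ 3) ->
  exists C, forall s, 0 <= s -> s <= 1 -> \sum_(i <- r) F i s <= C * s ^+ 3.
Proof.
move=> h; elim: r => [|i r [C hC]].
  by exists 0 => s _ _; rewrite big_nil mul0r.
have [D hD] := h i; exists (D + C) => s s0 s1.
by rewrite big_cons mulrDl lerD ?hC ?hD.
Qed.

Lemma step_mx_consistent n : exists2 C, 0 <= C & forall s, 0 <= s -> s <= 1 ->
  mxnorm1 (step_mx n s - 1%:M - s ^+ 2 *: moment_mx Q alpha gamma sigma n) <= C * s ^+ 3.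
Proof.
have [C hC] : exists C, forall s, 0 <= s -> s <= 1 ->
  mxnorm1 (step_mx n s - 1%:M - s ^+ 2 *: moment_mx Q alpha gamma sigma n) <= C * s ^+ 3.
  apply: sum_cube_bound => a; apply: sum_cube_bound => b.
  have [C hC] := expands_step_mx a b; exists C => s s0 s1.
  rewrite (le_trans _ (hC s s0 s1))//; apply: eq_ler; congr `|_|.
  move: (step_mx n s) (moment_mx _ _ _ _ n) => S A.
  by rewrite !mxE; ring.
exists C => //.
have := hC 1 ler01 (lexx 1); rewrite !expr1n mulr1; apply: le_trans.
exact: mxnorm1_ge0.
Qed.

End StepMatrix.

Section EulerMomentCvg.
Context (disp : measure_display) (T : measurableType disp) (R : realType)
  (P : probability T R) (d : nat) (Q : 'M[R]_d)
  (X : R -> T -> 'I_d) (B : R -> {RV P >-> R}).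
Variables (alpha gamma sigma : 'cV[R]_d) (m0 : R).
Hypothesis hX : is_markov_chain P Q X.
Hypothesis hB : is_brownian_motion B.
Hypothesis hXB : independent_chain_real X B.
Local Notation A n := (moment_mx Q alpha gamma sigma n).

Definition euler_stack n h j : 'cV[R]_(\sum_(k < n.+1) d) :=
  \mxcol_(k < n.+1) euler_moment X B alpha gamma sigma m0 (Num.sqrt h) j k.

Lemma euler_stackS n h j : 0 <= h -> euler_stack n h j.+1 =
  step_mx Q alpha gamma sigma (increment_moment_fun B) n (Num.sqrt h) *m euler_stack n h j.
Proof.
move=> h0; rewrite /step_mx /euler_stack mul_mxblock_mxrow.
apply: eq_mxcol => k; apply/matrixP => i z; rewrite (ord1 z) summxE.
have kn : (k <= n)%N by rewrite -ltnS.
rewrite (mean_euler_step alpha gamma sigma m0 hX hB hXB (sqrtr_ge0 h) j i kn).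
rewrite exchange_big/=; apply: eq_bigr => p _.
by rewrite [RHS]mxE; apply: eq_bigr => l _; rewrite [in RHS]mxE.
Qed.

Lemma euler_stack_cvg n (t : R) : exists2 K : R, 0 <= K &
  forall N h, 0 <= h -> h <= 1 -> N%:R * h = t ->
    vnorm1 (euler_stack n h N - expmx (t *: A n) *m euler_stack n 0 0) <= K * Num.sqrt h.
Proof.
have [C C0 hC] := step_mx_consistent Q alpha gamma sigma (expands_increment_moment hB) n.
have [K K0 hK] := euler_scheme_cvg (A n) (euler_stack n 0 0) t C0.
exists K => // N h h0 h1 Nh.
have s0 := sqrtr_ge0 h.
have s1 : Num.sqrt h <= 1 by rewrite -[leRHS]sqrtr1 ler_wsqrtr.
apply: hK; [exact: h0|exact: h1|exact: Nh| |].
  (* Before any step the scheme is [m0] at time 0 whatever the mesh, so the vector with mesh 0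
     serves as the common initial value. *)
  rewrite /euler_stack; apply: eq_mxcol => k; apply/matrixP => i z; rewrite !mxE.
  by apply: eq_Rintegral => w _; rewrite /= !mul0r.
move=> j _; rewrite euler_stackS//.
set S := step_mx _ _ _ _ _ _ _; set u := euler_stack n h j.
have -> : S *m u - u - h *: (A n *m u) =
    (S - 1%:M - Num.sqrt h ^+ 2 *: A n) *m u.
  by rewrite sqr_sqrtr// !mulmxBl mul1mx scalemxAl.
rewrite (le_trans (vnorm1_mulmx _ _))// ler_wpM2r ?vnorm1_ge0//.
rewrite (le_trans (hC _ s0 s1))//; apply: eq_ler; congr (_ * _).
by rewrite exprS sqr_sqrtr// mulrC.
Qed.

End EulerMomentCvg.

(** * Passage to the limit *)

Section MeanConvergence.
Context (disp : measure_display) (T : measurableType disp) (R : realType)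
  (P : probability T R).
Variables (f : nat -> T -> R) (g : T -> R) (C : R).
Hypothesis mf : forall l, measurable_fun setT (f l).
Hypothesis mg : measurable_fun setT g.
Hypothesis fg : {ae P, forall w, f l w @[l --> \oo] --> g w}.
Hypothesis if2 : forall l, Rintegrable P (fun w => f l w ^+ 2).
Hypothesis f2C : forall l, \int[P]_w (f l w ^+ 2) <= C.

Lemma Rintegrable_of_sqr (u : T -> R) : measurable_fun setT u ->
  Rintegrable P (fun w => u w ^+ 2) -> Rintegrable P u.
Proof.
move=> mu u2; apply: (Rintegrable_le mu (RintegrableD (Rintegrable_cst P 1) u2)) => w.
rewrite [leRHS]ger0_norm ?addr_ge0 ?sqr_ge0//= -[u w ^+ 2]real_normK ?num_real//.
by have := sqr_ge0 (`|u w| - 1); have := normr_ge0 (u w); nra.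
Qed.

(** Fatou's lemma, which provides the integrability of the limit. Multiplication by the indicator of
    the complement of a null set turns almost sure convergence into convergence everywhere. *)
Lemma sqr_limit : Rintegrable P (fun w => g w ^+ 2) /\ \int[P]_w (g w ^+ 2) <= C.
Proof.
have [N [mN N0 hN]] := fg.
pose u := fun w => g w ^+ 2.
have mu : measurable_fun setT u by exact: measurable_funX.
pose v l w : \bar R := ((f l w * \1_(~` N) w) ^+ 2)%:E.
have mv l : measurable_fun setT (v l).
  apply/measurable_EFinP; apply: measurable_funX; apply: measurable_funM => //.
  by apply: measurable_indic; exact: measurableC.
have v0 l w : setT w -> (0 <= v l w)%E by rewrite lee_fin sqr_ge0.
have aeu : (\int[P]_w (u w)%:E = \int[P]_w ((g w * \1_(~` N) w) ^+ 2)%:E)%E.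
  apply: ge0_ae_eq_integral => //.
  - exact/measurable_EFinP.
  - apply/measurable_EFinP; apply: measurable_funX; apply: measurable_funM => //.
    by apply: measurable_indic; exact: measurableC.
  - by move=> w _; rewrite lee_fin sqr_ge0.
  - by move=> w _; rewrite lee_fin sqr_ge0.
  exists N; split => // w /=; apply: contra_notP => Nw _.
  by rewrite indicE mem_set// mulr1.
have fat := fatou P measurableT mv v0.
have leC : (\int[P]_w (u w)%:E <= C%:E)%E.
  rewrite aeu; apply: (@le_trans _ _ (\int[P]_w limn_einf (v^~ w))%E).
    apply: ge0_integral_mono => w; first by rewrite lee_fin sqr_ge0.
    suff cv : v^~ w @ \oo --> ((g w * \1_(~` N) w) ^+ 2)%:E.
      by rewrite (cvg_limn_einf_sup cv).1.
    apply: cvg_EFin; first exact: nearW.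
    have [Nw|Nw] := pselect (N w).
      rewrite indicE memNset//= mulr0 expr0n/=; under eq_fun do rewrite /v/= indicE memNset//= mulr0 expr0n/=.
      exact: cvg_cst.
    have cw : f l w @[l --> \oo] --> g w by apply: contrapT => h; apply: Nw; exact: hN.
    rewrite /= indicE mem_set//= mulr1.
    have -> : fine \o v^~ w = (fun l => f l w * f l w).
      by apply/funext => l; rewrite /v/= indicE mem_set//= mulr1.
    exact: cvgM.
  rewrite (le_trans fat)// limn_einf_lim; apply: lime_le; first exact: is_cvg_einfs.
  apply: nearW => l; apply: (@le_trans _ _ (\int[P]_w (v l w))%E).
    by rewrite /einfs/=; apply: ereal_inf_lbound; exists l => /=.
  rewrite (@le_trans _ _ (\int[P]_w ((f l w ^+ 2)%:E))%E)//.
    apply: ge0_integral_mono => w; first by rewrite v0.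
    by rewrite lee_fin exprMn ler_piMr ?sqr_ge0.
  by rewrite -EFin_Rintegral// lee_fin.
have iu : Rintegrable P u.
  apply: RintegrableP => //; apply: le_lt_trans (ltry C); apply: le_trans leC.
  by apply: ge0_integral_mono => w; rewrite lee_fin// ger0_norm ?sqr_ge0.
by split => //; rewrite -lee_fin EFin_Rintegral.
Qed.

(* A bounded continuous truncation of the identity, with an error controlled by
   second moments. *)
Let phi (e x : R) : R := x * (1 + (e * x) ^+ 2)^-1.

Let den_gt0 (e x : R) : 0 < 1 + (e * x) ^+ 2.
Proof. by rewrite ltr_pwDl// sqr_ge0. Qed.

Let phi_bounded e x : 0 < e -> `|phi e x| <= e^-1.
Proof.
move=> e0; have D := den_gt0 e x; rewrite /phi normrM normfV (gtr0_norm D) ler_pdivrMr//.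
rewrite -(ler_pM2l e0) mulrA mulfV ?gt_eqF// mul1r.
have -> : e * `|x| = `|e * x| by rewrite normrM gtr0_norm.
rewrite -[(e * x) ^+ 2]real_normK ?num_real//.
by have := normr_ge0 (e * x); have := sqr_ge0 (`|e * x| - 1); nra.
Qed.

Let phi_close e x : 0 < e -> `|x - phi e x| <= e * x ^+ 2.
Proof.
move=> e0; have D := den_gt0 e x.
have -> : x - phi e x = x * (e * x) ^+ 2 / (1 + (e * x) ^+ 2).
  by rewrite /phi; field; rewrite gt_eqF.
rewrite normrM normfV (gtr0_norm D) ler_pdivrMr// normrM [`|_ ^+ 2|]ger0_norm ?sqr_ge0//.
have -> : x ^+ 2 = `|x| * `|x| by rewrite -expr2 real_normK ?num_real.
have -> : `|x| * (e * x) ^+ 2 = e * (`|x| * `|x|) * `|e * x|.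
  by rewrite exprMn -[x ^+ 2]real_normK ?num_real// normrM (gtr0_norm e0); ring.
apply: ler_wpM2l; first by rewrite mulr_ge0 ?mulr_ge0// ltW.
rewrite -[(e * x) ^+ 2]real_normK ?num_real//.
by have := normr_ge0 (e * x); have := sqr_ge0 (`|e * x| - 1); nra.
Qed.

Let phi_cvg e (u : nat -> R) (x : R) : u @ \oo --> x -> (fun l => phi e (u l)) @ \oo --> phi e x.
Proof.
move=> ux; have ex : (fun l => e * u l) @ \oo --> e * x by apply: cvgM => //; exact: cvg_cst.
apply: cvgM => //; apply: cvgV; first by rewrite gt_eqF// den_gt0.
by apply: cvgD; [exact: cvg_cst|apply: cvgM].
Qed.

Let measurable_phi e (u : T -> R) : measurable_fun setT u ->
  measurable_fun setT (fun w => phi e (u w)).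
Proof.
move=> mu; apply: (@measurableT_comp _ _ _ _ _ _ (phi e)) => //.
apply: continuous_measurable_fun => x.
apply: cvgM; first exact: cvg_id.
apply: cvgV; first by rewrite gt_eqF// den_gt0.
apply: cvgD; first exact: cvg_cst.
have ex : e * y @[y --> x] --> e * x by apply: cvgM; [exact: cvg_cst|exact: cvg_id].
exact: cvgM.
Qed.

Let phi_Rintegrable e (u : T -> R) : 0 < e -> measurable_fun setT u ->
  Rintegrable P (fun w => phi e (u w)).
Proof.
move=> e0 mu; apply: (@Rintegrable_bounded _ _ _ P _ e^-1) => [|w].
  exact: measurable_phi.
exact: phi_bounded.
Qed.

Let mean_phi_close e (u : T -> R) : 0 < e -> measurable_fun setT u ->
  Rintegrable P (fun w => u w ^+ 2) -> \int[P]_w (u w ^+ 2) <= C ->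
  `|\int[P]_w u w - \int[P]_w (phi e (u w))| <= e * C.
Proof.
move=> e0 mu u2 uC.
have iu := Rintegrable_of_sqr mu u2; have ip := phi_Rintegrable e0 mu.
have iN : Rintegrable P (fun w => -1 * phi e (u w)) by exact: RintegrableZ.
have -> : \int[P]_w u w - \int[P]_w (phi e (u w)) = \int[P]_w (u w + -1 * phi e (u w)).
  by rewrite meanD// meanZ// mulN1r.
rewrite (le_trans (ler_norm_mean (RintegrableD iu iN)))//.
apply: (@le_trans _ _ (\int[P]_w (e * u w ^+ 2))); last first.
  by rewrite meanZ// ler_wpM2l// ltW.
apply: le_mean.
- by apply: Rintegrable_norm; exact: RintegrableD.
- exact: RintegrableZ.
by move=> w; rewrite mulN1r; exact: phi_close.
Qed.

(** The bounded truncations converge in mean by dominated convergence. Replacing each variable by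
    its truncation costs at most [e * C], uniformly in [l] and also for the limit, whence the three
    thirds of [eps]. *)
Lemma mean_limit : \int[P]_w f l w @[l --> \oo] --> \int[P]_w g w.
Proof.
have [ig2 g2C] := sqr_limit.
have C0 : 0 <= C.
  by apply: le_trans g2C; apply: Rintegral_ge0 => w _; rewrite sqr_ge0.
apply/cvgrPdist_le => eps eps0.
pose e := eps / (3 * (C + 1)).
have C1 : 0 < C + 1 by rewrite ltr_wpDl.
have e0 : 0 < e by rewrite divr_gt0// mulr_gt0.
have eC : e * C <= eps / 3.
  have -> : e * C = eps / 3 * (C / (C + 1)) by rewrite /e; field; rewrite gt_eqF.
  apply: ler_piMr; first by rewrite divr_ge0// ltW.
  by rewrite ler_pdivrMr// mul1r lerDl.
have cphi : \int[P]_w (phi e (f l w)) @[l --> \oo] --> \int[P]_w (phi e (g w)).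
  have mp (u : T -> R) : measurable_fun setT u ->
      measurable_fun setT (fun w => (phi e (u w))%:E).
    by move=> mu; apply/measurable_EFinP; exact: measurable_phi.
  have [||_ _] := @dominated_convergence _ _ _ P setT measurableT
    (fun l w => (phi e (f l w))%:E) (fun w => (phi e (g w))%:E) (cst (e^-1)%:E)
    (fun l => mp _ (mf l)) (mp _ mg) _ (Rintegrable_cst P e^-1).
  - apply: filterS fg => w fw _; apply: cvg_EFin; first exact: nearW.
    exact: (phi_cvg (e := e) fw).
  - by apply: nearW => w l _; rewrite /= lee_fin phi_bounded.
  by rewrite -(EFin_Rintegral (phi_Rintegrable e0 mg)); exact: fine_cvg.
have /cvgrPdist_le /(_ (eps / 3)) := cphi.
rewrite divr_gt0// => /(_ isT); apply: filterS => l hl.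
have h1 := mean_phi_close e0 mg ig2 g2C.
have h2 := mean_phi_close e0 (mf l) (if2 l) (f2C l).
move: h1 h2 hl eC; move: (\int[P]_w g w) (\int[P]_w f l w) (\int[P]_w phi e (g w))
  (\int[P]_w phi e (f l w)) => a b c d'.
have -> : a - b = (a - c) + (c - d') + - (b - d') by ring.
move=> h1 h2 hl eC'.
rewrite (le_trans (ler_normD _ _))// normrN.
have -> : eps = eps / 3 + eps / 3 + eps / 3 by field.
apply: lerD; last exact: le_trans h2 _.
rewrite (le_trans (ler_normD _ _))//; apply: lerD => //; exact: le_trans h1 _.
Qed.

End MeanConvergence.

Section EulerLimit.
Context (disp : measure_display) (T : measurableType disp) (R : realType)
  (P : probability T R) (d : nat) (Q : 'M[R]_d)
  (X : R -> T -> 'I_d) (B M : R -> {RV P >-> R}).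
Variables (alpha gamma sigma : 'cV[R]_d) (m0 : R).
Hypothesis hX : is_markov_chain P Q X.
Hypothesis hB : is_brownian_motion B.
Hypothesis hXB : independent_chain_real X B.
Hypothesis hM : is_mmou alpha gamma sigma m0 X B M.
Local Notation eul := (euler X B alpha gamma sigma m0).
Local Notation A n := (moment_mx Q alpha gamma sigma n).
Local Notation Rintegrable := (Rintegrable P).

(** All simple integrals vanish at time 0, so the mean square errors form the constant sequence
    E[Y^2], whose limit is 0. *)
Lemma ito_integral_at0 (F : R -> set (set T)) (H : R -> T -> R) (Y : {RV P >-> R}) :
  is_ito_integral F B H 0 Y -> {ae P, forall w, Y w = 0}.
Proof.
move=> [S [aS _ cS]].
have E n : ('E_P[fun w => ((simple_integral (S n) B 0 w - Y w) ^+ 2)%R] =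
    \int[P]_w `|(Y w ^+ 2)%:E|)%E.
  rewrite unlock; apply: eq_integral => w _.
  have -> : simple_integral (S n) B 0 w = 0.
    have [s0 sS _ _] := aS n.
    have s0' i : 0 <= sp_time (S n) i by elim: i => // i IH; exact: le_trans (sS i).
    by rewrite /simple_integral big1// => i _; rewrite !min_r// subrr mulr0.
  by rewrite sub0r sqrrN gee0_abs// lee_fin sqr_ge0.
have /(cvg_lim (@ereal_hausdorff R)) := cS.
under eq_fun do rewrite E; rewrite lim_cst// => Y0.
have mY : measurable_fun setT (fun w => (Y w ^+ 2)%:E).
  by apply/measurable_EFinP; exact: measurable_funX.
have /(ae_eq_integral_abs P measurableT mY) := Y0.
apply: filterS => w /(_ I)/= [] /eqP.
by rewrite sqrf_eq0 => /eqP.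
Qed.

Lemma mmou_start : {ae P, forall w, M 0 w = m0}.
Proof.
have [_ [I [hI eM]]] := hM.
apply: filterS2 (ito_integral_at0 (hI 0 (lexx 0))) (eM 0 (lexx 0)) => w Iw ->.
by rewrite Iw addr0 set_itv1 Rintegral_set1 addr0.
Qed.

Lemma euler_approximation t : 0 <= t -> exists (h : nat -> R) (N : nat -> nat),
  [/\ forall l, 0 <= h l /\ h l <= 1, forall l, (N l)%:R * h l = t,
      Num.sqrt (h l) @[l --> \oo] --> (0 : R)
    & {ae P, forall w, eul (h l) (N l) w @[l --> \oo] --> M t w}].
Proof.
rewrite le_eqVlt => /predU1P[<-|t0].
  (* The meshes t / 4^l were positive; at time 0 the scheme without any step is used instead, and it
     agrees with [M] by [mmou_start]. *)
  exists (fun=> 0), (fun=> 0%N); split => //.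
  - by move=> l; rewrite mul0r.
  - by under eq_fun do rewrite sqrtr0; exact: cvg_cst.
  - by apply: filterS mmou_start => w ->; exact: cvg_cst.
have [cM [I [hI eM]]] := hM.
have [G [mG PG hG]] := right_continuity_set hX.
pose l0 := (Num.trunc t).+1.
have tl0 : t <= 4 ^+ l0.
  rewrite (le_trans (ltW (truncnS_gt t)))// -natrX ler_nat; exact/ltnW/ltn_expl.
exists (mesh t l0), (steps l0); split.
- by move=> l; rewrite (ltW (mesh_gt0 l0 t0 l)) (mesh_le1 tl0).
- by move=> l; rewrite steps_mesh.
- apply: (@squeeze_cvgr _ _ _ _ (fun=> 0) (fun l => 2^-1 ^+ l)).
  + by apply: nearW => l; rewrite sqrtr_ge0 (sqrt_mesh_le tl0).
  + exact: cvg_cst.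
  + by apply: cvg_expr; rewrite ger0_norm// invf_lt1// ltr1n.
exact: (ae_euler_cvg hX hB hXB t0 tl0 mG PG hG hI cM eM).
Qed.

Lemma euler_stack_entry n (h : R) j k i : 0 <= h -> (k <= n)%N ->
  submxcol (euler_stack X B alpha gamma sigma m0 n h j) (inord k) i 0 =
  \int[P]_w (eul h j w ^+ k * (X (j%:R * h) w == i)%:R).
Proof.
move=> h0 kn; rewrite /euler_stack mxcolK mxE sqr_sqrtr//.
by apply: eq_Rintegral => w _; rewrite inordK.
Qed.

Local Notation flow n t :=
  (expmx (t *: A n) *m euler_stack X B alpha gamma sigma m0 n 0 0).

Lemma euler_entry_cvg n (h : nat -> R) (N : nat -> nat) t k i :
  (forall l, 0 <= h l /\ h l <= 1) -> (forall l, (N l)%:R * h l = t) ->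
  Num.sqrt (h l) @[l --> \oo] --> (0 : R) -> (k <= n)%N ->
  \int[P]_w (eul (h l) (N l) w ^+ k * (X t w == i)%:R) @[l --> \oo]
     --> submxcol (flow n t) (inord k) i 0.
Proof.
move=> h01 Nh sh kn.
have [K K0 hK] := euler_stack_cvg alpha gamma sigma m0 hX hB hXB n t.
have Ks : K * Num.sqrt (h l) @[l --> \oo] --> (0 : R).
  by rewrite -[X in _ --> X](mulr0 K); apply: cvgM => //; exact: cvg_cst.
apply/cvgrPdist_le => e e0.
move/cvgrPdist_le : Ks => /(_ e e0); apply: filterS => l.
have [h0 h1] := h01 l.
rewrite sub0r normrN ger0_norm; last by rewrite mulr_ge0// sqrtr_ge0.
have := euler_stack_entry (N l) i h0 kn; rewrite Nh => <-.
apply: le_trans; rewrite distrC.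
apply: le_trans (hK (N l) (h l) h0 h1 (Nh l)).
apply: le_trans (ler_coord_vnorm1 _ (tagnat.Rank (inord k) i)).
by rewrite !mxE.
Qed.

Lemma mmou_moment t k i n : 0 <= t -> (k <= n)%N ->
  Rintegrable (fun w => (M t w ^+ k * (X t w == i)%:R) ^+ 2) /\
  \int[P]_w (M t w ^+ k * (X t w == i)%:R) = submxcol (flow n t) (inord k) i 0.
Proof.
move=> t0 kn.
have [h [N [h01 Nh sh ae]]] := euler_approximation t0.
pose f l w := eul (h l) (N l) w ^+ k * (X t w == i)%:R.
pose g w := M t w ^+ k * (X t w == i)%:R.
have ieul l j q : Rintegrable (fun w => eul (h l) j w ^+ q).
  have [hl0 hl1] := h01 l.
  have := euler_moment_integrable alpha gamma sigma m0 hX hB hXB (Num.sqrt (h l)) j q.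
  by rewrite sqr_sqrtr.
(* An indicator is its own square, so the second moments of [f] are moments of order [k * 2] of the
   scheme. They converge to an entry of the flow of that higher order and are therefore bounded. *)
have f2 l w : f l w ^+ 2 = eul (h l) (N l) w ^+ (k * 2) * (X t w == i)%:R.
  by rewrite /f exprMn -exprM; case: (X t w == i); rewrite ?expr1n ?expr0n.
have mf l : measurable_fun setT (f l).
  apply: measurable_funM; first exact: Rintegrable_measurable (ieul l (N l) k).
  exact: (measurable_chi hX).
have mg : measurable_fun setT g.
  by apply: measurable_funM; [exact: measurable_funX|exact: (measurable_chi hX)].
have fg : {ae P, forall w, f l w @[l --> \oo] --> g w}.
  apply: filterS ae => w ew; apply: cvgM; last exact: cvg_cst.
  elim: (k) => [|q IH]; first by under eq_fun do rewrite expr0; exact: cvg_cst.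
  by under eq_fun do rewrite exprS; rewrite exprS; apply: cvgM.
have if2 l : Rintegrable (fun w => f l w ^+ 2).
  under eq_fun do rewrite f2.
  exact: (RintegrableM_chi hX).
have [C f2C] : exists C, forall l, \int[P]_w (f l w ^+ 2) <= C.
  have c2 := @euler_entry_cvg _ _ _ _ _ i h01 Nh sh (leqnn (k * 2)%N).
  have /cvg_seq_bounded [C [_ hC]] : cvgn (fun l =>
     \int[P]_w (eul (h l) (N l) w ^+ (k * 2) * (X t w == i)%:R)).
    by apply/cvg_ex; eexists; exact: c2.
  exists (C + 1) => l; under eq_Rintegral do rewrite f2.
  apply: (le_trans (ler_norm _)); apply: (hC (C + 1) _ l I).
  by rewrite ltrDl.
split; first by have [] := sqr_limit mf mg fg if2 f2C.
have c1 := mean_limit mf mg fg if2 f2C.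
have c2 := @euler_entry_cvg _ _ _ _ _ i h01 Nh sh kn.
exact: (cvg_unique _ c1 c2).
Qed.

Lemma mmou_pow_integrable t k : 0 <= t -> Rintegrable (fun w => M t w ^+ k).
Proof.
move=> t0.
have -> : (fun w => M t w ^+ k) = (fun w => \sum_i M t w ^+ k * (X t w == i)%:R).
  by apply/funext => w; rewrite -mulr_sumr sum_chi mulr1.
apply: Rintegrable_sum => i.
have [i2 _] := mmou_moment i t0 (leqnn k).
apply: Rintegrable_of_sqr i2.
by apply: measurable_funM; [exact: measurable_funX|exact: (measurable_chi hX)].
Qed.

Lemma H_momentE k t i :
  H_moment X M k t i 0 = \int[P]_w (M t w ^+ k * (X t w == i)%:R).
Proof.
rewrite mxE unlock /Rintegral; congr fine; apply: eq_integral => w _.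
by rewrite mxE.
Qed.

Lemma H_stack_flow n t : 0 <= t ->
  H_stack X M n t = expmx (t *: A n) *m H_stack X M n 0.
Proof.
have H u : 0 <= u -> H_stack X M n u = flow n u.
  move=> u0; rewrite /H_stack -[RHS]submxcolK; apply: eq_mxcol => k.
  apply/matrixP => i z; rewrite (ord1 z) H_momentE.
  have kn : (k <= n)%N by rewrite -ltnS.
  by rewrite (mmou_moment i u0 kn).2 inord_val.
(* At time 0 the flow is the identity, so the initial vector of the scheme is the moment stack of
   [M] itself. *)
by move=> t0; rewrite (H t t0); congr (_ *m _); rewrite (H 0 (lexx 0)) expmx0 mul1mx.
Qed.

End EulerLimit.

Section MomentEquation.
Context (R : realType) (d : nat) (Q : 'M[R]_d) (alpha gamma sigma : 'cV[R]_d).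
Local Notation block := (moment_block Q alpha gamma sigma).

(** For k = 0 and k = 1 the truncated predecessors [k.-1] and [k.-2] denote no genuine lower order,
    but the coefficients k and k (k - 1) vanish there. *)
Lemma sum_moment_block k (H : nat -> 'cV[R]_d) :
  \sum_(p < k.+1) block k p *m H p =
  (Q^T - k%:R *: diag_mx gamma^T) *m H k + k%:R *: (diag_mx alpha^T *m H k.-1)
  + (2^-1 * k%:R * (k%:R - 1)) *:
      (diag_mx (map_mx (fun x => x ^+ 2) sigma)^T *m H k.-2).
Proof.
have diagE i : block i i = Q^T - i%:R *: diag_mx gamma^T by rewrite /moment_block eqxx.
have subE i : block i.+1 i = i.+1%:R *: diag_mx alpha^T.
  by rewrite /moment_block ltn_eqF// eqxx.
rewrite big_ord_recr/= diagE -addrA addrC; congr (_ + _).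
case: k => [|k]; first by rewrite big_ord0 mulr0 mul0r !scale0r addr0.
rewrite big_ord_recr/= subE -scalemxAl addrC; congr (_ + _).
case: k => [|k]; first by rewrite big_ord0 subrr mulr0 scale0r.
rewrite big_ord_recr/= big1 ?add0r => [|p _].
  by rewrite scalemxAl /moment_block ltn_eqF// eqSS ltn_eqF// eqxx.
have pk := ltn_ord p.
by rewrite /moment_block !eqSS (ltn_eqF pk) (ltn_eqF (leqW pk)) (ltn_eqF (leqW (leqW pk))) mul0mx.
Qed.

Lemma moment_mx_mxcol n (H : nat -> 'cV[R]_d) (k : 'I_n.+1) :
  submxcol (moment_mx Q alpha gamma sigma n *m \mxcol_(p < n.+1) H p) k =
  \sum_(p < n.+1) block k p *m H p.
Proof. by rewrite /moment_mx mul_mxblock_mxrow mxcolK. Qed.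

Lemma has_derivative_submxcol n (f : R -> 'cV[R]_(\sum_(k < n.+1) d)) t v (k : 'I_n.+1) :
  has_derivative_nonneg f t v ->
  has_derivative_nonneg (fun s => submxcol (f s) k) t (submxcol v k).
Proof.
move=> fv i; have := fv (tagnat.Rank k i); rewrite [submxcol v k i 0]mxE; apply: cvg_trans; apply: near_eq_cvg; apply: nearW => h.
by rewrite ![submxcol _ k i 0]mxE.
Qed.

End MomentEquation.

Theorem mainTheorem8 (disp : measure_display) (T : measurableType disp)
    (R : realType) (P : probability T R) (d : nat) (Q : 'M[R]_d)
    (X : R -> T -> 'I_d) (B M : R -> {RV P >-> R})
    (alpha gamma sigma : 'cV[R]_d) (m0 : R)
    (hQ : is_generator Q)
    (hX : is_markov_chain P Q X)
    (hB : is_brownian_motion B)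
    (hXB : independent_chain_real X B)
    (hgamma : forall i, 0 < gamma i 0)
    (hM : is_mmou alpha gamma sigma m0 X B M) :
  [/\ forall (k : nat) (t : R), 0 <= t ->
        P.-integrable [set: T] (EFin \o (fun w => M t w ^+ k)),
      forall (k : nat) (t : R), 0 <= t ->
        has_derivative_nonneg (H_moment X M k) t
          ((Q^T - k%:R *: diag_mx gamma^T) *m H_moment X M k t
           + k%:R *: (diag_mx alpha^T *m H_moment X M k.-1 t)
           + (2^-1 * k%:R * (k%:R - 1)) *:
               (diag_mx (map_mx (fun x => x ^+ 2) sigma)^T
                  *m H_moment X M k.-2 t)),
      forall (n : nat) (t : R), 0 <= t ->
        H_stack X M n t =
          expmx (t *: moment_mx Q alpha gamma sigma n) *m H_stack X M n 0
    & forall (k : nat) (t : R), 0 <= t ->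
        ('E_P[fun w => (M t w ^+ k)%R])%E
          = (((const_mx 1 : 'cV[R]_d)^T *m H_moment X M k t) 0 0)%:E ].
Proof.
have iM k t (t0 : 0 <= t) := mmou_pow_integrable hX hB hXB hM k t0.
have flow n t (t0 : 0 <= t) := H_stack_flow hX hB hXB hM n t0.
split => [//|k t t0|//|k t t0].
(* The equation of order [k] is the last block row of the closed linear system truncated at n =
   k. *)
- have := has_derivative_submxcol (k := ord_max) (expmx_flow_has_derivative (flow k) t0).
  have -> : submxcol (moment_mx Q alpha gamma sigma k *m H_stack X M k t) ord_max = _ :=
    etrans (moment_mx_mxcol Q alpha gamma sigma (fun p => H_moment X M p t) ord_max)
      (sum_moment_block Q alpha gamma sigma k (fun p => H_moment X M p t)).
  suff -> : (fun s => submxcol (H_stack X M k s) ord_max) = H_moment X M k by [].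
  by apply/funext => s; rewrite /H_stack mxcolK.
- rewrite unlock -(EFin_Rintegral (iM k t t0)); congr EFin.
  rewrite mxE; under [RHS]eq_bigr do rewrite [_^T _ _]mxE [const_mx _ _ _]mxE mul1r H_momentE.
  rewrite -mean_sum => [|i]; last by apply: (RintegrableM_chi hX) => //; exact: iM.
  by apply: eq_Rintegral => w _; rewrite -mulr_sumr sum_chi mulr1.
Qed.
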